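(* Let $M\ge1$, $n\ge1$, $l\ge 1$ and $\nu_1,\ldots,\nu_M\ge0$ be integers with $l\ge 2n+\nu_1$, put $\nu_0=0$, and let $K_n$ be the correlation kernel $K_n(x,y)=\sum_{k=0}^{n-1}P_k(x)Q_k(y)$ associated with the functions $w_0,\ldots,w_{n-1}$ (see context). Then for $x,y>0$, $$K_n(x,y)=\frac{1}{(2\pi i)^2}\int_{-1/2-i\infty}^{-1/2+i\infty}ds\oint_\Sigma dt\;\prod_{j=0}^M\frac{\Gamma(s+1+\nu_j)}{\Gamma(t+1+\nu_j)}\;\frac{\Gamma(t+1-n)\,\Gamma(t+l-n+1)}{\Gamma(s+1-n)\,\Gamma(s+l-n+1)}\;\frac{x^t y^{-s-1}}{s-t},$$ where $\Sigma$ is a closed contour encircling $0,1,\ldots,n$ once in the positive direction such that $\operatorname{Re}t>-1/2$ for $t\in\Sigma$.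
   Context: For $k=0,\ldots,n-1$ and $x>0$ let (with any $c>0$) $$w_k(x)=\frac{1}{2\pi i}\int_{c-i\infty}^{c+i\infty}\frac{\Gamma(s+\nu_1+k)\prod_{j=2}^M\Gamma(s+\nu_j)}{\Gamma(s+l-2n+1+k)}\,x^{-s}\,ds,$$ i.e. the Meijer G-function $G^{M,0}_{1,M}\left(\begin{matrix} l-2n+1+k\\ \nu_M,\ldots,\nu_2,\nu_1+k\end{matrix}\,\Big|\,x\right)$. Here $x^{t}=e^{t\log x}$ with real $\log x$. Integrals over vertical lines are absolutely convergent when $M\ge2$; when $M=1$ they are understood as $\lim_{R\to\infty}\int_{c-iR}^{c+iR}$. $P_k$ is the monic polynomial of degree $k$ with $\int_0^\infty P_k(x)w_j(x)\,dx=0$ for $j=0,\ldots,k-1$. $Q_k$ is the function in the linear span of $w_0,\ldots,w_k$ with $\int_0^\infty x^jQ_k(x)\,dx=\delta_{j,k}$ for $j=0,\ldots,k$. *)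

(* Defs.v *)
From Stdlib Require Export Reals ZArith List.
From Coquelicot Require Export Coquelicot.

Open Scope R_scope.

(** * Complex exponential, powers of a positive real, Euler's Gamma function *)

Definition Cexp (z : C) : C :=
  (RtoC (exp (Re z)) * (cos (Im z), sin (Im z)))%C.

(* [x ^ z] for [x > 0], with the real logarithm of [x]. *)
Definition Cpowr (x : R) (z : C) : C := Cexp (z * RtoC (ln x))%C.

(* Product over [a <= j <= b]; it is [1] if [b < a]. *)
Definition Cprod (f : nat -> C) (a b : nat) : C :=
  fold_right Cmult (RtoC 1) (map f (List.seq a (S b - a))).

(* Complex-valued (improper) Riemann integrals of a real variable. *)
Definition is_CRInt (f : R -> C) (a b : R) (v : C) : Prop :=
  is_RInt (V := C_R_NormedModule) f a b v.

Definition CRInt (f : R -> C) (a b : R) : C :=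
  RInt (V := C_R_CompleteNormedModule) f a b.

Definition is_CRInt_0oo (f : R -> C) (v : C) : Prop :=
  is_RInt_gen (V := C_R_NormedModule) f (at_right 0) (Rbar_locally p_infty) v.

Definition CRInt_0oo (f : R -> C) : C :=
  RInt_gen (V := C_R_CompleteNormedModule)
    f (at_right 0) (Rbar_locally p_infty).

Definition Gamma_int (z : C) : C :=
  CRInt_0oo (fun x => RtoC (exp (- x)) * Cpowr x (z - 1))%C.

(* Least natural number [m] with [Re z + m > 0]. *)
Definition Gamma_shift (z : C) : nat := Z.to_nat (up (- Re z)).

(* Euler's integral, continued to the left by
   [Gamma z = Gamma (z + m) / (z (z + 1) ... (z + m - 1))];
   for [Re z > 0] one has [m = 0].  The value at the poles
   [0, -1, -2, ...] is meaningless. *)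
Definition Gamma (z : C) : C :=
  let m := Gamma_shift z in
  (Gamma_int (z + INR m)
   / fold_right Cmult (RtoC 1) (map (fun i => z + INR i) (List.seq 0 m)))%C.

(** * Integrals over vertical lines *)

Definition is_vint_sym (f : C -> C) (c : R) (v : C) : Prop :=
  filterlimi (fun T => is_CRInt (fun u => Ci * f (c, u))%C (- T) T)
    (Rbar_locally p_infty) (locally (T := C_UniformSpace) v).

Definition vint_abs_cv (f : C -> C) (c : R) : Prop :=
  ex_RInt_gen (fun u => Cmod (f (c, u)))
    (Rbar_locally m_infty) (Rbar_locally p_infty).

(* [v] is the integral of [f] over the upward line [Re s = c].  For [M >= 2]
   it is an absolutely convergent integral (whose value is then the symmetric
   limit); for [M = 1] it is the symmetric limit only. *)
Definition is_vint (M : nat) (f : C -> C) (c : R) (v : C) : Prop :=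
  is_vint_sym f c v /\ ((2 <= M)%nat -> vint_abs_cv f c).

Definition vint (M : nat) (f : C -> C) (c : R) : C :=
  iota (T := C_R_CompleteNormedModule) (is_vint M f c).

Definition twopii : C := (2 * PI * Ci)%C.

(** * Closed contours *)

Definition C1_path (g : R -> C) : Prop :=
  exists dg : R -> C,
    forall u, is_derive (V := C_R_NormedModule) g u (dg u)
              /\ continuous (U := C_UniformSpace) dg u.

Definition piecewise_C1 (g : R -> C) (a b : R) : Prop :=
  exists (m : nat) (p : nat -> R),
    p 0%nat = a /\ p m = b /\
    forall i, (i < m)%nat ->
      p i < p (S i) /\
      exists h, C1_path h /\ forall u, p i <= u <= p (S i) -> g u = h u.

Definition closed_contour (g : R -> C) (a b : R) : Prop :=
  a < b /\ piecewise_C1 g a b /\ g a = g b.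

(* For a piecewise C1 path, [path_derive] is the derivative except at the
   finitely many break points and end points, which do not affect the
   integral. *)
Definition path_derive (g : R -> C) (u : R) : C :=
  (Derive (fun v => Re (g v)) u, Derive (fun v => Im (g v)) u).

Definition contour_int (g : R -> C) (a b : R) (f : C -> C) : C :=
  CRInt (fun u => f (g u) * path_derive g u)%C a b.

(* The point [z] is off the contour and has winding number [1]. *)
Definition encircles_once (g : R -> C) (a b : R) (z : C) : Prop :=
  (forall u, a <= u <= b -> g u <> z) /\
  (/ twopii * contour_int g a b (fun t => / (t - z)))%C = RtoC 1.

(** * The weights, the biorthogonal system and its kernel *)

Definition w_integrand (M n l : nat) (nu : nat -> nat) (k : nat) (x : R)
    (s : C) : C :=
  (Gamma (s + INR (nu 1%nat) + INR k)
   * Cprod (fun j => Gamma (s + INR (nu j))) 2 M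
   / Gamma (s + INR l - 2 * INR n + 1 + INR k)
   * Cpowr x (- s))%C.

Definition w (M n l : nat) (nu : nat -> nat) (c : R) (k : nat) (x : R) : C :=
  (/ twopii * vint M (w_integrand M n l nu k x) c)%C.

Definition monic_poly (k : nat) (p : R -> C) : Prop :=
  exists a : nat -> C,
    a k = RtoC 1 /\
    forall x, p x = sum_n (fun i => a i * RtoC (x ^ i))%C k.

Definition in_span (w : nat -> R -> C) (k : nat) (q : R -> C) : Prop :=
  exists b : nat -> C,
    forall x, 0 < x -> q x = sum_n (fun i => b i * w i x)%C k.

Definition is_Pk (w : nat -> R -> C) (k : nat) (p : R -> C) : Prop :=
  monic_poly k p /\
  forall j, (j < k)%nat -> is_CRInt_0oo (fun x => p x * w j x)%C (RtoC 0).

Definition is_Qk (w : nat -> R -> C) (k : nat) (q : R -> C) : Prop :=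
  in_span w k q /\
  forall j, (j <= k)%nat ->
    is_CRInt_0oo (fun x => RtoC (x ^ j) * q x)%C
      (RtoC (if Nat.eqb j k then 1 else 0)).

(* Meant for [n >= 1] only. *)
Definition kernel (n : nat) (P Q : nat -> R -> C) (x y : R) : C :=
  sum_n (fun k => P k x * Q k y)%C (n - 1).

Definition kernel_integrand (M n l : nat) (nu : nat -> nat) (x y : R)
    (s t : C) : C :=
  (Cprod (fun j => Gamma (s + 1 + INR (nu j)) / Gamma (t + 1 + INR (nu j))) 0 M
   * (Gamma (t + 1 - INR n) * Gamma (t + INR l - INR n + 1)
      / (Gamma (s + 1 - INR n) * Gamma (s + INR l - INR n + 1)))
   * (Cpowr x t * Cpowr y (- s - 1) / (s - t)))%C.

(* Main.v *)
Require Import Defs.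
From Stdlib Require Import Lra Lia Psatz FunctionalExtensionality Arith.

(* Both sides are the same linear combination of the weights.  Write
   [int w_k x^j dx = G_k (j + 1)], where [G_k] is the Mellin transform under the
   integral defining [w_k].  Biorthogonality says exactly that
   [K_n (x, .) = sum_i beta_i w_i] with [sum_i beta_i G_i (j + 1) = x^j] for
   [j < n].  All the [G_i] with [i < n] are a common factor [rho] times a polynomial
   of degree at most [n - 1], so [sum_i beta_i G_i = rho p], where [p] is the
   polynomial interpolating [x^j / rho (j + 1)] at the points [j + 1], [j < n].  On the
   other side, the inner integrand has simple poles at [0, ..., n - 1] only,
   because [Gamma] has no zeros, and the sum of its residues is the Lagrange
   interpolation formula for [p].  The outer integral is then the sum of the
   integrals defining [beta_i w_i], taken over [Re s = 1 / 2].

   The moments of [w_k] come from moving the line of integration across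
   [s = j + 1]: the line on its left serves for [0 < x < 1], the one on its right
   for [x > 1].  For [M = 1] the integrals converge only conditionally and [w_k]
   is computed by partial fractions and Perron's formula. *)

(** The inner contour integral is evaluated in closed form for every [s] on the line, so the two
    integrations are never interchanged; of [P k] and [Q k] only the defining relations enter. The
    complex analysis rests on one construction: for [H] holomorphic on a half-plane, [F t = int_0^1
    (H (k + r (t - k)) - H k) / r dr] is a primitive of [(H t - H k) / (t - k)] off [k]. Subtracting
    [H k / (t - k)] thus leaves a function with a primitive, on a closed contour as on the boundary
    of a rectangle: residues reduce to the winding number, and shifts of lines to the explicit
    integral of [1 / (t - k)]. The condition [l >= 2 n + nu_1] makes [Gamma (s + nu_1 + k) / Gamma
    (s + l - 2 n + 1 + k)] the reciprocal of a product of at least one linear factor; completing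
    these products to a common one, with last denominator [Gamma (s + 1 + l - n)] after the shift by
    one, is what produces [rho]. *)

(** * Modulus, limits and continuity of complex-valued functions *)

Lemma Cmod_sub_le (z w : C) : Cmod (z - w) <= Cmod z + Cmod w.
Proof.
  unfold Cminus. eapply Rle_trans; [apply Cmod_triangle|].
  rewrite Cmod_opp. apply Rle_refl.
Qed.

Lemma Im_le_Cmod (z : C) : Rabs (Im z) <= Cmod z.
Proof. eapply Rle_trans; [apply Rmax_r|apply Rmax_Cmod]. Qed.

Lemma Cmod_le_sum (z : C) : Cmod z <= Rabs (Re z) + Rabs (Im z).
Proof.
  destruct z as [a b]. unfold Re, Im; simpl.
  replace (a, b) with (RtoC a + Ci * RtoC b)%C
    by (unfold Cplus, Cmult, RtoC, Ci; simpl; f_equal; ring).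
  eapply Rle_trans; [apply Cmod_triangle|].
  rewrite Cmod_mult, Cmod_Ci, !Cmod_R. lra.
Qed.

Lemma C_ball_Cmod (z w : C) (e : R) :
  Cmod (w - z) < e -> ball (M := C_UniformSpace) z e w.
Proof. intro H. apply C_NormedModule_mixin_compat1. exact H. Qed.

(** Balls of [C_UniformSpace] are squares, and the modulus is at most the sum of the two
    coordinates; hence the halved radius. *)
Lemma Cmod_C_ball (z w : C) (e : R) :
  ball (M := C_UniformSpace) z (e / 2) w -> Cmod (w - z) < e.
Proof.
  intros [H1 H2].
  eapply Rle_lt_trans; [apply Cmod_le_sum|].
  change (Rabs (fst w - fst z) < e / 2) in H1.
  change (Rabs (snd w - snd z) < e / 2) in H2.
  change (Re (w - z)) with (fst w + - fst z)%R.
  change (Im (w - z)) with (snd w + - snd z)%R.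
  unfold Rminus in H1, H2. lra.
Qed.

Lemma Cnorm_R (z : C) : norm (V := C_R_NormedModule) z = Cmod z.
Proof.
  change (prod_norm z = Cmod z). unfold prod_norm, Cmod. f_equal.
  change (norm (fst z)) with (Rabs (fst z)).
  change (norm (snd z)) with (Rabs (snd z)).
  now rewrite !pow2_abs.
Qed.

Lemma filterlim_C {T} (F : (T -> Prop) -> Prop) {FF : Filter F} (f : T -> C) (v : C) :
  filterlim f F (locally (T := C_UniformSpace) v) <->
  forall e, 0 < e -> F (fun x => Cmod (f x - v) < e).
Proof.
  rewrite (filterlim_locally (U := C_UniformSpace) f v). split.
  - intros H e He. assert (He' : 0 < e / 2) by lra.
    generalize (H (mkposreal _ He')). apply filter_imp.
    intros x Hx. now apply Cmod_C_ball.
  - intros H e. generalize (H e (cond_pos e)). apply filter_imp.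
    intros x Hx. now apply C_ball_Cmod.
Qed.

Notation contC := (continuous (U := C_UniformSpace)).

Section Continuity.
Context {U : UniformSpace}.

Lemma continuous_pair (f : U -> C) (x : U) :
  continuous (fun u => Re (f u)) x -> continuous (fun u => Im (f u)) x ->
  contC f x.
Proof.
  intros H1 H2. apply filterlim_locally. intros e.
  generalize (filter_and _ _ (proj1 (filterlim_locally _ _) H1 e)
    (proj1 (filterlim_locally _ _) H2 e)).
  apply filter_imp. intros y [A B]. split; assumption.
Qed.

Lemma continuous_Re (f : U -> C) (x : U) :
  contC f x -> continuous (fun u => Re (f u)) x.
Proof.
  intros H. apply filterlim_locally. intros e.
  generalize (proj1 (filterlim_locally (U := C_UniformSpace) _ _) H e).
  apply filter_imp. intros y [A B]. exact A.
Qed.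

Lemma continuous_Im (f : U -> C) (x : U) :
  contC f x -> continuous (fun u => Im (f u)) x.
Proof.
  intros H. apply filterlim_locally. intros e.
  generalize (proj1 (filterlim_locally (U := C_UniformSpace) _ _) H e).
  apply filter_imp. intros y [A B]. exact B.
Qed.

Lemma continuous_Cplus (f g : U -> C) (x : U) :
  contC f x -> contC g x ->
  contC (fun u => f u + g u)%C x.
Proof.
  intros Hf Hg. apply continuous_pair; simpl.
  - apply (continuous_plus (V := R_NormedModule)); now apply continuous_Re.
  - apply (continuous_plus (V := R_NormedModule)); now apply continuous_Im.
Qed.

Lemma continuous_Copp (f : U -> C) (x : U) :
  contC f x ->
  contC (fun u => - f u)%C x.
Proof.
  intros Hf. apply continuous_pair; simpl.
  - apply (continuous_opp (V := R_NormedModule)); now apply continuous_Re.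
  - apply (continuous_opp (V := R_NormedModule)); now apply continuous_Im.
Qed.

Lemma continuous_Cminus (f g : U -> C) (x : U) :
  contC f x -> contC g x ->
  contC (fun u => f u - g u)%C x.
Proof. intros Hf Hg. apply continuous_Cplus; [|apply continuous_Copp]; assumption. Qed.

Lemma continuous_Cmult (f g : U -> C) (x : U) :
  contC f x -> contC g x ->
  contC (fun u => f u * g u)%C x.
Proof.
  intros Hf Hg. apply continuous_pair; simpl.
  - apply (continuous_minus (V := R_NormedModule)); apply (continuous_mult (K := R_AbsRing));
      [apply continuous_Re|apply continuous_Re|apply continuous_Im|apply continuous_Im]; assumption.
  - apply (continuous_plus (V := R_NormedModule)); apply (continuous_mult (K := R_AbsRing));
      [apply continuous_Re|apply continuous_Im|apply continuous_Im|apply continuous_Re]; assumption.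
Qed.

Lemma continuous_Cconst (c : C) (x : U) :
  contC (fun _ => c) x.
Proof. apply continuous_const. Qed.

Lemma continuous_RtoC (f : U -> R) (x : U) :
  continuous f x -> contC (fun u => RtoC (f u)) x.
Proof.
  intros H. apply continuous_pair; simpl; [exact H|apply continuous_const].
Qed.

Lemma continuous_Cinv (f : U -> C) (x : U) :
  f x <> 0 -> contC f x ->
  contC (fun u => / f u)%C x.
Proof.
  intros H0 Hf.
  assert (Hn : (Re (f x) ^ 2 + Im (f x) ^ 2 <> 0)%R).
  { rewrite <- Cmod2_alt. apply pow_nonzero. intro E.
    apply H0. now apply Cmod_eq_0. }
  assert (Hc : continuous (fun u => / (Re (f u) ^ 2 + Im (f u) ^ 2))%R x).
  { apply (continuous_comp (fun u => (Re (f u) ^ 2 + Im (f u) ^ 2)%R) Rinv).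
    - apply (continuous_ext (fun u => plus (mult (Re (f u)) (Re (f u)))
         (mult (Im (f u)) (Im (f u))))).
      + intros u. unfold plus, mult; simpl. ring.
      + apply (continuous_plus (V := R_NormedModule)); apply (continuous_mult (K := R_AbsRing));
        [apply continuous_Re|apply continuous_Re|apply continuous_Im|apply continuous_Im]; assumption.
    - now apply continuous_Rinv. }
  apply continuous_pair; simpl.
  - apply (continuous_mult (K := R_AbsRing)); [now apply continuous_Re|exact Hc].
  - apply (continuous_mult (K := R_AbsRing)); [|exact Hc].
    apply (continuous_opp (V := R_NormedModule)). now apply continuous_Im.
Qed.

Lemma continuous_Cdiv (f g : U -> C) (x : U) :
  g x <> 0 -> contC f x ->
  contC g x ->
  contC (fun u => f u / g u)%C x.
Proof. intros H0 Hf Hg. apply continuous_Cmult; [|apply continuous_Cinv]; assumption. Qed.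

Lemma continuous_Cexp (f : U -> C) (x : U) :
  contC f x ->
  contC (fun u => Cexp (f u)) x.
Proof.
  intros Hf. unfold Cexp. apply continuous_Cmult.
  - apply continuous_RtoC.
    apply (continuous_comp (fun u => Re (f u)) exp);
      [now apply continuous_Re|apply continuous_exp].
  - apply continuous_pair; simpl.
    + apply (continuous_comp (fun u => Im (f u)) cos);
      [now apply continuous_Im|apply continuous_cos].
    + apply (continuous_comp (fun u => Im (f u)) sin);
      [now apply continuous_Im|apply continuous_sin].
Qed.

Lemma continuous_Cmod (f : U -> C) (x : U) :
  contC f x -> continuous (fun u => Cmod (f u)) x.
Proof.
  intros Hf.
  apply (continuous_ext (fun u => norm (V := C_R_NormedModule) (f u))).
  - intros u. apply Cnorm_R.
  - apply (continuous_comp (V := C_UniformSpace) f (fun z => norm (V := C_R_NormedModule) z) x Hf).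
    apply (filterlim_norm (V := C_R_NormedModule)).
Qed.

End Continuity.

Lemma continuous_C_eps (f : C -> C) (z : C) :
  continuous (T := C_UniformSpace) (U := C_UniformSpace) f z <->
  forall e, 0 < e -> exists d, 0 < d /\
    forall w, Cmod (w - z) < d -> Cmod (f w - f z) < e.
Proof.
  unfold continuous.
  rewrite (@filterlim_C C _ (filter_filter (ProperFilter := locally_filter (T := C_UniformSpace) z)) f (f z)). split.
  - intros H e He. destruct (H e He) as [d Hd].
    exists d. split; [apply cond_pos|]. intros w Hw. apply Hd. now apply C_ball_Cmod.
  - intros H e He. destruct (H e He) as [d [Hd0 Hd]].
    assert (Hd2 : 0 < d / 2) by lra.
    exists (mkposreal _ Hd2). intros w Hw. apply Hd. apply Cmod_C_ball. exact Hw.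
Qed.

(** * Integrals of complex functions of a real variable *)

Lemma is_CRInt_components (f : R -> C) (a b : R) (v : C) :
  is_CRInt f a b v <->
  is_RInt (fun u => Re (f u)) a b (Re v) /\ is_RInt (fun u => Im (f u)) a b (Im v).
Proof.
  split.
  - intros H. split.
    + exact (is_RInt_fct_extend_fst (U := R_NormedModule) (V := R_NormedModule) f a b v H).
    + exact (is_RInt_fct_extend_snd (U := R_NormedModule) (V := R_NormedModule) f a b v H).
  - intros [H1 H2]. destruct v as [v1 v2].
    exact (is_RInt_fct_extend_pair (U := R_NormedModule) (V := R_NormedModule) f a b v1 v2 H1 H2).
Qed.

Lemma is_CRInt_unique (f : R -> C) (a b : R) (v w : C) :
  is_CRInt f a b v -> is_CRInt f a b w -> v = w.
Proof.
  intros H1 H2.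
  rewrite <- (is_RInt_unique (V := C_R_CompleteNormedModule) f a b v H1).
  apply (is_RInt_unique (V := C_R_CompleteNormedModule) f a b w H2).
Qed.

Lemma is_CRInt_CRInt (f : R -> C) (a b : R) :
  (forall u, Rmin a b <= u <= Rmax a b -> contC f u) ->
  is_CRInt f a b (CRInt f a b).
Proof.
  intros H. apply (RInt_correct (V := C_R_CompleteNormedModule)).
  apply (ex_RInt_continuous (V := C_R_CompleteNormedModule)). exact H.
Qed.

Lemma is_CRInt_eq (f : R -> C) (a b : R) (v : C) :
  is_CRInt f a b v -> CRInt f a b = v.
Proof. apply (is_RInt_unique (V := C_R_CompleteNormedModule)). Qed.

Lemma is_CRInt_ext (f g : R -> C) (a b : R) (v : C) :
  (forall u, Rmin a b < u < Rmax a b -> f u = g u) ->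
  is_CRInt f a b v -> is_CRInt g a b v.
Proof. apply is_RInt_ext. Qed.

Lemma is_CRInt_plus (f g : R -> C) (a b : R) (v w : C) :
  is_CRInt f a b v -> is_CRInt g a b w -> is_CRInt (fun u => f u + g u)%C a b (v + w)%C.
Proof. apply (is_RInt_plus (V := C_R_NormedModule)). Qed.

Lemma is_CRInt_minus (f g : R -> C) (a b : R) (v w : C) :
  is_CRInt f a b v -> is_CRInt g a b w -> is_CRInt (fun u => f u - g u)%C a b (v - w)%C.
Proof. apply (is_RInt_minus (V := C_R_NormedModule)). Qed.

(** [C_R_NormedModule] has real scalars only, so linearity over complex constants is checked on real
    and imaginary parts. *)
Lemma is_CRInt_mult (c : C) (f : R -> C) (a b : R) (v : C) :
  is_CRInt f a b v -> is_CRInt (fun u => c * f u)%C a b (c * v)%C.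
Proof.
  rewrite !is_CRInt_components. intros [H1 H2]. split; simpl.
  - apply (is_RInt_minus (V := R_NormedModule));
      apply (is_RInt_scal (V := R_NormedModule)); assumption.
  - apply (is_RInt_plus (V := R_NormedModule));
      apply (is_RInt_scal (V := R_NormedModule)); assumption.
Qed.

Lemma is_CRInt_Chasles (f : R -> C) (a b c : R) (v w : C) :
  is_CRInt f a b v -> is_CRInt f b c w -> is_CRInt f a c (v + w)%C.
Proof. apply (is_RInt_Chasles (V := C_R_NormedModule)). Qed.

Lemma is_CRInt_const (c : C) (a b : R) : is_CRInt (fun _ => c) a b (RtoC (b - a) * c)%C.
Proof.
  replace (RtoC (b - a) * c)%C with (scal (V := C_R_NormedModule) (b - a)%R c).
  - apply (is_RInt_const (V := C_R_NormedModule)).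
  - destruct c as [p q]. unfold scal; simpl. unfold prod_scal, scal; simpl.
    unfold mult, Cmult, RtoC; simpl. f_equal; ring.
Qed.

Lemma is_CRInt_norm_le (f : R -> C) (g : R -> R) (a b : R) (v : C) (w : R) :
  a <= b -> (forall u, a <= u <= b -> Cmod (f u) <= g u) ->
  is_CRInt f a b v -> is_RInt g a b w -> Cmod v <= w.
Proof.
  intros Hab H Hf Hg. rewrite <- Cnorm_R.
  apply (norm_RInt_le (V := C_R_NormedModule) f g a b); try assumption.
  intros u Hu. rewrite Cnorm_R. now apply H.
Qed.

Lemma is_CRInt_norm_le_const (f : R -> C) (K : R) (a b : R) (v : C) :
  a <= b -> (forall u, a <= u <= b -> Cmod (f u) <= K) ->
  is_CRInt f a b v -> Cmod v <= (b - a) * K.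
Proof.
  intros Hab H Hf. rewrite <- Cnorm_R.
  apply (norm_RInt_le_const (V := C_R_NormedModule) f a b); try assumption.
  intros u Hu. rewrite Cnorm_R. now apply H.
Qed.

(** * Derivatives of complex functions of a real variable *)

Definition is_Cderive (f : R -> C) (u : R) (d : C) : Prop :=
  is_derive (K := R_AbsRing) (V := C_R_NormedModule) f u d.

Lemma is_derive_eps {V : NormedModule R_AbsRing} (f : R -> V) (u : R) (d : V) :
  is_derive f u d <->
  forall e, 0 < e -> exists r, 0 < r /\ forall h, Rabs h < r ->
    norm (minus (minus (f (u + h)%R) (f u)) (scal h d)) <= e * Rabs h.
Proof.
  assert (E : forall y, minus y u = y - u) by reflexivity.
  split.
  - intros [_ H] e He.
    destruct (H u (fun P HP => HP) (mkposreal e He)) as [r Hr].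
    exists r. split; [apply cond_pos|]. intros h Hh.
    assert (Eh : (u + h - u)%R = h) by ring.
    specialize (Hr (u + h)%R). rewrite E, Eh in Hr. apply Hr.
    change (Rabs (u + h - u) < r). now rewrite Eh.
  - intros H. split; [apply is_linear_scal_l|].
    intros x Hx. assert (Ex : u = x)
      by (apply (is_filter_lim_locally_unique (V := R_NormedModule)); exact Hx).
    subst x. intros e. destruct (H e (cond_pos e)) as [r [Hr0 Hr]].
    exists (mkposreal r Hr0). intros y Hy. specialize (Hr (y - u)%R Hy).
    now rewrite Rplus_minus in Hr.
Qed.

Lemma is_Cderive_eps (f : R -> C) (u : R) (d : C) :
  is_Cderive f u d <->
  forall e, 0 < e -> exists r, 0 < r /\
    forall h, Rabs h < r -> Cmod (f (u + h) - f u - RtoC h * d) <= e * Rabs h.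
Proof.
  assert (E : forall h, norm (V := C_R_NormedModule)
      (minus (minus (f (u + h)%R) (f u)) (scal h d)) = Cmod (f (u + h) - f u - RtoC h * d)).
  { intros h. rewrite Cnorm_R. f_equal. change (scal h d) with (h * fst d, h * snd d)%R.
    unfold minus, plus, opp; simpl.
    unfold prod_plus, prod_opp, Cminus, Cplus, Copp, Cmult, RtoC; simpl.
    unfold plus, opp; simpl. f_equal; ring. }
  unfold is_Cderive. rewrite (is_derive_eps (V := C_R_NormedModule)).
  split; intros H e He; destruct (H e He) as [r [Hr Hr']]; exists r; (split; [exact Hr|]);
    intros h Hh.
  - rewrite <- E. now apply Hr'.
  - eapply Rle_trans; [right; exact (E h)|now apply Hr'].
Qed.

Lemma is_Cderive_components (f : R -> C) (u : R) (d : C) :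
  is_Cderive f u d <->
  is_derive (fun v => Re (f v)) u (Re d) /\ is_derive (fun v => Im (f v)) u (Im d).
Proof.
  assert (ER : forall h, Re (f (u + h)%R - f u - RtoC h * d) = Re (f (u + h)%R) - Re (f u) - h * Re d)
    by (intros; unfold Re, Cminus, Cplus, Copp, Cmult, RtoC; simpl; ring).
  assert (EI : forall h, Im (f (u + h)%R - f u - RtoC h * d) = Im (f (u + h)%R) - Im (f u) - h * Im d)
    by (intros; unfold Im, Cminus, Cplus, Copp, Cmult, RtoC; simpl; ring).
  rewrite is_Cderive_eps, !(is_derive_eps (V := R_NormedModule)). split.
  - intros H. split; intros e He; destruct (H e He) as [r [Hr Hr']]; exists r;
      (split; [exact Hr|]); intros h Hh; (eapply Rle_trans; [|exact (Hr' h Hh)]).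
    + change (Rabs (Re (f (u + h)%R) - Re (f u) - h * Re d) <= Cmod (f (u + h) - f u - RtoC h * d)).
      rewrite <- ER. apply re_le_Cmod.
    + change (Rabs (Im (f (u + h)%R) - Im (f u) - h * Im d) <= Cmod (f (u + h) - f u - RtoC h * d)).
      rewrite <- EI. apply Im_le_Cmod.
  - intros [H1 H2] e He. destruct (H1 (e / 2)%R) as [r1 [P1 Hr1]]; [lra|].
    destruct (H2 (e / 2)%R) as [r2 [P2 Hr2]]; [lra|].
    exists (Rmin r1 r2). split; [now apply Rmin_pos|]. intros h Hh.
    specialize (Hr1 h (Rlt_le_trans _ _ _ Hh (Rmin_l _ _))).
    specialize (Hr2 h (Rlt_le_trans _ _ _ Hh (Rmin_r _ _))).
    change (Rabs (Re (f (u + h)%R) - Re (f u) - h * Re d) <= e / 2 * Rabs h) in Hr1.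
    change (Rabs (Im (f (u + h)%R) - Im (f u) - h * Im d) <= e / 2 * Rabs h) in Hr2.
    eapply Rle_trans; [apply Cmod_le_sum|]. rewrite ER, EI. lra.
Qed.

Lemma is_CRInt_derive (f df : R -> C) (a b : R) :
  (forall u, Rmin a b <= u <= Rmax a b -> is_Cderive f u (df u)) ->
  (forall u, Rmin a b <= u <= Rmax a b -> contC df u) ->
  is_CRInt df a b (f b - f a)%C.
Proof. apply (is_RInt_derive (V := C_R_CompleteNormedModule)). Qed.

Lemma is_Cderive_continuous (f : R -> C) (u : R) (d : C) :
  is_Cderive f u d -> contC f u.
Proof.
  intros H. apply (ex_derive_continuous (V := C_R_NormedModule)). now exists d.
Qed.

(** * Integrals over the real line of functions dominated by [K / (1 + u ^ 2)] *)

(** The majorant has the primitive [K * atan]: tails are controlled by the approach of [atan] to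
    [PI / 2], and the whole integral by [PI * K]. *)
Definition dominated (F : R -> C) (K : R) : Prop :=
  (forall u, contC F u) /\ (forall u, Cmod (F u) <= K / (1 + u ^ 2)).

Definition J (F : R -> C) : C :=
  RInt_gen (V := C_R_CompleteNormedModule) F (Rbar_locally m_infty) (Rbar_locally p_infty).

Lemma one_sqr_pos (u : R) : 0 < 1 + u ^ 2.
Proof. nra. Qed.

Lemma dominated_nonneg (F : R -> C) (K : R) : dominated F K -> 0 <= K.
Proof.
  intros [_ H]. specialize (H 0). pose proof (Cmod_ge_0 (F 0)).
  replace (K / (1 + 0 ^ 2))%R with K in H by field. lra.
Qed.

Lemma is_RInt_atan (K a b : R) :
  is_RInt (fun u => K / (1 + u ^ 2)) a b (K * (atan b - atan a)).
Proof.
  replace (K * (atan b - atan a))%R with (minus (K * atan b) (K * atan a))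
    by (unfold minus, plus, opp; simpl; ring).
  apply (is_RInt_derive (V := R_CompleteNormedModule) (fun u => (K * atan u)%R)).
  - intros u _. auto_derive; [trivial|]. field. pose proof (one_sqr_pos u). nra.
  - intros u _. apply (ex_derive_continuous (V := R_NormedModule)).
    auto_derive. pose proof (one_sqr_pos u). nra.
Qed.

Lemma CRInt_continuous (F : R -> C) (a b : R) :
  (forall u, contC F u) -> is_CRInt F a b (CRInt F a b).
Proof. intros H. apply is_CRInt_CRInt. intros; apply H. Qed.

Lemma dominated_CRInt_le (F : R -> C) (K a b : R) :
  dominated F K -> a <= b -> Cmod (CRInt F a b) <= K * (atan b - atan a).
Proof.
  intros [Hc H] Hab.
  apply (is_CRInt_norm_le F (fun u => K / (1 + u ^ 2)) a b); try assumption.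
  - intros u _. apply H.
  - now apply CRInt_continuous.
  - apply is_RInt_atan.
Qed.

Lemma CRInt_Chasles (F : R -> C) (a b c : R) :
  (forall u, contC F u) -> CRInt F a c = (CRInt F a b + CRInt F b c)%C.
Proof.
  intros H. apply is_CRInt_eq.
  apply (is_RInt_Chasles (V := C_R_NormedModule) F a b c); now apply CRInt_continuous.
Qed.

Lemma atan_near_PI2 (e : R) :
  0 < e -> exists A, 0 < A /\ forall b, A <= b -> PI / 2 - e < atan b < PI / 2.
Proof.
  intros He. pose proof PI_RGT_0.
  (* Since [e] may exceed [PI], truncating at [0] keeps [tan t] nonnegative and the threshold
     positive. *)
  set (t := Rmax 0 (PI / 2 - e / 2)).
  assert (Ht : 0 <= t < PI / 2).
  { unfold t. split; [apply Rmax_l|]. apply Rmax_lub_lt; lra. }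
  exists (tan t + 1)%R. split.
  { assert (0 <= tan t); [|lra].
    destruct (Req_dec t 0) as [E|E]; [rewrite E, tan_0; lra|].
    left. apply tan_gt_0; lra. }
  intros b Hb. split; [|apply atan_bound].
  apply Rlt_trans with t.
  { apply Rlt_le_trans with (PI / 2 - e / 2)%R; [lra|apply Rmax_r]. }
  rewrite <- (atan_tan t) by (split; lra). apply atan_increasing. lra.
Qed.

(** The two integrals differ by one piece beyond [A] and one before [- A]; on each, [atan] varies by
    less than [e]. *)
Lemma dominated_tail (F : R -> C) (K a b a' b' A e : R) :
  dominated F K -> (forall b, A <= b -> PI / 2 - e < atan b < PI / 2) ->
  a <= - A -> A <= b -> a' <= - A -> A <= b' ->
  Cmod (CRInt F a' b' - CRInt F a b) <= 2 * K * e.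
Proof.
  intros HF HA Ha Hb Ha' Hb'. pose proof (dominated_nonneg F K HF) as HK.
  assert (Hc := proj1 HF).
  assert (B1 : forall p q, A <= p -> A <= q -> Cmod (CRInt F p q) <= K * e).
  { assert (W : forall p q, A <= p -> p <= q -> Cmod (CRInt F p q) <= K * e).
    { intros p q Hp Hpq. eapply Rle_trans; [exact (dominated_CRInt_le F K p q HF Hpq)|].
      apply Rmult_le_compat_l; [exact HK|].
      pose proof (HA p Hp). assert (A <= q) by lra. pose proof (HA q ltac:(assumption)). lra. }
    intros p q Hp Hq. destruct (Rle_dec p q) as [Hpq|Hpq]; [now apply W|].
    replace (CRInt F p q) with (- CRInt F q p)%C.
    - rewrite Cmod_opp. apply W; lra.
    - symmetry. apply is_CRInt_eq.
      apply (is_RInt_swap (V := C_R_NormedModule)). now apply CRInt_continuous. }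
  assert (B2 : forall p q, p <= - A -> q <= - A -> Cmod (CRInt F p q) <= K * e).
  { assert (W : forall p q, q <= - A -> p <= q -> Cmod (CRInt F p q) <= K * e).
    { intros p q Hp Hpq. eapply Rle_trans; [exact (dominated_CRInt_le F K p q HF Hpq)|].
      apply Rmult_le_compat_l; [exact HK|].
      pose proof (HA (- p)%R ltac:(lra)). pose proof (HA (- q)%R ltac:(lra)).
      rewrite atan_opp in *. lra. }
    intros p q Hp Hq. destruct (Rle_dec p q) as [Hpq|Hpq]; [now apply W|].
    replace (CRInt F p q) with (- CRInt F q p)%C.
    - rewrite Cmod_opp. apply W; lra.
    - symmetry. apply is_CRInt_eq.
      apply (is_RInt_swap (V := C_R_NormedModule)). now apply CRInt_continuous. }
  rewrite (CRInt_Chasles F a' a b') by exact Hc.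
  rewrite (CRInt_Chasles F a b b') by exact Hc.
  replace (CRInt F a' a + (CRInt F a b + CRInt F b b') - CRInt F a b)%C
    with (CRInt F a' a + CRInt F b b')%C by ring.
  eapply Rle_trans; [apply Cmod_triangle|].
  pose proof (B1 b b' Hb Hb'). pose proof (B2 a' a Ha' Ha). lra.
Qed.

Lemma J_ex (F : R -> C) (K : R) :
  dominated F K ->
  is_RInt_gen (V := C_R_NormedModule) F (Rbar_locally m_infty) (Rbar_locally p_infty) (J F).
Proof.
  intros HF. pose proof (dominated_nonneg F K HF) as HK.
  apply (RInt_gen_correct (V := C_R_CompleteNormedModule)).
  destruct (proj1 (filterlim_locally_cauchy (U := C_R_CompleteNormedModule)
    (F := filter_prod (Rbar_locally m_infty) (Rbar_locally p_infty))
    (fun ab : R * R => CRInt F (fst ab) (snd ab)))) as [v Hv].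
  (* The two tails cost [2 K e']; the [+ 1] keeps the divisor positive when [K = 0]. *)
  - intros e. set (e' := (e / (2 * (2 * K + 1)))%R).
    assert (He' : 0 < e').
    { apply Rdiv_lt_0_compat; [apply cond_pos|lra]. }
    destruct (atan_near_PI2 e' He') as [A [HA0 HA]].
    exists (fun ab : R * R => fst ab <= - A /\ A <= snd ab). split.
    + apply (Filter_prod _ _ _ (fun a => a <= - A) (fun b => A <= b)).
      * exists (- A)%R. intros a Ha. lra.
      * exists A. intros a Ha. lra.
      * intros a b Ha Hb. split; assumption.
    + intros [a b] [a' b'] [Ha Hb] [Ha' Hb']. simpl in *.
      apply C_ball_Cmod.
      eapply Rle_lt_trans;
        [exact (dominated_tail F K a b a' b' A e' HF HA Ha Hb Ha' Hb')|].
      apply Rlt_le_trans with ((2 * K + 1) * e')%R; [nra|].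
      unfold e'. pose proof (cond_pos e).
      replace ((2 * K + 1) * (e / (2 * (2 * K + 1))))%R with (e / 2)%R by (field; lra).
      lra.
  - exists v. 
    intros P HP. specialize (Hv P HP). unfold filtermapi, filtermap in *.
    revert Hv. apply filter_imp. intros [a b] H. exists (CRInt F a b). split; [|exact H].
    apply CRInt_continuous. apply HF.
Qed.

Lemma is_RInt_gen_CRInt (F : R -> C) (Fa Fb : (R -> Prop) -> Prop) (v : C)
    {FFa : Filter Fa} {FFb : Filter Fb} :
  is_RInt_gen (V := C_R_NormedModule) F Fa Fb v ->
  filterlim (fun ab : R * R => CRInt F (fst ab) (snd ab)) (filter_prod Fa Fb)
    (locally (T := C_UniformSpace) v).
Proof.
  intros H P HP. specialize (H P HP). unfold filtermapi, filtermap in *.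
  revert H. apply filter_imp. intros [a b] [w [Hw HPw]].
  now rewrite (is_CRInt_eq _ _ _ _ Hw).
Qed.

Lemma J_lim (F : R -> C) (K : R) :
  dominated F K -> forall e, 0 < e -> exists A, forall a b, a <= - A -> A <= b ->
  Cmod (CRInt F a b - J F) < e.
Proof.
  intros HF e He.
  pose proof (is_RInt_gen_CRInt _ _ _ _ (J_ex F K HF)) as H.
  assert (H' := proj1 (filterlim_C _ _ _) H); clear H; rename H' into H. destruct (H e He) as [Q1 Q2 [A1 H1] [A2 H2] H3].
  exists (Rmax (- A1) A2 + 1)%R. intros a b Ha Hb.
  pose proof (Rmax_l (- A1) A2). pose proof (Rmax_r (- A1) A2).
  apply (H3 a b); [apply H1|apply H2]; lra.
Qed.

Lemma J_lim_sym (F : R -> C) (K : R) :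
  dominated F K ->
  filterlim (fun T => CRInt F (- T) T) (Rbar_locally p_infty)
    (locally (T := C_UniformSpace) (J F)).
Proof.
  intros HF. apply filterlim_C; [typeclasses eauto|]. intros e He.
  destruct (J_lim F K HF e He) as [A HA].
  exists A. intros T HT. apply HA; lra.
Qed.

Lemma filterlim_C_unique (f : R -> C) (v w : C) :
  filterlim f (Rbar_locally p_infty) (locally (T := C_UniformSpace) v) ->
  filterlim f (Rbar_locally p_infty) (locally (T := C_UniformSpace) w) -> v = w.
Proof. apply (filterlim_locally_unique (V := C_R_NormedModule)). Qed.

Lemma J_unique (F : R -> C) (K : R) (v : C) :
  dominated F K ->
  filterlim (fun T => CRInt F (- T) T) (Rbar_locally p_infty)
    (locally (T := C_UniformSpace) v) -> J F = v.
Proof. intros HF. apply filterlim_C_unique. exact (J_lim_sym F K HF). Qed.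

Lemma J_norm (F : R -> C) (K : R) : dominated F K -> Cmod (J F) <= PI * K.
Proof.
  intros HF. apply Rle_plus_epsilon. intros e He.
  destruct (J_lim F K HF e He) as [A HA].
  set (T := Rmax A 0). specialize (HA (- T)%R T).
  assert (HT : A <= T) by apply Rmax_l. assert (HT0 : 0 <= T) by apply Rmax_r.
  specialize (HA ltac:(lra) HT).
  replace (J F) with (CRInt F (- T) T - (CRInt F (- T) T - J F))%C by ring.
  eapply Rle_trans; [apply Cmod_sub_le|].
  pose proof (dominated_CRInt_le F K (- T) T HF ltac:(lra)).
  pose proof (dominated_nonneg F K HF).
  pose proof (atan_bound T). rewrite atan_opp in H. nra.
Qed.

Lemma dominated_plus (F G : R -> C) (K L : R) :
  dominated F K -> dominated G L -> dominated (fun u => F u + G u)%C (K + L).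
Proof.
  intros [C1 H1] [C2 H2]. split.
  - intros u. now apply continuous_Cplus.
  - intros u. eapply Rle_trans; [apply Cmod_triangle|].
    rewrite Rdiv_plus_distr. now apply Rplus_le_compat.
Qed.

Lemma dominated_mult (c : C) (F : R -> C) (K : R) :
  dominated F K -> dominated (fun u => c * F u)%C (Cmod c * K).
Proof.
  intros [C1 H1]. split.
  - intros u. apply continuous_Cmult; [apply continuous_Cconst|apply C1].
  - intros u. rewrite Cmod_mult. unfold Rdiv. rewrite Rmult_assoc.
    apply Rmult_le_compat_l; [apply Cmod_ge_0|apply H1].
Qed.

Definition is_J (F : R -> C) (v : C) : Prop :=
  is_RInt_gen (V := C_R_NormedModule) F (Rbar_locally m_infty) (Rbar_locally p_infty) v.

Lemma J_eq (F : R -> C) (v : C) : is_J F v -> J F = v.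
Proof. intros H. exact (is_RInt_gen_unique (V := C_R_CompleteNormedModule) F v H). Qed.

Lemma is_RInt_gen_Cplus (F G : R -> C) (v w : C) :
  is_J F v -> is_J G w -> is_J (fun u => F u + G u)%C (v + w)%C.
Proof. exact (is_RInt_gen_plus (V := C_R_NormedModule) F G v w). Qed.

Lemma is_RInt_gen_Cmult (Fa Fb : (R -> Prop) -> Prop) {FFa : Filter Fa} {FFb : Filter Fb}
    (c : C) (f : R -> C) (v : C) :
  is_RInt_gen (V := C_R_NormedModule) f Fa Fb v ->
  is_RInt_gen (V := C_R_NormedModule) (fun u => c * f u)%C Fa Fb (c * v)%C.
Proof.
  intros H P HP.
  assert (Hc : continuous (T := C_UniformSpace) (U := C_UniformSpace) (fun z => c * z)%C v).
  { apply continuous_Cmult; [apply continuous_Cconst|apply continuous_id]. }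
  specialize (H _ (Hc P HP)). unfold filtermapi in *. revert H. apply filter_imp.
  intros [p q] [z [Hz HPz]]. exists (c * z)%C. split; [|exact HPz].
  now apply is_CRInt_mult.
Qed.

Lemma J_plus (F G : R -> C) (K L : R) :
  dominated F K -> dominated G L -> J (fun u => F u + G u)%C = (J F + J G)%C.
Proof.
  intros HF HG.
  pose proof (J_ex F K HF) as H1. pose proof (J_ex G L HG) as H2.
  generalize dependent (J F). intros v Hv. generalize dependent (J G). intros w Hw.
  exact (J_eq _ _ (is_RInt_gen_Cplus F G v w Hv Hw)).
Qed.

Lemma J_mult (c : C) (F : R -> C) (K : R) :
  dominated F K -> J (fun u => c * F u)%C = (c * J F)%C.
Proof.
  intros HF. pose proof (J_ex F K HF) as H. generalize dependent (J F). intros v Hv.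
  exact (J_eq _ _ (is_RInt_gen_Cmult _ _ c F v Hv)).
Qed.

(** The part over [[0, 1]] already contributes [k], the rest is nonnegative. With [k = 0] this is
    positivity of the integral; a positive [k] serves to bound Gamma from below on the real axis. *)
Lemma J_Re_ge (F : R -> C) (K k : R) :
  dominated F K -> (forall u, 0 <= Re (F u)) -> (forall u, 0 <= u <= 1 -> k <= Re (F u)) ->
  k <= Re (J F).
Proof.
  intros HF H0 Hk. apply Rle_plus_epsilon. intros e He.
  destruct (J_lim F K HF e He) as [A HA].
  set (T := Rmax A 1). specialize (HA (- T)%R T).
  assert (HT : A <= T) by apply Rmax_l. assert (HT0 : 1 <= T) by apply Rmax_r.
  specialize (HA ltac:(lra) HT).
  assert (Hi : forall p q, is_RInt (fun u => Re (F u)) p q (Re (CRInt F p q))).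
  { intros p q.
    exact (proj1 (proj1 (is_CRInt_components F p q _) (CRInt_continuous F p q (proj1 HF)))). }
  assert (Hp : forall p q, p <= q -> 0 <= Re (CRInt F p q)).
  { intros p q Hpq. replace 0 with ((q - p) * 0)%R by ring.
    apply (is_RInt_le (fun _ => 0) (fun u => Re (F u)) p q); try assumption.
    - apply (is_RInt_const (V := R_NormedModule)).
    - apply Hi.
    - intros; apply H0. }
  assert (H1 : k <= Re (CRInt F 0 1)).
  { replace k with ((1 - 0) * k)%R by ring.
    apply (is_RInt_le (fun _ => k) (fun u => Re (F u)) 0 1); try lra.
    - apply (is_RInt_const (V := R_NormedModule)).
    - apply Hi.
    - intros; apply Hk; lra. }
  rewrite (CRInt_Chasles F (- T) 0 T) in HA by apply HF.
  rewrite (CRInt_Chasles F 0 1 T) in HA by apply HF.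
  pose proof (Hp (- T)%R 0 ltac:(lra)). pose proof (Hp 1 T ltac:(lra)).
  pose proof (re_le_Cmod (CRInt F (- T) 0 + (CRInt F 0 1 + CRInt F 1 T) - J F)) as E.
  unfold Cminus in E, HA. rewrite !re_plus, re_opp in E.
  apply Rabs_le_between in E. lra.
Qed.

Lemma dominated_ex_Cmod (F : R -> C) (K : R) :
  dominated F K ->
  ex_RInt_gen (fun u => Cmod (F u)) (Rbar_locally m_infty) (Rbar_locally p_infty).
Proof.
  intros HF.
  assert (HG : dominated (fun u => RtoC (Cmod (F u))) K).
  { split.
    - intros u. apply continuous_RtoC. apply continuous_Cmod. apply HF.
    - intros u. rewrite Cmod_R, Rabs_pos_eq by apply Cmod_ge_0. apply HF. }
  exists (Re (J (fun u => RtoC (Cmod (F u))))).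
  pose proof (J_ex _ _ HG) as H. intros P HP.
  assert (HP' : locally (T := C_UniformSpace) (J (fun u => RtoC (Cmod (F u))))
    (fun z => P (Re z))).
  { destruct HP as [d Hd]. exists d. intros z [Hz _]. apply Hd. exact Hz. }
  specialize (H _ HP'). unfold filtermapi in *. revert H. apply filter_imp.
  intros [a b] [v [Hv HPv]]. exists (Re v). split; [|exact HPv].
  apply (proj1 (is_CRInt_components _ _ _ _) Hv).
Qed.

(** * The complex exponential *)

Lemma Cexp_plus (z w : C) : Cexp (z + w) = (Cexp z * Cexp w)%C.
Proof.
  unfold Cexp. rewrite re_plus. unfold Im at 1 2. simpl.
  fold (Im z) (Im w). rewrite exp_plus, cos_plus, sin_plus.
  unfold Cmult, RtoC; simpl. f_equal; ring.
Qed.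

Lemma Cexp_0 : Cexp 0 = 1.
Proof. unfold Cexp. simpl. rewrite exp_0, cos_0, sin_0. unfold RtoC, Cmult; simpl. f_equal; ring. Qed.

Lemma Cmod_Cexp (z : C) : Cmod (Cexp z) = exp (Re z).
Proof.
  unfold Cexp. rewrite Cmod_mult, Cmod_R, Rabs_pos_eq by (left; apply exp_pos).
  unfold Cmod; simpl. pose proof (sin2_cos2 (Im z)) as H. unfold Rsqr in H.
  replace (cos (Im z) * (cos (Im z) * 1) + sin (Im z) * (sin (Im z) * 1))%R with 1 by lra.
  rewrite sqrt_1. ring.
Qed.

Lemma Cexp_RtoC (r : R) : Cexp (RtoC r) = RtoC (exp r).
Proof.
  unfold Cexp. simpl. rewrite cos_0, sin_0. unfold RtoC, Cmult; simpl. f_equal; ring.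
Qed.

Lemma Cexp_coord (r p q : R) :
  Cexp (RtoC r * (p, q)) = (exp (r * p) * cos (r * q), exp (r * p) * sin (r * q))%R.
Proof.
  unfold Cexp. replace (Re (r * (p, q))) with (r * p)%R by (unfold Re; simpl; ring).
  replace (Im (r * (p, q))) with (r * q)%R by (unfold Im; simpl; ring).
  unfold Cmult, RtoC; simpl. f_equal; ring.
Qed.

Lemma is_Cderive_Cexp (w : C) (r : R) :
  is_Cderive (fun r => Cexp (RtoC r * w)) r (w * Cexp (RtoC r * w))%C.
Proof.
  destruct w as [p q]. apply is_Cderive_components. split.
  - apply (is_derive_ext (fun r => exp (r * p) * cos (r * q))%R).
    { intros t. now rewrite Cexp_coord. }
    auto_derive; [trivial|]. rewrite Cexp_coord, re_mult. unfold Re, Im; simpl. ring.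
  - apply (is_derive_ext (fun r => exp (r * p) * sin (r * q))%R).
    { intros t. now rewrite Cexp_coord. }
    auto_derive; [trivial|]. rewrite Cexp_coord, im_mult. unfold Re, Im; simpl. ring.
Qed.

Lemma continuous_path_Cexp (w : C) (r : R) : contC (fun r => Cexp (RtoC r * w)) r.
Proof. eapply is_Cderive_continuous. apply is_Cderive_Cexp. Qed.

Lemma exp_le_exp (a b : R) : a <= b -> exp a <= exp b.
Proof. intros [H|H]; [left; now apply exp_increasing|subst; apply Rle_refl]. Qed.

(** [exp (r a)] lies between [1] and [exp a], whatever the sign of [a]. *)
Lemma exp_segment_le (a r : R) : 0 <= r <= 1 -> exp (r * a) <= 1 + exp a.
Proof.
  intros Hr. pose proof (exp_pos a). destruct (Rle_dec 0 a) as [Ha|Ha].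
  - assert (exp (r * a) <= exp a); [|lra].
    apply exp_le_exp. nra.
  - assert (exp (r * a) <= exp 0); [|rewrite exp_0 in *; lra].
    apply exp_le_exp. nra.
Qed.

Lemma Re_scal (r : R) (w : C) : Re (RtoC r * w) = (r * Re w)%R.
Proof. apply re_scal_l. Qed.

Lemma Cexp_sub_1_le (w : C) : Cmod (Cexp w - 1) <= Cmod w * (1 + exp (Re w)).
Proof.
  assert (H : is_CRInt (fun r => w * Cexp (RtoC r * w))%C 0 1 (Cexp w - 1)%C).
  { replace (Cexp w - 1)%C with (Cexp (RtoC 1 * w) - Cexp (RtoC 0 * w))%C
      by (rewrite Cmult_1_l, Cmult_0_l, Cexp_0; reflexivity).
    apply (is_CRInt_derive (fun r => Cexp (RtoC r * w))).
    - intros; apply is_Cderive_Cexp.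
    - intros. apply continuous_Cmult; [apply continuous_Cconst|apply continuous_path_Cexp]. }
  replace (Cmod w * (1 + exp (Re w)))%R with ((1 - 0) * (Cmod w * (1 + exp (Re w))))%R by ring.
  revert H. apply is_CRInt_norm_le_const; [lra|]. intros r Hr.
  rewrite Cmod_mult, Cmod_Cexp, Re_scal.
  apply Rmult_le_compat_l; [apply Cmod_ge_0|]. now apply exp_segment_le.
Qed.

(** The remainder is the integral of [w (Cexp (r w) - 1)] over [[0, 1]], bounded by the previous
    lemma. Keeping [exp (Re w)] instead of [exp |w|] matters: multiplied by the exponential of an
    integrand, it gives the same weight at a shifted real part. *)
Lemma Cexp_taylor_le (w : C) : Cmod (Cexp w - 1 - w) <= Cmod w ^ 2 * (2 + exp (Re w)).
Proof.
  assert (H : is_CRInt (fun r => w * (Cexp (RtoC r * w) - 1))%C 0 1 (Cexp w - 1 - w)%C).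
  { replace (Cexp w - 1 - w)%C
      with ((Cexp (RtoC 1 * w) - Cexp (RtoC 0 * w)) - (w * 1))%C
      by (rewrite Cmult_1_l, Cmult_0_l, Cexp_0; ring).
    apply (is_CRInt_ext (fun r => w * Cexp (RtoC r * w) - w * 1)%C).
    { intros; ring. }
    apply is_CRInt_minus.
    - apply (is_CRInt_derive (fun r => Cexp (RtoC r * w))).
      + intros; apply is_Cderive_Cexp.
      + intros. apply continuous_Cmult; [apply continuous_Cconst|apply continuous_path_Cexp].
    - apply is_CRInt_mult. pose proof (is_CRInt_const 1 0 1) as H.
      now rewrite Rminus_0_r, Cmult_1_l in H. }
  replace (Cmod w ^ 2 * (2 + exp (Re w)))%R with ((1 - 0) * (Cmod w ^ 2 * (2 + exp (Re w))))%R by ring.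
  revert H. apply is_CRInt_norm_le_const; [lra|]. intros r Hr.
  rewrite Cmod_mult. pose proof (Cmod_ge_0 w) as Hw.
  replace (Cmod w ^ 2 * (2 + exp (Re w)))%R with (Cmod w * (Cmod w * (2 + exp (Re w))))%R by ring.
  apply Rmult_le_compat_l; [exact Hw|].
  eapply Rle_trans; [apply Cexp_sub_1_le|].
  rewrite Cmod_mult, Cmod_R, Rabs_pos_eq, Re_scal by lra.
  pose proof (exp_segment_le (Re w) r Hr). pose proof (exp_pos (r * Re w)).
  assert (r * Cmod w <= Cmod w) by nra.
  apply Rmult_le_compat; nra.
Qed.

(** * Holomorphy with second-order remainder bounds *)

(* The boxes [s1 <= Re z, |z| <= B] with [s0 < s1] are convex and exhaust the
   half-plane [s0 < Re z]; asking for a uniform quadratic remainder on each of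
   them replaces all compactness arguments. *)
Definition box (s1 B : R) (z : C) : Prop := s1 <= Re z /\ Cmod z <= B.

Definition holo (s0 : R) (f f' : C -> C) : Prop :=
  forall s1 B, s0 < s1 -> exists K, 0 <= K /\ forall z w, box s1 B z -> box s1 B w ->
    Cmod (f w - f z - (w - z) * f' z) <= K * Cmod (w - z) ^ 2.

Lemma box_dist (s1 B : R) (z w : C) : box s1 B z -> box s1 B w -> Cmod (w - z) <= 2 * B.
Proof.
  intros [_ Hz] [_ Hw]. eapply Rle_trans; [apply Cmod_sub_le|]. lra.
Qed.

Lemma box_le (s1 B B' : R) (z : C) : B <= B' -> box s1 B z -> box s1 B' z.
Proof. intros H [H1 H2]. split; lra. Qed.

(** Adding the remainders at [z] and at [w] cancels the values of [f] and leaves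
    [(w - z) (f' w - f' z)] up to sign. *)
Lemma holo_derivative_lipschitz (s0 : R) (f f' : C -> C) :
  holo s0 f f' -> forall s1 B, s0 < s1 -> exists K, 0 <= K /\
  forall z w, box s1 B z -> box s1 B w -> Cmod (f' w - f' z) <= K * Cmod (w - z).
Proof.
  intros H s1 B Hs. destruct (H s1 B Hs) as [K [HK0 HK]].
  exists (2 * K)%R. split; [lra|]. intros z w Hz Hw.
  pose proof (HK z w Hz Hw) as H1. pose proof (HK w z Hw Hz) as H2.
  destruct (Req_dec (Cmod (w - z)) 0) as [E|E].
  - apply Cmod_eq_0 in E. assert (w = z) as ->.
    { replace w with (w - z + z)%C by ring. rewrite E. ring. }
    replace (f' z - f' z)%C with (RtoC 0) by ring. rewrite Cmod_0.
    pose proof (Cmod_ge_0 (z - z)). nra.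
  - pose proof (Cmod_ge_0 (w - z)).
    apply Rmult_le_reg_l with (Cmod (w - z)); [lra|].
    rewrite <- Cmod_mult.
    replace ((w - z) * (f' w - f' z))%C
      with ((f w - f z - (w - z) * f' z) + (f z - f w - (z - w) * f' w))%C by ring.
    eapply Rle_trans; [apply Cmod_triangle|].
    replace (Cmod (z - w)) with (Cmod (w - z)) in H2
      by (rewrite <- Cmod_opp; f_equal; ring).
    lra.
Qed.

Lemma holo_bounds (s0 : R) (f f' : C -> C) :
  holo s0 f f' -> forall s1 B, s0 < s1 -> exists K, 0 <= K /\
  (forall z, box s1 B z -> Cmod (f z) <= K /\ Cmod (f' z) <= K) /\
  (forall z w, box s1 B z -> box s1 B w -> Cmod (f w - f z) <= K * Cmod (w - z)).
Proof.
  (* Enlarging the box makes it contain the real point [s1], with which all values are compared. *)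
  intros H s1 B Hs. set (B' := Rmax B (Rabs s1)).
  destruct (H s1 B' Hs) as [K [HK0 HK]].
  destruct (holo_derivative_lipschitz s0 f f' H s1 B' Hs) as [L [HL0 HL]].
  set (z0 := RtoC s1).
  assert (Hz0 : box s1 B' z0).
  { split; [apply Rle_refl|]. unfold z0. rewrite Cmod_R. apply Rmax_r. }
  assert (HB' : 0 <= B').
  { eapply Rle_trans; [apply Rabs_pos|apply Rmax_r]. }
  set (M1 := (Cmod (f' z0) + L * (2 * B'))%R).
  set (M0 := (Cmod (f z0) + 2 * B' * Cmod (f' z0) + K * (2 * B') ^ 2)%R).
  set (M2 := (M1 + K * (2 * B'))%R).
  assert (P0 := Cmod_ge_0 (f z0)). assert (P1 := Cmod_ge_0 (f' z0)).
  assert (Q1 : 0 <= L * (2 * B')) by (apply Rmult_le_pos; lra).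
  assert (Q2 : 0 <= K * (2 * B')) by (apply Rmult_le_pos; lra).
  assert (Q3 : 0 <= K * (2 * B') ^ 2) by (apply Rmult_le_pos; [lra|apply pow2_ge_0]).
  assert (Q4 : 0 <= 2 * B' * Cmod (f' z0)) by (apply Rmult_le_pos; lra).
  assert (HM1 : 0 <= M1) by (unfold M1; lra). assert (HM0 : 0 <= M0) by (unfold M0; lra).
  assert (HM2 : 0 <= M2) by (unfold M2; lra).
  assert (D1 : forall z, box s1 B' z -> Cmod (f' z) <= M1).
  { intros z Hz. replace (f' z) with (f' z0 + (f' z - f' z0))%C by ring.
    eapply Rle_trans; [apply Cmod_triangle|]. apply Rplus_le_compat_l.
    eapply Rle_trans; [apply HL; assumption|]. apply Rmult_le_compat_l; [exact HL0|].
    exact (box_dist _ _ _ _ Hz0 Hz). }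
  assert (D0 : forall z, box s1 B' z -> Cmod (f z) <= M0).
  { intros z Hz.
    replace (f z) with (f z0 + (z - z0) * f' z0 + (f z - f z0 - (z - z0) * f' z0))%C by ring.
    pose proof (box_dist _ _ _ _ Hz0 Hz) as Hd.
    eapply Rle_trans; [apply Cmod_triangle|]. unfold M0. apply Rplus_le_compat.
    - eapply Rle_trans; [apply Cmod_triangle|]. apply Rplus_le_compat_l.
      rewrite Cmod_mult. apply Rmult_le_compat_r; assumption.
    - eapply Rle_trans; [apply HK; assumption|]. apply Rmult_le_compat_l; [exact HK0|].
      apply pow_incr. split; [apply Cmod_ge_0|exact Hd]. }
  assert (HBB : B <= B') by apply Rmax_l.
  exists (M0 + M1 + M2)%R. split; [lra|]. split.
  - intros z Hz. apply (box_le _ _ _ _ HBB) in Hz.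
    specialize (D0 z Hz). specialize (D1 z Hz). lra.
  - intros z w Hz Hw. apply (box_le _ _ _ _ HBB) in Hz, Hw.
    replace (f w - f z)%C with ((w - z) * f' z + (f w - f z - (w - z) * f' z))%C by ring.
    eapply Rle_trans; [apply Cmod_triangle|].
    rewrite Cmod_mult. specialize (HK z w Hz Hw). specialize (D1 z Hz).
    pose proof (box_dist _ _ _ _ Hz Hw) as Hd. pose proof (Cmod_ge_0 (w - z)).
    assert (K * Cmod (w - z) ^ 2 <= K * (2 * B') * Cmod (w - z))
      by (simpl; rewrite Rmult_1_r, <- Rmult_assoc; apply Rmult_le_compat_r; [lra|];
          apply Rmult_le_compat_l; lra).
    assert (Cmod (w - z) * Cmod (f' z) <= Cmod (w - z) * M1)
      by (apply Rmult_le_compat_l; lra).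
    unfold M2. nra.
Qed.

Lemma holo_weaken (s0 s0' : R) (f f' : C -> C) : s0 <= s0' -> holo s0 f f' -> holo s0' f f'.
Proof. intros H Hf s1 B Hs. apply Hf. lra. Qed.

Lemma holo_const (s0 : R) (c : C) : holo s0 (fun _ => c) (fun _ => RtoC 0).
Proof.
  intros s1 B Hs. exists 0. split; [lra|]. intros z w _ _.
  replace (c - c - (w - z) * 0)%C with (RtoC 0) by ring. rewrite Cmod_0. lra.
Qed.

Lemma holo_id (s0 : R) : holo s0 (fun z => z) (fun _ => RtoC 1).
Proof.
  intros s1 B Hs. exists 0. split; [lra|]. intros z w _ _.
  replace (w - z - (w - z) * 1)%C with (RtoC 0) by ring. rewrite Cmod_0. lra.
Qed.

Lemma holo_plus (s0 : R) (f f' g g' : C -> C) :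
  holo s0 f f' -> holo s0 g g' ->
  holo s0 (fun z => f z + g z)%C (fun z => f' z + g' z)%C.
Proof.
  intros Hf Hg s1 B Hs. destruct (Hf s1 B Hs) as [K [K0 HK]].
  destruct (Hg s1 B Hs) as [L [L0 HL]].
  exists (K + L)%R. split; [lra|]. intros z w Hz Hw.
  replace (f w + g w - (f z + g z) - (w - z) * (f' z + g' z))%C
    with ((f w - f z - (w - z) * f' z) + (g w - g z - (w - z) * g' z))%C by ring.
  eapply Rle_trans; [apply Cmod_triangle|].
  specialize (HK z w Hz Hw). specialize (HL z w Hz Hw). lra.
Qed.

Lemma holo_mult (s0 : R) (f f' g g' : C -> C) :
  holo s0 f f' -> holo s0 g g' ->
  holo s0 (fun z => f z * g z)%C (fun z => f' z * g z + f z * g' z)%C.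
Proof.
  intros Hf Hg s1 B Hs. destruct (Hf s1 B Hs) as [K [K0 HK]].
  destruct (Hg s1 B Hs) as [L [L0 HL]].
  destruct (holo_bounds _ _ _ Hf s1 B Hs) as [M [M0 [HM1 HM2]]].
  destruct (holo_bounds _ _ _ Hg s1 B Hs) as [N [N0 [HN1 HN2]]].
  exists (M * L + N * K + M * N)%R. split; [nra|]. intros z w Hz Hw.
  replace (f w * g w - f z * g z - (w - z) * (f' z * g z + f z * g' z))%C
    with (f z * (g w - g z - (w - z) * g' z) + g z * (f w - f z - (w - z) * f' z)
          + (f w - f z) * (g w - g z))%C by ring.
  specialize (HK z w Hz Hw). specialize (HL z w Hz Hw).
  destruct (HM1 z Hz) as [HM _]. destruct (HN1 z Hz) as [HN _].
  specialize (HM2 z w Hz Hw). specialize (HN2 z w Hz Hw).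
  eapply Rle_trans; [apply Cmod_triangle|].
  rewrite !Rmult_plus_distr_r. apply Rplus_le_compat.
  - eapply Rle_trans; [apply Cmod_triangle|]. rewrite !Cmod_mult, !Rmult_assoc.
    apply Rplus_le_compat; apply Rmult_le_compat; try apply Cmod_ge_0; assumption.
  - rewrite Cmod_mult. replace (M * N * Cmod (w - z) ^ 2)%R
      with ((M * Cmod (w - z)) * (N * Cmod (w - z)))%R by ring.
    apply Rmult_le_compat; try apply Cmod_ge_0; assumption.
Qed.

(** A uniform remainder for the inverse needs [f] bounded away from [0] on each box, so the
    hypothesis is a lower bound and not mere nonvanishing. *)
Lemma holo_inv (s0 : R) (f f' : C -> C) :
  (forall s1 B, s0 < s1 -> exists k, 0 < k /\ forall z, box s1 B z -> k <= Cmod (f z)) ->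
  holo s0 f f' -> holo s0 (fun z => / f z)%C (fun z => - (f' z / (f z * f z)))%C.
Proof.
  intros Hk Hf s1 B Hs. destruct (Hf s1 B Hs) as [K [K0 HK]].
  destruct (holo_bounds _ _ _ Hf s1 B Hs) as [M [M0 [HM1 HM2]]].
  destruct (Hk s1 B Hs) as [k [k0 Hk1]].
  exists ((M * K + M * M) / (k * k * k))%R. split.
  { apply Rmult_le_pos; [nra|]. left. apply Rinv_0_lt_compat.
    repeat apply Rmult_lt_0_compat; assumption. }
  intros z w Hz Hw.
  pose proof (Hk1 z Hz) as kz. pose proof (Hk1 w Hw) as kw.
  assert (nz : f z <> 0) by (apply Cmod_gt_0; lra).
  assert (nw : f w <> 0) by (apply Cmod_gt_0; lra).
  replace (/ f w - / f z - (w - z) * - (f' z / (f z * f z)))%C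
    with ((- f z * (f w - f z - (w - z) * f' z) + ((w - z) * f' z) * (f w - f z))
          / (f z * f z * f w))%C by (field; split; assumption).
  specialize (HK z w Hz Hw). destruct (HM1 z Hz) as [HM HM']. specialize (HM2 z w Hz Hw).
  assert (nzw : (f z * f z * f w)%C <> 0).
  { repeat apply Cmult_neq_0; assumption. }
  rewrite Cmod_div by exact nzw.
  unfold Rdiv. rewrite Rmult_assoc, (Rmult_comm (/ _)), <- Rmult_assoc.
  apply Rmult_le_compat.
  - apply Cmod_ge_0.
  - left. apply Rinv_0_lt_compat. apply Cmod_gt_0. exact nzw.
  - eapply Rle_trans; [apply Cmod_triangle|]. rewrite Rmult_plus_distr_r.
    apply Rplus_le_compat.
    + rewrite Cmod_mult, Cmod_opp, Rmult_assoc.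
      apply Rmult_le_compat; try apply Cmod_ge_0; assumption.
    + rewrite !Cmod_mult.
      replace (M * M * Cmod (w - z) ^ 2)%R
        with ((Cmod (w - z) * M) * (M * Cmod (w - z)))%R by ring.
      apply Rmult_le_compat; try apply Cmod_ge_0; [| |assumption].
      * apply Rmult_le_pos; apply Cmod_ge_0.
      * apply Rmult_le_compat_l; [apply Cmod_ge_0|assumption].
  - apply Rinv_le_contravar.
    + repeat apply Rmult_lt_0_compat; assumption.
    + rewrite !Cmod_mult. repeat apply Rmult_le_compat; try lra; nra.
Qed.

Lemma holo_exp (s0 a : R) :
  holo s0 (fun z => Cexp (z * RtoC a)) (fun z => RtoC a * Cexp (z * RtoC a))%C.
Proof.
  intros s1 B Hs.
  exists (exp (B * Rabs a) * (Rabs a ^ 2 * (2 + exp (2 * B * Rabs a))))%R. split.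
  { repeat apply Rmult_le_pos; try apply Rabs_pos; try lra; pose proof (exp_pos (2 * B * Rabs a));
      try (left; apply exp_pos); lra. }
  intros z w Hz Hw. pose proof (box_dist _ _ _ _ Hz Hw) as Hd.
  assert (HR : forall t b, Cmod t <= b -> Re (t * RtoC a) <= b * Rabs a).
  { intros t b Ht. eapply Rle_trans; [apply Rle_abs|].
    eapply Rle_trans; [apply re_le_Cmod|]. rewrite Cmod_mult, Cmod_R.
    apply Rmult_le_compat_r; [apply Rabs_pos|exact Ht]. }
  replace (w * RtoC a)%C with (z * RtoC a + (w - z) * RtoC a)%C by ring.
  rewrite Cexp_plus.
  replace (Cexp (z * a) * Cexp ((w - z) * a) - Cexp (z * a) - (w - z) * (a * Cexp (z * a)))%C
    with (Cexp (z * a) * (Cexp ((w - z) * a) - 1 - (w - z) * a))%C by ring.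
  rewrite Cmod_mult, Rmult_assoc. apply Rmult_le_compat; try apply Cmod_ge_0.
  - rewrite Cmod_Cexp. apply exp_le_exp. apply HR, Hz.
  - eapply Rle_trans; [apply Cexp_taylor_le|]. rewrite Cmod_mult, Cmod_R, Rpow_mult_distr.
    replace (Rabs a ^ 2 * (2 + exp (2 * B * Rabs a)) * Cmod (w - z) ^ 2)%R
      with (Cmod (w - z) ^ 2 * Rabs a ^ 2 * (2 + exp (2 * B * Rabs a)))%R by ring.
    apply Rmult_le_compat_l.
    + apply Rmult_le_pos; apply pow2_ge_0.
    + apply Rplus_le_compat_l. apply exp_le_exp. apply HR, Hd.
Qed.

Lemma holo_shift (s0 a : R) (f f' : C -> C) :
  holo s0 f f' -> holo (s0 - a) (fun z => f (z + RtoC a)%C) (fun z => f' (z + RtoC a)%C).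
Proof.
  intros Hf s1 B Hs. destruct (Hf (s1 + a)%R (B + Rabs a)%R ltac:(lra)) as [K [K0 HK]].
  exists K. split; [exact K0|]. intros z w Hz Hw.
  assert (Hb : forall t, box s1 B t -> box (s1 + a) (B + Rabs a) (t + RtoC a)).
  { intros t [H1 H2]. split.
    - rewrite re_plus, re_RtoC. lra.
    - eapply Rle_trans; [apply Cmod_triangle|]. rewrite Cmod_R. lra. }
  specialize (HK _ _ (Hb z Hz) (Hb w Hw)).
  now replace (w + a - (z + a))%C with (w - z)%C in HK by ring.
Qed.

Lemma box_segment (s1 B : R) (z w : C) (r : R) :
  0 <= r <= 1 -> box s1 B z -> box s1 B w -> box s1 B (z + RtoC r * (w - z)).
Proof.
  intros Hr [Hz1 Hz2] [Hw1 Hw2]. split.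
  - rewrite re_plus, Re_scal. unfold Cminus. rewrite re_plus, re_opp. nra.
  - replace (z + r * (w - z))%C with (RtoC (1 - r) * z + RtoC r * w)%C
      by (rewrite RtoC_minus; ring).
    eapply Rle_trans; [apply Cmod_triangle|].
    rewrite !Cmod_mult, !Cmod_R, !Rabs_pos_eq by lra. nra.
Qed.

(** Pointwise complex differentiability, in contrast to [holo]: the primitives constructed later are
    controlled only off one point of the half-plane. *)
Definition cderiv (f : C -> C) (z d : C) : Prop :=
  forall e, 0 < e -> exists r, 0 < r /\
    forall h, Cmod h < r -> Cmod (f (z + h)%C - f z - h * d) <= e * Cmod h.

Lemma box_nbhd (s0 : R) (z : C) : s0 < Re z ->
  exists s1 B d, s0 < s1 /\ 0 < d /\ box s1 B z /\ forall h, Cmod h < d -> box s1 B (z + h).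
Proof.
  intros H. exists ((s0 + Re z) / 2)%R, (Cmod z + 1)%R, (Rmin 1 ((Re z - s0) / 2)).
  split; [lra|]. split; [apply Rmin_pos; lra|]. split; [split; lra|].
  intros h Hh. pose proof (Rmin_l 1 ((Re z - s0) / 2)). pose proof (Rmin_r 1 ((Re z - s0) / 2)).
  split.
  - rewrite re_plus. pose proof (re_le_Cmod h) as E. apply Rabs_le_between in E. lra.
  - eapply Rle_trans; [apply Cmod_triangle|]. lra.
Qed.

Lemma cderiv_of_quadratic (f : C -> C) (z d : C) (K r : R) :
  0 <= K -> 0 < r ->
  (forall h, Cmod h < r -> Cmod (f (z + h)%C - f z - h * d) <= K * Cmod h ^ 2) ->
  cderiv f z d.
Proof.
  intros HK Hr H e He. exists (Rmin r (e / (K + 1))). split.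
  { apply Rmin_pos; [exact Hr|apply Rdiv_lt_0_compat; lra]. }
  intros h Hh. pose proof (Cmod_ge_0 h) as H0.
  eapply Rle_trans; [apply H; eapply Rlt_le_trans; [exact Hh|apply Rmin_l]|].
  simpl. rewrite Rmult_1_r, <- Rmult_assoc. apply Rmult_le_compat_r; [exact H0|].
  assert (Hh' : Cmod h < e / (K + 1)) by (eapply Rlt_le_trans; [exact Hh|apply Rmin_r]).
  apply Rle_trans with ((K + 1) * Cmod h)%R; [nra|].
  apply Rmult_lt_compat_l with (r := (K + 1)%R) in Hh'; [|lra].
  replace ((K + 1) * (e / (K + 1)))%R with e in Hh' by (field; lra). lra.
Qed.

Lemma holo_cderiv (s0 : R) (f f' : C -> C) (z : C) :
  holo s0 f f' -> s0 < Re z -> cderiv f z (f' z).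
Proof.
  intros Hf Hz. destruct (box_nbhd s0 z Hz) as (s1 & B & d & Hs & Hd & Hz' & Hb).
  destruct (Hf s1 B Hs) as [K [K0 HK]].
  apply (cderiv_of_quadratic f z (f' z) K d K0 Hd). intros h Hh.
  specialize (HK z (z + h)%C Hz' (Hb h Hh)). now replace (z + h - z)%C with h in HK by ring.
Qed.

Lemma lipschitz_continuous (s0 : R) (f : C -> C) (z : C) :
  (forall s1 B, s0 < s1 -> exists K, 0 <= K /\ forall z w, box s1 B z -> box s1 B w ->
     Cmod (f w - f z) <= K * Cmod (w - z)) ->
  s0 < Re z -> continuous (T := C_UniformSpace) (U := C_UniformSpace) f z.
Proof.
  intros Hf Hz. apply continuous_C_eps. intros e He.
  destruct (box_nbhd s0 z Hz) as (s1 & B & d & Hs & Hd & Hz' & Hb).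
  destruct (Hf s1 B Hs) as [K [K0 HK]].
  exists (Rmin d (e / (K + 1))). split.
  { apply Rmin_pos; [exact Hd|apply Rdiv_lt_0_compat; lra]. }
  intros w Hw.
  assert (Hw' : box s1 B w).
  { replace w with (z + (w - z))%C by ring. apply Hb.
    eapply Rlt_le_trans; [exact Hw|apply Rmin_l]. }
  eapply Rle_lt_trans; [apply HK; assumption|].
  assert (Hh' : Cmod (w - z) < e / (K + 1)) by (eapply Rlt_le_trans; [exact Hw|apply Rmin_r]).
  apply Rmult_lt_compat_l with (r := (K + 1)%R) in Hh'; [|lra].
  replace ((K + 1) * (e / (K + 1)))%R with e in Hh' by (field; lra).
  pose proof (Cmod_ge_0 (w - z)). lra.
Qed.

Lemma holo_continuous (s0 : R) (f f' : C -> C) (z : C) :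
  holo s0 f f' -> s0 < Re z -> continuous (T := C_UniformSpace) (U := C_UniformSpace) f z.
Proof.
  intros Hf. apply lipschitz_continuous. intros s1 B Hs.
  destruct (holo_bounds _ _ _ Hf s1 B Hs) as [K [K0 [_ HK]]]. now exists K.
Qed.

Lemma holo_derivative_continuous (s0 : R) (f f' : C -> C) (z : C) :
  holo s0 f f' -> s0 < Re z -> continuous (T := C_UniformSpace) (U := C_UniformSpace) f' z.
Proof. intros Hf. apply lipschitz_continuous. now apply (holo_derivative_lipschitz s0 f). Qed.

Lemma cderiv_path (f : C -> C) (g : R -> C) (u : R) (d dg : C) :
  cderiv f (g u) d -> is_Cderive g u dg -> is_Cderive (fun v => f (g v)) u (d * dg)%C.
Proof.
  intros Hf Hg. rewrite is_Cderive_eps in *. intros e He.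
  set (M := (Cmod dg + 1)%R). assert (HM : 0 < M) by (pose proof (Cmod_ge_0 dg); unfold M; lra).
  assert (He1 : 0 < e / (2 * M)) by (apply Rdiv_lt_0_compat; lra).
  destruct (Hf _ He1) as [r [Hr Hf']].
  set (N := (Cmod d + 1)%R). assert (HN : 0 < N) by (pose proof (Cmod_ge_0 d); unfold N; lra).
  (* The bound [1] makes the increment of [g] at most [M |h|]; the bound [e / (2 N)] absorbs the
     factor [d]. *)
  set (e2 := Rmin 1 (e / (2 * N))).
  assert (He2 : 0 < e2) by (apply Rmin_pos; [lra|apply Rdiv_lt_0_compat; lra]).
  destruct (Hg _ He2) as [r2 [Hr2 Hg']].
  exists (Rmin r2 (r / M)). split; [apply Rmin_pos; [lra|apply Rdiv_lt_0_compat; lra]|].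
  intros h Hh.
  assert (Hh1 : Rabs h < r2) by (eapply Rlt_le_trans; [exact Hh|apply Rmin_l]).
  assert (Hh2 : Rabs h < r / M) by (eapply Rlt_le_trans; [exact Hh|apply Rmin_r]).
  specialize (Hg' h Hh1). set (k := (g (u + h)%R - g u)%C) in *.
  assert (E2 : e2 <= 1) by apply Rmin_l. assert (E2' : e2 <= e / (2 * N)) by apply Rmin_r.
  pose proof (Rabs_pos h) as Hp.
  assert (Hk : Cmod k <= M * Rabs h).
  { replace k with (k - h * dg + h * dg)%C by ring.
    eapply Rle_trans; [apply Cmod_triangle|]. rewrite Cmod_mult, Cmod_R. unfold M. nra. }
  assert (Hk' : Cmod k < r).
  { eapply Rle_lt_trans; [exact Hk|]. apply Rmult_lt_compat_l with (r := M) in Hh2; [|lra].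
    replace (M * (r / M))%R with r in Hh2 by (field; lra). exact Hh2. }
  specialize (Hf' k Hk').
  replace (g u + k)%C with (g (u + h)%R) in Hf' by (unfold k; ring).
  replace (f (g (u + h)%R) - f (g u) - h * (d * dg))%C
    with ((f (g (u + h)%R) - f (g u) - k * d) + d * (k - h * dg))%C by ring.
  eapply Rle_trans; [apply Cmod_triangle|]. rewrite Cmod_mult.
  assert (X1 : e / (2 * M) * Cmod k <= e / 2 * Rabs h).
  { apply Rle_trans with (e / (2 * M) * (M * Rabs h))%R; [apply Rmult_le_compat_l; lra|].
    right. field. lra. }
  assert (X2 : Cmod d * Cmod (k - h * dg) <= e / 2 * Rabs h).
  { apply Rle_trans with (N * (e / (2 * N) * Rabs h))%R.
    - apply Rmult_le_compat; try apply Cmod_ge_0; [unfold N; lra|].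
      eapply Rle_trans; [exact Hg'|]. apply Rmult_le_compat_r; assumption.
    - right. field. lra. }
  lra.
Qed.

(** * Primitives of difference quotients *)

Lemma is_Cderive_line (p q : C) (r : R) : is_Cderive (fun r => p + RtoC r * q)%C r q.
Proof.
  apply is_Cderive_eps. intros e He. exists 1. split; [lra|]. intros h _.
  replace (p + (r + h)%R * q - (p + r * q) - h * q)%C with (RtoC 0)
    by (rewrite RtoC_plus; ring).
  rewrite Cmod_0. apply Rmult_le_pos; [lra|apply Rabs_pos].
Qed.

Lemma continuous_line (p q : C) (r : R) : contC (fun r => p + RtoC r * q)%C r.
Proof. eapply is_Cderive_continuous, is_Cderive_line. Qed.

Lemma continuous_path_comp (f : C -> C) (g : R -> C) (u : R) :
  continuous (T := C_UniformSpace) (U := C_UniformSpace) f (g u) -> contC g u ->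
  contC (fun v => f (g v)) u.
Proof. intros Hf Hg. exact (continuous_comp (V := C_UniformSpace) (W := C_UniformSpace) g f u Hg Hf). Qed.

Lemma Re_segment_gt (s0 : R) (k t : C) (r : R) :
  0 <= r <= 1 -> s0 < Re k -> s0 < Re t -> s0 < Re (k + RtoC r * (t - k)).
Proof.
  intros Hr Hk Ht. rewrite re_plus, Re_scal. unfold Cminus. rewrite re_plus, re_opp.
  destruct (Rle_dec (Re k) (Re t)); nra.
Qed.

Section DifferenceQuotient.
Context (s0 : R) (H H' : C -> C) (k : C) (HH : holo s0 H H') (Hk : s0 < Re k).

(* [H'(k) (t - k)] at [r = 0] is the limit of the other branch. *)
Let phi (t : C) (r : R) : C :=
  if Req_EM_T r 0 then (H' k * (t - k))%C
  else ((H (k + RtoC r * (t - k)) - H k) / RtoC r)%C.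

(** Near [r = 0] the quadratic remainder of [H] at [k], divided by [r], is of order [r]. The
    integral over [[0, 1]] is therefore a proper one. *)
Lemma continuous_quotient_path (t : C) (r : R) :
  s0 < Re t -> 0 <= r <= 1 -> contC (phi t) r.
Proof.
  intros Ht Hr. destruct (Req_dec r 0) as [->|Hr0].
  - apply filterlim_C; [typeclasses eauto|]. intros e He.
    destruct (box_nbhd s0 k Hk) as (s1 & B & d & Hs & Hd & Hk' & Hb).
    destruct (HH s1 B Hs) as [K [K0 HK]].
    set (D := (Cmod (t - k) + 1)%R).
    assert (HD : 0 < D) by (pose proof (Cmod_ge_0 (t - k)); unfold D; lra).
    assert (Hq : 0 < e / ((K + 1) * D ^ 2)).
    { apply Rdiv_lt_0_compat; [exact He|]. apply Rmult_lt_0_compat; [lra|].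
      apply pow_lt; exact HD. }
    assert (Hm : 0 < Rmin (d / D) (e / ((K + 1) * D ^ 2))).
    { apply Rmin_pos; [apply Rdiv_lt_0_compat; lra|exact Hq]. }
    exists (mkposreal _ Hm). intros r Hr'.
    change (Rabs (r - 0) < Rmin (d / D) (e / ((K + 1) * D ^ 2))) in Hr'.
    rewrite Rminus_0_r in Hr'.
    assert (R1 : Rabs r < d / D) by (eapply Rlt_le_trans; [exact Hr'|apply Rmin_l]).
    assert (R2 : Rabs r < e / ((K + 1) * D ^ 2)) by (eapply Rlt_le_trans; [exact Hr'|apply Rmin_r]).
    unfold phi. destruct (Req_EM_T 0 0) as [_|n]; [|now destruct n].
    destruct (Req_EM_T r 0) as [E|E].
    { replace (H' k * (t - k) - H' k * (t - k))%C with (RtoC 0) by ring. now rewrite Cmod_0. }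
    assert (rC : RtoC r <> 0) by (intro X; apply E; now apply RtoC_inj).
    assert (Hh : Cmod (RtoC r * (t - k)) < d).
    { rewrite Cmod_mult, Cmod_R. apply Rle_lt_trans with (Rabs r * D)%R.
      - apply Rmult_le_compat_l; [apply Rabs_pos|unfold D; lra].
      - apply Rmult_lt_compat_r with (r := D) in R1; [|exact HD].
        replace (d / D * D)%R with d in R1 by (field; lra). exact R1. }
    specialize (HK _ _ Hk' (Hb _ Hh)).
    replace (k + r * (t - k) - k)%C with (RtoC r * (t - k))%C in HK by ring.
    replace ((H (k + r * (t - k)) - H k) / r - H' k * (t - k))%C
      with ((H (k + r * (t - k)) - H k - r * (t - k) * H' k) / r)%C by (field; exact rC).
    rewrite Cmod_div by exact rC. rewrite Cmod_R.
    assert (Rp : 0 < Rabs r) by now apply Rabs_pos_lt.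
    apply Rle_lt_trans with (K * (Rabs r * D ^ 2))%R.
    + apply Rmult_le_reg_r with (Rabs r); [exact Rp|].
      unfold Rdiv. rewrite Rmult_assoc, Rinv_l, Rmult_1_r by lra.
      eapply Rle_trans; [exact HK|]. rewrite Cmod_mult, Cmod_R, Rpow_mult_distr.
      replace (K * (Rabs r * D ^ 2) * Rabs r)%R with (K * (Rabs r ^ 2 * D ^ 2))%R by ring.
      apply Rmult_le_compat_l; [exact K0|]. apply Rmult_le_compat_l; [apply pow2_ge_0|].
      apply pow_incr. split; [apply Cmod_ge_0|unfold D; lra].
    + apply Rmult_lt_compat_r with (r := ((K + 1) * D ^ 2)%R) in R2;
        [|apply Rmult_lt_0_compat; [lra|apply pow_lt; exact HD]].
      replace (e / ((K + 1) * D ^ 2) * ((K + 1) * D ^ 2))%R with e in R2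
        by (field; split; lra).
      assert (0 <= Rabs r * D ^ 2) by (apply Rmult_le_pos; [lra|apply pow2_ge_0]).
      nra.
  - apply (continuous_ext_loc (U := C_UniformSpace) _
      (fun r => (H (k + RtoC r * (t - k)) - H k) / RtoC r)%C).
    + assert (Hp : 0 < Rabs r) by now apply Rabs_pos_lt.
      exists (mkposreal _ Hp). intros x Hx. change (Rabs (x - r) < Rabs r) in Hx.
      unfold phi. destruct (Req_EM_T x 0) as [->|_]; [|reflexivity].
      exfalso. rewrite Rminus_0_l, Rabs_Ropp in Hx. lra.
    + apply continuous_Cdiv.
      * intro X. apply Hr0. now apply RtoC_inj.
      * apply continuous_Cminus; [|apply continuous_Cconst].
        apply (continuous_path_comp H (fun r => k + RtoC r * (t - k))%C).
        -- apply (holo_continuous s0 H H'); [exact HH|]. now apply Re_segment_gt.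
        -- apply continuous_line.
      * apply continuous_RtoC. apply continuous_id.
Qed.

(** The half-plane is star-shaped about [k]. Differentiating [int_0^1 phi t r dr] under the integral
    gives [int_0^1 H' (k + r (t - k)) dr], which is the difference quotient by the fundamental
    theorem on the segment. This takes the place of Cauchy's theorem. *)
Lemma difference_quotient_primitive :
  exists F : C -> C, forall t, s0 < Re t -> t <> k ->
    cderiv F t ((H t - H k) / (t - k))%C.
Proof.
  exists (fun t => CRInt (phi t) 0 1). intros t Ht Htk.
  assert (tk : (t - k)%C <> 0).
  { intro E. apply Htk. replace t with (t - k + k)%C by ring. rewrite E. ring. }
  set (m := Rmin (Re k) (Re t)).
  assert (Hm : s0 < m) by now apply Rmin_glb_lt.
  set (s1 := ((s0 + m) / 2)%R). set (B := (Cmod k + Cmod t + 1)%R).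
  assert (Hs : s0 < s1) by (unfold s1; lra).
  destruct (HH s1 B Hs) as [K [K0 HK]].
  assert (mk : m <= Re k) by apply Rmin_l. assert (mt : m <= Re t) by apply Rmin_r.
  pose proof (Cmod_ge_0 k). pose proof (Cmod_ge_0 t).
  assert (Bk : box s1 B k) by (unfold s1, B; split; lra).
  assert (Bt : box s1 B t) by (unfold s1, B; split; lra).
  set (d := Rmin 1 ((m - s0) / 2)).
  assert (Hd : 0 < d) by (apply Rmin_pos; lra).
  assert (Bh : forall h, Cmod h < d -> box s1 B (t + h)).
  { intros h Hh. assert (d <= 1) by apply Rmin_l. assert (d <= (m - s0) / 2) by apply Rmin_r.
    split.
    - rewrite re_plus. pose proof (re_le_Cmod h) as E. apply Rabs_le_between in E.
      unfold s1. lra.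
    - eapply Rle_trans; [apply Cmod_triangle|]. unfold B. lra. }
  assert (HI : is_CRInt (fun r => H' (k + RtoC r * (t - k)) * (t - k))%C 0 1 (H t - H k)%C).
  { replace (H t - H k)%C with (H (k + RtoC 1 * (t - k)) - H (k + RtoC 0 * (t - k)))%C
      by (f_equal; [f_equal; ring|f_equal; f_equal; ring]).
    rewrite <- (Rmin_left 0 1) at 1 by lra.
    rewrite <- (Rmax_right 0 1) at 2 by lra. rewrite Rmin_left, Rmax_right by lra.
    apply (is_CRInt_derive (fun r => H (k + RtoC r * (t - k)))); intros r Hr;
      rewrite Rmin_left, Rmax_right in Hr by lra.
    - apply (cderiv_path H (fun r => k + RtoC r * (t - k))%C); [|apply is_Cderive_line].
      apply (holo_cderiv s0); [exact HH|]. now apply Re_segment_gt.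
    - apply continuous_Cmult; [|apply continuous_Cconst].
      apply (continuous_path_comp H' (fun r => k + RtoC r * (t - k))%C).
      + apply (holo_derivative_continuous s0 H H'); [exact HH|]. now apply Re_segment_gt.
      + apply continuous_line. }
  apply (is_CRInt_mult (/ (t - k))%C) in HI.
  assert (HI' : is_CRInt (fun r => H' (k + RtoC r * (t - k))) 0 1 ((H t - H k) / (t - k))%C).
  { replace ((H t - H k) / (t - k))%C with (/ (t - k) * (H t - H k))%C by (field; exact tk).
    revert HI. apply is_CRInt_ext. intros r _. field. exact tk. }
  apply (cderiv_of_quadratic _ _ _ K d K0 Hd). intros h Hh.
  assert (Hth : s0 < Re (t + h)) by (destruct (Bh h Hh); lra).
  assert (HD : is_CRInt (fun r => phi (t + h) r - phi t r - h * H' (k + RtoC r * (t - k)))%C 0 1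
    (CRInt (phi (t + h)%C) 0 1 - CRInt (phi t) 0 1 - h * ((H t - H k) / (t - k)))%C).
  { apply is_CRInt_minus; [apply is_CRInt_minus|].
    - apply is_CRInt_CRInt. intros r Hr. rewrite Rmin_left, Rmax_right in Hr by lra.
      now apply continuous_quotient_path.
    - apply is_CRInt_CRInt. intros r Hr. rewrite Rmin_left, Rmax_right in Hr by lra.
      now apply continuous_quotient_path.
    - now apply is_CRInt_mult. }
  replace (K * Cmod h ^ 2)%R with ((1 - 0) * (K * Cmod h ^ 2))%R by ring.
  revert HD. apply is_CRInt_norm_le_const; [lra|]. intros r Hr.
  pose proof (Rmult_le_pos _ _ K0 (pow2_ge_0 (Cmod h))) as Hpos.
  unfold phi. destruct (Req_EM_T r 0) as [->|Hr0].
  - replace (k + RtoC 0 * (t - k))%C with k by ring.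
    replace (H' k * (t + h - k) - H' k * (t - k) - h * H' k)%C with (RtoC 0) by ring.
    now rewrite Cmod_0.
  - assert (rC : RtoC r <> 0) by (intro X; apply Hr0; now apply RtoC_inj).
    pose proof (HK _ _ (box_segment s1 B k t r Hr Bk Bt)
      (box_segment s1 B k (t + h)%C r Hr Bk (Bh h Hh))) as E.
    replace (k + r * (t + h - k) - (k + r * (t - k)))%C with (RtoC r * h)%C in E by ring.
    set (U := H (k + r * (t + h - k))) in *. set (V := H (k + r * (t - k))) in *.
    set (W := H' (k + r * (t - k))) in *.
    replace ((U - H k) / r - (V - H k) / r - h * W)%C with ((U - V - r * h * W) / r)%C
      by (field; exact rC).
    rewrite Cmod_div, Cmod_R, Rabs_pos_eq by (exact rC || lra).
    apply Rmult_le_reg_r with r; [lra|]. unfold Rdiv.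
    rewrite Rmult_assoc, Rinv_l, Rmult_1_r by lra.
    eapply Rle_trans; [exact E|]. rewrite Cmod_mult, Cmod_R, Rabs_pos_eq, Rpow_mult_distr by lra.
    (* The argument moves by [r h], so the quadratic remainder carries [r ^ 2] and survives the
       division by [r]. *)
    replace (K * (r ^ 2 * Cmod h ^ 2))%R with ((K * Cmod h ^ 2) * (r * r))%R by ring.
    apply Rmult_le_compat_l; [exact Hpos|]. nra.
Qed.

End DifferenceQuotient.

Lemma Csub_neq_0 (t k : C) : t <> k -> (t - k)%C <> 0.
Proof.
  intros Htk E. apply Htk. replace t with (t - k + k)%C by ring. rewrite E. ring.
Qed.

(** [f] is the difference quotient at [k] of [(t - k) f t], which vanishes at [k]. The excluded
    point [k] is free and can be placed away from the region of interest. *)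
Lemma holo_primitive (s0 : R) (f f' : C -> C) (k : C) :
  holo s0 f f' -> s0 < Re k ->
  exists F : C -> C, forall t, s0 < Re t -> t <> k -> cderiv F t (f t).
Proof.
  intros Hf Hk.
  destruct (difference_quotient_primitive s0 (fun t => (t + - k) * f t)%C
    (fun t => (1 + 0) * f t + (t + - k) * f' t)%C k) as [F HF]; [|exact Hk|].
  - apply (holo_mult s0 (fun t => t + - k)%C (fun _ => 1 + 0)%C); [|exact Hf].
    apply holo_plus; [apply holo_id|apply holo_const].
  - exists F. intros t Ht Htk. specialize (HF t Ht Htk).
    replace (f t) with (((t + - k) * f t - (k + - k) * f k) / (t - k))%C; [exact HF|].
    field. now apply Csub_neq_0.
Qed.

(** * Contour integrals *)

Lemma piecewise_increasing (p : nat -> R) (m : nat) :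
  (forall i, (i < m)%nat -> p i < p (S i)) ->
  forall i j, (i <= j <= m)%nat -> p i <= p j.
Proof.
  intros H i j [Hij Hj]. induction Hij as [|j Hij IH]; [lra|].
  specialize (IH ltac:(lia)). specialize (H j ltac:(lia)). lra.
Qed.

(** [Derive] is total and may be meaningless at a break point; inside a piece, [g] agrees with the
    smooth [h] on a neighbourhood. *)
Lemma path_derive_interior (g h dh : R -> C) (p q u : R) :
  (forall u, p <= u <= q -> g u = h u) -> p < u < q -> is_Cderive h u (dh u) ->
  path_derive g u = dh u.
Proof.
  intros Hgh Hu Hd.
  assert (Hloc : locally u (fun v => h v = g v)).
  { assert (He : 0 < Rmin (u - p) (q - u)) by (apply Rmin_pos; lra).
    exists (mkposreal _ He). intros v Hv.
    change (Rabs (v - u) < Rmin (u - p) (q - u)) in Hv.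
    pose proof (Rmin_l (u - p) (q - u)). pose proof (Rmin_r (u - p) (q - u)).
    apply Rabs_lt_between in Hv. symmetry. apply Hgh. lra. }
  unfold path_derive. destruct (dh u) as [d1 d2].
  destruct (proj1 (is_Cderive_components h u (d1, d2)) Hd) as [D1 D2].
  f_equal; apply is_derive_unique.
  - apply (is_derive_ext_loc (fun v => Re (h v))); [|exact D1].
    revert Hloc. apply filter_imp. now intros v ->.
  - apply (is_derive_ext_loc (fun v => Im (h v))); [|exact D2].
    revert Hloc. apply filter_imp. now intros v ->.
Qed.

(** The relational form carries integrability along, which the total function [contour_int] does
    not. *)
Definition is_contour (g : R -> C) (a b : R) (f : C -> C) (v : C) : Prop :=
  is_CRInt (fun u => f (g u) * path_derive g u)%C a b v.

Section Contour.
Context (g : R -> C) (a b : R) (Hg : closed_contour g a b) (f : C -> C)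
  (Hf : forall u, a <= u <= b -> continuous (T := C_UniformSpace) (U := C_UniformSpace) f (g u)).

Lemma is_contour_exists : exists v, is_contour g a b f v.
Proof.
  destruct Hg as [Hab [[m [p [Hp0 [Hpm Hp]]]] _]].
  assert (Hmon := piecewise_increasing p m (fun i Hi => proj1 (Hp i Hi))).
  assert (W : forall i, (i <= m)%nat -> exists v, is_contour g (p 0%nat) (p i) f v).
  { induction i as [|i IH]; intros Hi.
    - exists 0. apply (is_RInt_point (V := C_R_NormedModule)).
    - destruct (IH ltac:(lia)) as [v Hv].
      destruct (Hp i ltac:(lia)) as [Hlt [h [[dh Hh] Hgh]]].
      assert (Hc : is_CRInt (fun u => f (h u) * dh u)%C (p i) (p (S i))
        (CRInt (fun u => f (h u) * dh u)%C (p i) (p (S i)))).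
      { apply is_CRInt_CRInt. rewrite Rmin_left, Rmax_right by lra. intros u Hu.
        apply continuous_Cmult; [|apply Hh].
        apply continuous_path_comp.
        - rewrite <- Hgh by exact Hu. apply Hf.
          pose proof (Hmon 0%nat i ltac:(lia)). pose proof (Hmon (S i) m ltac:(lia)). lra.
        - eapply is_Cderive_continuous. apply Hh. }
      exists (v + CRInt (fun u => f (h u) * dh u)%C (p i) (p (S i)))%C.
      eapply is_CRInt_Chasles; [exact Hv|].
      revert Hc. apply is_CRInt_ext. rewrite Rmin_left, Rmax_right by lra. intros u Hu.
      rewrite (Hgh u) by lra. f_equal. symmetry.
      apply (path_derive_interior g h dh (p i) (p (S i))); [exact Hgh|lra|apply Hh]. }
  destruct (W m (le_n m)) as [v Hv]. rewrite Hp0, Hpm in Hv. now exists v.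
Qed.

(** The increments of [F] over the smooth pieces telescope, and the end points coincide. *)
Lemma is_contour_primitive (F : C -> C) :
  (forall u, a <= u <= b -> cderiv F (g u) (f (g u))) -> is_contour g a b f 0.
Proof.
  intros HF. destruct Hg as [Hab [[m [p [Hp0 [Hpm Hp]]]] Hcl]].
  assert (Hmon := piecewise_increasing p m (fun i Hi => proj1 (Hp i Hi))).
  assert (W : forall i, (i <= m)%nat ->
    is_contour g (p 0%nat) (p i) f (F (g (p i)) - F (g (p 0%nat)))%C).
  { induction i as [|i IH]; intros Hi.
    - replace (F (g (p 0%nat)) - F (g (p 0%nat)))%C with (RtoC 0) by ring.
      apply (is_RInt_point (V := C_R_NormedModule)).
    - specialize (IH ltac:(lia)).
      destruct (Hp i ltac:(lia)) as [Hlt [h [[dh Hh] Hgh]]].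
      assert (Hin : forall u, p i <= u <= p (S i) -> a <= u <= b).
      { pose proof (Hmon 0%nat i ltac:(lia)). pose proof (Hmon (S i) m ltac:(lia)).
        intros; lra. }
      assert (Hc : is_CRInt (fun u => f (h u) * dh u)%C (p i) (p (S i))
        (F (h (p (S i))) - F (h (p i)))%C).
      { apply (is_CRInt_derive (fun u => F (h u)));
          rewrite Rmin_left, Rmax_right by lra; intros u Hu.
        - apply cderiv_path; [|apply Hh]. rewrite <- Hgh by exact Hu. now apply HF, Hin.
        - apply continuous_Cmult; [|apply Hh]. apply continuous_path_comp.
          + rewrite <- Hgh by exact Hu. now apply Hf, Hin.
          + eapply is_Cderive_continuous. apply Hh. }
      rewrite <- !Hgh in Hc by lra.
      replace (F (g (p (S i))) - F (g (p 0%nat)))%C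
        with ((F (g (p i)) - F (g (p 0%nat))) + (F (g (p (S i))) - F (g (p i))))%C by ring.
      eapply is_CRInt_Chasles; [exact IH|].
      revert Hc. apply is_CRInt_ext. rewrite Rmin_left, Rmax_right by lra. intros u Hu.
      rewrite (Hgh u) by lra. f_equal. symmetry.
      apply (path_derive_interior g h dh (p i) (p (S i))); [exact Hgh|lra|apply Hh]. }
  specialize (W m (le_n m)). rewrite Hp0, Hpm, Hcl in W.
  now replace (F (g b) - F (g b))%C with (RtoC 0) in W by ring.
Qed.

End Contour.

Lemma twopii_neq_0 : twopii <> 0.
Proof.
  unfold twopii. pose proof PI_RGT_0. intro E.
  apply (f_equal Im) in E. rewrite im_mult in E. unfold Im, Re, Ci, RtoC in E; simpl in E. nra.
Qed.

(** Of [(H t - H k) / (t - k)] and [H k / (t - k)], the first has a primitive off [k] and integrates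
    to [0]; the second is [H k] times the integral that defines the winding number. *)
Lemma residue_simple_pole (g : R -> C) (a b s0 : R) (H H' : C -> C) (k : C) :
  closed_contour g a b -> (forall u, a <= u <= b -> s0 < Re (g u)) ->
  holo s0 H H' -> s0 < Re k -> encircles_once g a b k ->
  is_contour g a b (fun t => H t / (t - k))%C (twopii * H k)%C.
Proof.
  intros Hg Hs HH Hk [Hoff Hwind].
  destruct (difference_quotient_primitive s0 H H' k HH Hk) as [F HF].
  assert (Hq : is_contour g a b (fun t => (H t - H k) / (t - k))%C 0).
  { apply (is_contour_primitive g a b Hg) with (F := F).
    - intros u Hu. apply continuous_Cdiv.
      + now apply Csub_neq_0, Hoff.
      + apply continuous_Cminus; [|apply continuous_Cconst].
        apply (holo_continuous s0 H H'); [exact HH|now apply Hs].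
      + apply continuous_Cminus; [apply continuous_id|apply continuous_Cconst].
    - intros u Hu. apply HF; [now apply Hs|now apply Hoff]. }
  destruct (is_contour_exists g a b Hg (fun t => / (t - k))%C) as [v Hv].
  { intros u Hu. apply continuous_Cinv; [now apply Csub_neq_0, Hoff|].
    apply continuous_Cminus; [apply continuous_id|apply continuous_Cconst]. }
  unfold contour_int in Hwind. rewrite (is_CRInt_eq _ _ _ _ Hv) in Hwind.
  assert (Ev : v = twopii).
  { replace v with (twopii * (/ twopii * v))%C by (field; apply twopii_neq_0).
    rewrite Hwind. ring. }
  subst v. apply (is_CRInt_mult (H k)) in Hv.
  replace (twopii * H k)%C with (0 + H k * twopii)%C by ring.
  apply (is_CRInt_ext (fun u => (H (g u) - H k) / (g u - k) * path_derive g u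
    + H k * (/ (g u - k) * path_derive g u))%C).
  - intros u Hu. rewrite Rmin_left, Rmax_right in Hu by (destruct Hg; lra).
    field. apply Csub_neq_0, Hoff. lra.
  - now apply is_CRInt_plus.
Qed.

(** * Shifting vertical segments *)

Lemma vline_eq (c u : R) : (c, u) = (RtoC c + RtoC u * Ci)%C.
Proof. unfold Cplus, Cmult, RtoC, Ci; simpl. f_equal; ring. Qed.

Lemma hline_eq (c u : R) : (c, u) = ((0, u) + RtoC c * 1)%C.
Proof. unfold Cplus, Cmult, RtoC; simpl. f_equal; ring. Qed.

Lemma continuous_vline (c u : R) : contC (fun v => (c, v)) u.
Proof.
  apply (continuous_ext (fun v => RtoC c + RtoC v * Ci)%C).
  - intros v. symmetry. apply vline_eq.
  - apply continuous_line.
Qed.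

Lemma continuous_hline (c u : R) : contC (fun v => (v, u)) c.
Proof.
  apply (continuous_ext (fun v => (0, u) + RtoC v * 1)%C).
  - intros v. symmetry. apply hline_eq.
  - apply continuous_line.
Qed.

Lemma is_Cderive_vline (c u : R) : is_Cderive (fun v => (c, v)) u Ci.
Proof.
  apply (is_derive_ext (V := C_R_NormedModule) (fun v => RtoC c + RtoC v * Ci)%C).
  - intros v. symmetry. apply vline_eq.
  - apply is_Cderive_line.
Qed.

Lemma is_Cderive_hline (c u : R) : is_Cderive (fun v => (v, u)) c 1.
Proof.
  apply (is_derive_ext (V := C_R_NormedModule) (fun v => (0, u) + RtoC v * 1)%C).
  - intros v. symmetry. apply hline_eq.
  - apply is_Cderive_line.
Qed.

(** A primitive along the four sides equates the difference of the vertical integrals with that of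
    the horizontal ones, each at most [(c' - c) e]. Only the boundary is asked for, because the
    point excluded by the primitive may lie inside. *)
Lemma rectangle_shift (F q : C -> C) (c c' T e : R) :
  0 < T -> c <= c' ->
  (forall s u, c <= s <= c' -> - T <= u <= T -> (s = c \/ s = c' \/ u = - T \/ u = T) ->
     cderiv F (s, u) (q (s, u)) /\
     continuous (T := C_UniformSpace) (U := C_UniformSpace) q (s, u)) ->
  (forall s, c <= s <= c' -> Cmod (q (s, T)) <= e /\ Cmod (q (s, - T)%R) <= e) ->
  Cmod (CRInt (fun u => q (c', u)) (- T) T - CRInt (fun u => q (c, u)) (- T) T)
    <= 2 * (c' - c) * e.
Proof.
  intros HT Hcc Hq He.
  assert (V : forall s, s = c \/ s = c' ->
    (Ci * CRInt (fun u => q (s, u)) (- T) T)%C = (F (s, T) - F (s, - T)%R)%C).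
  { intros s Hs.
    assert (Hd : forall u, - T <= u <= T -> cderiv F (s, u) (q (s, u)) /\
       continuous (T := C_UniformSpace) (U := C_UniformSpace) q (s, u)).
    { intros u Hu. apply Hq; [destruct Hs; lra|exact Hu|destruct Hs; auto]. }
    apply (is_CRInt_unique (fun u => Ci * q (s, u))%C (- T) T).
    - apply is_CRInt_mult. apply is_CRInt_CRInt. rewrite Rmin_left, Rmax_right by lra.
      intros u Hu. apply (continuous_path_comp q (fun u => (s, u)));
        [now apply Hd|apply continuous_vline].
    - apply (is_CRInt_ext (fun u => q (s, u) * Ci)%C); [intros; ring|].
      apply (is_CRInt_derive (fun u => F (s, u))); rewrite Rmin_left, Rmax_right by lra;
        intros u Hu.
      + apply (cderiv_path F (fun u => (s, u))); [now apply Hd|apply is_Cderive_vline].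
      + apply continuous_Cmult; [|apply continuous_Cconst].
        apply (continuous_path_comp q (fun u => (s, u))); [now apply Hd|apply continuous_vline]. }
  assert (Hz : forall u, u = - T \/ u = T -> Cmod (F (c', u) - F (c, u)) <= (c' - c) * e).
  { intros u Hu.
    apply (is_CRInt_norm_le_const (fun s => q (s, u) * 1)%C e c c' _ Hcc).
    - intros s Hs. rewrite Cmult_1_r. destruct (He s Hs). destruct Hu as [->| ->]; assumption.
    - assert (Hd : forall s, c <= s <= c' -> cderiv F (s, u) (q (s, u)) /\
        continuous (T := C_UniformSpace) (U := C_UniformSpace) q (s, u)).
      { intros s Hs. apply Hq; [exact Hs|destruct Hu; lra|tauto]. }
      apply (is_CRInt_derive (fun s => F (s, u))); rewrite Rmin_left, Rmax_right by lra;
        intros s Hs.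
      + apply (cderiv_path F (fun s => (s, u))); [now apply Hd|apply is_Cderive_hline].
      + apply continuous_Cmult; [|apply continuous_Cconst].
        apply (continuous_path_comp q (fun s => (s, u))); [now apply Hd|apply continuous_hline]. }
  (* A factor [Ci] of modulus one turns the vertical integrals into differences of [F], which are
     then regrouped along the horizontal sides. *)
  rewrite <- (Rmult_1_l (Cmod _)), <- Cmod_Ci, <- Cmod_mult.
  replace (Ci * (CRInt (fun u => q (c', u)) (- T) T - CRInt (fun u => q (c, u)) (- T) T))%C
    with ((F (c', T) - F (c, T)) - (F (c', (- T)%R) - F (c, (- T)%R)))%C.
  - eapply Rle_trans; [apply Cmod_sub_le|].
    pose proof (Hz T (or_intror eq_refl)). pose proof (Hz (- T)%R (or_introl eq_refl)). lra.
  - replace (Ci * (CRInt (fun u => q (c', u)) (- T) T - CRInt (fun u => q (c, u)) (- T) T))%C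
      with (Ci * CRInt (fun u => q (c', u)) (- T) T - Ci * CRInt (fun u => q (c, u)) (- T) T)%C by ring.
    rewrite !V by auto. ring.
Qed.

(** * The Gamma function on the right half-plane *)

(* The integrand of [Gamma] after the substitution [x = exp v]; the factor
   [v ^ m] comes from differentiating [m] times in [z]. *)
Definition gamma_integrand (m : nat) (z : C) (v : R) : C :=
  (RtoC (v ^ m * exp (- exp v)) * Cexp (z * RtoC v))%C.

Lemma exp_pow_INR (a : R) (n : nat) : exp a ^ n = exp (INR n * a).
Proof.
  induction n as [|n IH]; [simpl; now rewrite Rmult_0_l, exp_0|].
  simpl pow. rewrite IH, <- exp_plus. f_equal. rewrite S_INR. ring.
Qed.

(** The inequality [1 + x <= exp x] at [x = d w / (N + 1)], raised to the power [N]. Dividing by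
    [N + 1] instead of [N] covers [N = 0] and keeps the final exponent below [d w]. *)
Lemma pow_le_exp (N : nat) (d w : R) : 0 < d <= 1 -> 0 <= w ->
  (1 + w) ^ N <= (INR (S N) / d) ^ N * exp (d * w).
Proof.
  intros Hd Hw. pose proof (lt_0_INR (S N) ltac:(lia)) as HN.
  set (M := INR (S N)) in *.
  assert (HM : 1 <= M) by (unfold M; rewrite S_INR; pose proof (pos_INR N); lra).
  assert (H1 : 1 + w <= M / d * exp (d * w / M)).
  { pose proof (exp_ineq1_le (d * w / M)) as E.
    assert (Hq : 0 < M / d) by (apply Rdiv_lt_0_compat; lra).
    apply Rle_trans with (M / d * (1 + d * w / M))%R.
    - replace (M / d * (1 + d * w / M))%R with (M / d + w)%R by (field; lra).
      apply Rplus_le_compat_r. apply Rmult_le_reg_r with d; [lra|].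
      unfold Rdiv. rewrite Rmult_assoc, Rinv_l by lra. lra.
    - apply Rmult_le_compat_l; lra. }
  apply Rle_trans with ((M / d * exp (d * w / M)) ^ N)%R.
  - apply pow_incr. lra.
  - rewrite Rpow_mult_distr. apply Rmult_le_compat_l.
    { apply pow_le. left. apply Rdiv_lt_0_compat; lra. }
    rewrite exp_pow_INR. apply exp_le_exp.
    assert (Hdw : 0 <= d * w) by nra.
    apply Rmult_le_reg_r with M; [exact HN|].
    replace (INR N * (d * w / M) * M)%R with (INR N * (d * w))%R by (field; lra).
    unfold M. rewrite S_INR. nra.
Qed.

(** The maximum in [v] is at [v = ln a]; convexity of [exp] enters through its tangent there. *)
Lemma mul_sub_exp_le (a v : R) : 1 <= a -> a * v - exp v <= a * ln a.
Proof.
  intros Ha. pose proof (exp_ineq1_le (v - ln a)) as E.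
  assert (exp v = a * exp (v - ln a))%R.
  { unfold Rminus. rewrite exp_plus, exp_Ropp, exp_ln by lra. field. lra. }
  nra.
Qed.

(** For [v < 0] the decay comes from [exp (s v)] with [s >= s1], for [v >= 0] from [exp (- exp v)].
    The factor [|v| ^ m (1 + v ^ 2)] is traded for [exp (d |v|)]: as [d <= s1], the exponent stays
    nonpositive on the left, and as [d <= 1], it is at most [a v - exp v] with [a = 1 + |s2|] on the
    right. *)
Lemma gamma_weight_le (m : nat) (s1 s2 : R) : 0 < s1 ->
  exists K, 0 <= K /\ forall s v, s1 <= s <= s2 ->
    Rabs v ^ m * exp (- exp v) * exp (s * v) <= K / (1 + v ^ 2).
Proof.
  intros Hs1. set (d := Rmin 1 s1).
  assert (Hd : 0 < d) by (apply Rmin_pos; lra).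
  assert (Hd1 : d <= 1) by apply Rmin_l. assert (Hd2 : d <= s1) by apply Rmin_r.
  set (a := (1 + Rabs s2)%R).
  assert (Ha : 1 <= a) by (unfold a; pose proof (Rabs_pos s2); lra).
  set (P := ((INR (S (m + 2)) / d) ^ (m + 2))%R).
  assert (HP : 0 <= P).
  { apply pow_le. left. apply Rdiv_lt_0_compat; [apply lt_0_INR; lia|exact Hd]. }
  exists (P * (1 + exp (a * ln a)))%R. pose proof (exp_pos (a * ln a)) as HE.
  split; [apply Rmult_le_pos; lra|]. intros s v Hs.
  pose proof (one_sqr_pos v) as Hv.
  apply Rmult_le_reg_r with (1 + v ^ 2)%R; [exact Hv|].
  replace (P * (1 + exp (a * ln a)) / (1 + v ^ 2) * (1 + v ^ 2))%R
    with (P * (1 + exp (a * ln a)))%R by (field; lra).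
  assert (Hp : Rabs v ^ m * (1 + v ^ 2) <= P * exp (d * Rabs v)).
  { eapply Rle_trans; [|apply (pow_le_exp (m + 2)); [lra|apply Rabs_pos]].
    rewrite pow_add. pose proof (Rabs_pos v).
    apply Rmult_le_compat.
    - now apply pow_le.
    - lra.
    - apply pow_incr. lra.
    - rewrite <- pow2_abs. nra. }
  apply Rle_trans with (P * exp (d * Rabs v) * (exp (- exp v) * exp (s * v)))%R.
  { replace (Rabs v ^ m * exp (- exp v) * exp (s * v) * (1 + v ^ 2))%R
      with (Rabs v ^ m * (1 + v ^ 2) * (exp (- exp v) * exp (s * v)))%R by ring.
    apply Rmult_le_compat_r; [|exact Hp].
    apply Rmult_le_pos; left; apply exp_pos. }
  rewrite !Rmult_assoc. apply Rmult_le_compat_l; [exact HP|].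
  rewrite <- !exp_plus. destruct (Rle_dec 0 v) as [H0|H0].
  - rewrite Rabs_pos_eq by exact H0.
    apply Rle_trans with (exp (a * ln a)); [|lra]. apply exp_le_exp.
    eapply Rle_trans; [|apply (mul_sub_exp_le a v Ha)].
    assert (s <= Rabs s2) by (pose proof (Rle_abs s2); lra).
    unfold a. nra.
  - rewrite Rabs_left by lra.
    apply Rle_trans with (exp 0); [|rewrite exp_0; lra]. apply exp_le_exp.
    pose proof (exp_pos v). nra.
Qed.

Lemma continuous_gamma_integrand (m : nat) (z : C) (v : R) : contC (gamma_integrand m z) v.
Proof.
  unfold gamma_integrand. apply continuous_Cmult.
  - apply continuous_RtoC. apply (ex_derive_continuous (V := R_NormedModule)).
    auto_derive. trivial.
  - apply (continuous_ext (fun r => Cexp (RtoC r * z))).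
    + intros r. f_equal. ring.
    + apply continuous_path_Cexp.
Qed.

Lemma Re_mul_R (z : C) (r : R) : Re (z * RtoC r) = (Re z * r)%R.
Proof. apply re_scal_r. Qed.

Lemma Cmod_gamma_integrand (m : nat) (z : C) (v : R) :
  Cmod (gamma_integrand m z v) = (Rabs v ^ m * exp (- exp v) * exp (Re z * v))%R.
Proof.
  unfold gamma_integrand. rewrite Cmod_mult, Cmod_R, Cmod_Cexp, Re_mul_R.
  rewrite Rabs_mult, RPow_abs, (Rabs_pos_eq (exp _)) by (left; apply exp_pos). reflexivity.
Qed.

Lemma gamma_dominated (m : nat) (s1 s2 : R) : 0 < s1 -> exists K, 0 <= K /\
  forall z, s1 <= Re z <= s2 -> dominated (gamma_integrand m z) K.
Proof.
  intros Hs. destruct (gamma_weight_le m s1 s2 Hs) as [K [K0 HK]].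
  exists K. split; [exact K0|]. intros z Hz. split.
  - intros v. apply continuous_gamma_integrand.
  - intros v. rewrite Cmod_gamma_integrand. now apply HK.
Qed.

Lemma gamma_dominated_at (m : nat) (z : C) : 0 < Re z -> exists K, dominated (gamma_integrand m z) K.
Proof.
  intros Hz. destruct (gamma_dominated m (Re z) (Re z) Hz) as [K [_ HK]].
  exists K. apply HK. lra.
Qed.

Definition Gam (z : C) : C := J (gamma_integrand 0 z).

(** Differentiation under the integral: the derivative in [z] brings down [v], and the second-order
    remainder is dominated by the weight with [v ^ 2], uniformly on a box. *)
Lemma holo_Gam : holo 0 Gam (fun z => J (gamma_integrand 1 z)).
Proof.
  intros s1 B Hs. destruct (gamma_weight_le 2 s1 B Hs) as [K [K0 HK]].
  (* The Taylor bound contains [2 + exp (Re (w - z) v)]: two copies of the weight at [Re z] and one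
     at [Re w]. *)
  exists (PI * (3 * K))%R. pose proof PI_RGT_0 as Hpi. split; [nra|]. intros z w Hz Hw.
  assert (Rz : s1 <= Re z <= B).
  { destruct Hz as [H1 H2]. split; [exact H1|].
    pose proof (re_le_Cmod z) as E. pose proof (Rle_abs (Re z)). lra. }
  assert (Rw : s1 <= Re w <= B).
  { destruct Hw as [H1 H2]. split; [exact H1|].
    pose proof (re_le_Cmod w) as E. pose proof (Rle_abs (Re w)). lra. }
  destruct (gamma_dominated_at 0 z ltac:(lra)) as [Kz HKz].
  destruct (gamma_dominated_at 0 w ltac:(lra)) as [Kw HKw].
  destruct (gamma_dominated_at 1 z ltac:(lra)) as [K1 HK1].
  set (D := fun v => (gamma_integrand 0 w v + (-1) * gamma_integrand 0 z v
    + (- (w - z)) * gamma_integrand 1 z v)%C).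
  assert (ED : (Gam w - Gam z - (w - z) * J (gamma_integrand 1 z))%C = J D).
  { unfold D. erewrite J_plus;
      [|apply dominated_plus; [exact HKw|apply dominated_mult, HKz]|apply dominated_mult, HK1].
    erewrite J_plus; [|exact HKw|apply dominated_mult, HKz].
    erewrite !J_mult by eassumption. unfold Gam. ring. }
  rewrite ED, Rmult_assoc. apply J_norm. split.
  - apply (dominated_plus _ _ _ _ (dominated_plus _ _ _ _ HKw (dominated_mult (-1) _ _ HKz))
      (dominated_mult (- (w - z)) _ _ HK1)).
  - intros v. set (h := (w - z)%C).
    assert (E : D v = (RtoC (exp (- exp v)) * Cexp (z * RtoC v)
      * (Cexp (h * RtoC v) - 1 - h * RtoC v))%C).
    { unfold D, gamma_integrand. replace (w * RtoC v)%C with (z * RtoC v + h * RtoC v)%C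
        by (unfold h; ring).
      rewrite Cexp_plus. fold h. rewrite !RtoC_mult. simpl. rewrite Rmult_1_r. ring. }
    rewrite E, !Cmod_mult, Cmod_R, Cmod_Cexp, Re_mul_R, Rabs_pos_eq by (left; apply exp_pos).
    pose proof (Cexp_taylor_le (h * RtoC v)) as ET.
    rewrite Cmod_mult, Cmod_R, Re_mul_R in ET.
    pose proof (HK (Re z) v Rz) as Bz. pose proof (HK (Re w) v Rw) as Bw.
    replace (Re w) with (Re z + Re h)%R in Bw
      by (unfold h, Cminus; rewrite re_plus, re_opp; ring).
    rewrite Rmult_plus_distr_r, exp_plus in Bw.
    pose proof (exp_pos (- exp v)) as P1. pose proof (exp_pos (Re z * v)) as P2.
    apply Rle_trans with (exp (- exp v) * exp (Re z * v) *
      ((Cmod h * Rabs v) ^ 2 * (2 + exp (Re h * v))))%R.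
    { apply Rmult_le_compat_l; [|exact ET]. apply Rmult_le_pos; lra. }
    rewrite Rpow_mult_distr.
    replace (exp (- exp v) * exp (Re z * v) * (Cmod h ^ 2 * Rabs v ^ 2 * (2 + exp (Re h * v))))%R
      with (Cmod h ^ 2 * (2 * (Rabs v ^ 2 * exp (- exp v) * exp (Re z * v))
        + Rabs v ^ 2 * exp (- exp v) * (exp (Re z * v) * exp (Re h * v))))%R by ring.
    replace (3 * K * Cmod h ^ 2 / (1 + v ^ 2))%R
      with (Cmod h ^ 2 * (2 * (K / (1 + v ^ 2)) + K / (1 + v ^ 2)))%R
      by (field; pose proof (one_sqr_pos v); lra).
    apply Rmult_le_compat_l; [apply pow2_ge_0|lra].
Qed.

Lemma Gam_bounded (s1 s2 : R) : 0 < s1 -> exists K, 0 <= K /\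
  forall z, s1 <= Re z <= s2 -> Cmod (Gam z) <= K.
Proof.
  intros Hs. destruct (gamma_dominated 0 s1 s2 Hs) as [K [K0 HK]].
  exists (PI * K)%R. pose proof PI_RGT_0. split; [nra|]. intros z Hz.
  apply J_norm. now apply HK.
Qed.

(** The substitution [x = exp v]; [ln] carries the two ends of the half-line to the two ends of the
    real line. *)
Lemma is_CRInt_0oo_subst (f F : R -> C) (v : C) :
  (forall u, contC F u) -> (forall x, 0 < x -> f x = (RtoC (/ x) * F (ln x))%C) ->
  is_J F v -> is_CRInt_0oo f v.
Proof.
  intros HF Hf HJ.
  assert (Hab : forall a b, 0 < a -> 0 < b -> is_CRInt f a b (CRInt F (ln a) (ln b))).
  { intros a b Ha Hb.
    assert (Hpos : forall x, Rmin a b <= x -> 0 < x).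
    { intros x Hx. eapply Rlt_le_trans; [|exact Hx]. now apply Rmin_pos. }
    apply (is_CRInt_ext (fun x => scal (V := C_R_NormedModule) (/ x)%R (F (ln x)))).
    - intros x Hx. rewrite Hf by (apply Hpos; lra).
      destruct (F (ln x)) as [p q]. unfold scal; simpl. unfold prod_scal, scal; simpl.
      unfold mult, Cmult, RtoC; simpl. f_equal; ring.
    - apply (is_RInt_comp (V := C_R_CompleteNormedModule) F ln Rinv).
      + intros x _. apply HF.
      + intros x [Hx _]. specialize (Hpos x Hx). split.
        * auto_derive; [exact Hpos|field; lra].
        * apply continuous_Rinv. lra. }
  pose proof (is_RInt_gen_CRInt F _ _ v HJ) as H.
  intros P HP. specialize (H P HP). unfold filtermapi, filtermap in *.
  destruct H as [Q1 Q2 HQ1 HQ2 H].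
  assert (L1 : at_right 0 (fun a => Q1 (ln a))) by (apply is_lim_ln_0; exact HQ1).
  assert (L2 : Rbar_locally p_infty (fun b => Q2 (ln b))) by (apply is_lim_ln_p; exact HQ2).
  apply (Filter_prod _ _ _ (fun a => Q1 (ln a) /\ 0 < a) (fun b => Q2 (ln b) /\ 0 < b)).
  - apply filter_and; [exact L1|]. exists (mkposreal 1 Rlt_0_1). intros y _ Hy. exact Hy.
  - apply filter_and; [exact L2|]. exists 0. intros y Hy. exact Hy.
  - intros a b [Ha1 Ha2] [Hb1 Hb2]. exists (CRInt F (ln a) (ln b)). split.
    + now apply Hab.
    + now apply (H (ln a) (ln b)).
Qed.

Lemma CRInt_0oo_eq (f : R -> C) (v : C) : is_CRInt_0oo f v -> CRInt_0oo f = v.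
Proof. intros H. exact (is_RInt_gen_unique (V := C_R_CompleteNormedModule) f v H). Qed.

Lemma Gamma_int_Gam (z : C) : 0 < Re z -> Gamma_int z = Gam z.
Proof.
  intros Hz. apply CRInt_0oo_eq.
  apply (is_CRInt_0oo_subst _ (gamma_integrand 0 z)).
  - intros u. apply continuous_gamma_integrand.
  - intros x Hx. unfold gamma_integrand, Cpowr. rewrite exp_ln by exact Hx.
    replace (z * ln x)%C with ((z - 1) * ln x + RtoC (ln x))%C by ring.
    rewrite Cexp_plus, Cexp_RtoC, exp_ln by exact Hx.
    rewrite RtoC_mult, RtoC_inv by lra. simpl.
    assert (Hx0 : RtoC x <> 0) by (intro E; apply RtoC_inj in E; lra).
    field. exact Hx0.
  - destruct (gamma_dominated_at 0 z Hz) as [K HK]. exact (J_ex _ K HK).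
Qed.

(** Integration by parts: [z Gam z - Gam (z + 1)] is the integral of the derivative of
    [exp (z v - exp v)], which vanishes at both ends. *)
Lemma Gam_succ (z : C) : 0 < Re z -> Gam (z + 1) = (z * Gam z)%C.
Proof.
  intros Hz.
  destruct (gamma_dominated_at 0 z Hz) as [K0 H0].
  assert (Hz1 : 0 < Re (z + 1)) by (rewrite re_plus, re_RtoC; lra).
  destruct (gamma_dominated_at 0 (z + 1) Hz1) as [K1 H1].
  set (D := fun v => (z * gamma_integrand 0 z v + (-1) * gamma_integrand 0 (z + 1) v)%C).
  assert (ED : J D = (z * Gam z - Gam (z + 1))%C).
  { unfold D. erewrite J_plus; [|apply dominated_mult, H0|apply dominated_mult, H1].
    erewrite !J_mult by eassumption. unfold Gam. ring. }
  assert (HD : dominated D (Cmod z * K0 + Cmod (-1) * K1)).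
  { apply dominated_plus; now apply dominated_mult. }
  assert (Hder : forall v, is_Cderive (gamma_integrand 0 z) v (D v)).
  { intros v. destruct z as [p q].
    assert (EG : forall t p, gamma_integrand 0 (p, q) t
      = (exp (p * t - exp t) * cos (t * q), exp (p * t - exp t) * sin (t * q))%R).
    { intros t p'. unfold gamma_integrand.
      replace ((p', q) * RtoC t)%C with (RtoC t * (p', q))%C by ring.
      rewrite Cexp_coord, (Rmult_comm t p'). unfold Rminus. rewrite exp_plus.
      unfold Cmult, RtoC; simpl. f_equal; ring. }
    assert (E1 : ((p, q) + 1)%C = ((p + 1)%R, q)).
    { unfold Cplus, RtoC; simpl. f_equal. ring. }
    unfold D. rewrite E1. apply is_Cderive_components. split.
    - apply (is_derive_ext (fun t => exp (p * t - exp t) * cos (t * q))%R).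
      { intros t. now rewrite EG. }
      auto_derive; [trivial|]. rewrite !EG.
      replace ((p + 1) * v - exp v)%R with ((p * v - exp v) + v)%R by ring.
      unfold Re, Cplus, Cmult, RtoC; simpl. unfold Rminus. rewrite !exp_plus. ring.
    - apply (is_derive_ext (fun t => exp (p * t - exp t) * sin (t * q))%R).
      { intros t. now rewrite EG. }
      auto_derive; [trivial|]. rewrite !EG.
      replace ((p + 1) * v - exp v)%R with ((p * v - exp v) + v)%R by ring.
      unfold Im, Cplus, Cmult, RtoC; simpl. unfold Rminus. rewrite !exp_plus. ring. }
  assert (HJ0 : J D = 0).
  { apply (J_unique D _ 0 HD). apply filterlim_C; [typeclasses eauto|]. intros e He.
    exists (Rmax 1 (2 * K0 / e)). intros T HT.
    pose proof (Rmax_l 1 (2 * K0 / e)). pose proof (Rmax_r 1 (2 * K0 / e)).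
    rewrite (is_CRInt_eq D (- T) T (gamma_integrand 0 z T - gamma_integrand 0 z (- T)%R)%C).
    - replace (gamma_integrand 0 z T - gamma_integrand 0 z (- T)%R - 0)%C
        with (gamma_integrand 0 z T - gamma_integrand 0 z (- T)%R)%C by ring.
      eapply Rle_lt_trans; [apply Cmod_sub_le|].
      destruct H0 as [_ H0]. pose proof (H0 T) as B1. pose proof (H0 (- T)%R) as B2.
      replace ((- T) ^ 2)%R with (T ^ 2)%R in B2 by ring.
      apply Rle_lt_trans with (2 * K0 / (1 + T ^ 2))%R; [unfold Rdiv in *; lra|].
      apply Rmult_lt_reg_r with (1 + T ^ 2)%R; [apply one_sqr_pos|].
      unfold Rdiv. rewrite Rmult_assoc, Rinv_l, Rmult_1_r
        by (pose proof (one_sqr_pos T); lra).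
      assert (HTe : 2 * K0 / e < T) by lra.
      apply Rmult_lt_compat_r with (r := e) in HTe; [|exact He].
      replace (2 * K0 / e * e)%R with (2 * K0)%R in HTe by (field; lra).
      assert (T * e <= T ^ 2 * e) by (apply Rmult_le_compat_r; nra). lra.
    - apply is_CRInt_derive; intros u _; [apply Hder|apply HD]. }
  rewrite HJ0 in ED. replace (Gam (z + 1)) with (z * Gam z - (z * Gam z - Gam (z + 1)))%C by ring.
  rewrite <- ED. ring.
Qed.

Fixpoint Cprodn (f : nat -> C) (n : nat) : C :=
  match n with 0%nat => RtoC 1 | S n => (Cprodn f n * f n)%C end.

Lemma Cprodn_ext (f g : nat -> C) (n : nat) :
  (forall i, (i < n)%nat -> f i = g i) -> Cprodn f n = Cprodn g n.
Proof.
  induction n as [|n IH]; intros H; simpl; [reflexivity|].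
  rewrite IH by (intros; apply H; lia). now rewrite H by lia.
Qed.

Lemma Cprodn_add (f : nat -> C) (m n : nat) :
  Cprodn f (m + n) = (Cprodn f m * Cprodn (fun i => f (m + i)%nat) n)%C.
Proof.
  induction n as [|n IH]; simpl.
  - rewrite Nat.add_0_r. ring.
  - rewrite Nat.add_succ_r. simpl. rewrite IH. ring.
Qed.

Lemma Cprodn_neq_0 (f : nat -> C) (n : nat) :
  (forall i, (i < n)%nat -> f i <> 0) -> Cprodn f n <> 0.
Proof.
  induction n as [|n IH]; intros H; simpl.
  - intro E. apply RtoC_inj in E. lra.
  - apply Cmult_neq_0; [apply IH; intros; apply H; lia|apply H; lia].
Qed.

Definition poch (z : C) (n : nat) : C := Cprodn (fun i => z + RtoC (INR i))%C n.

Lemma RtoC_S (n : nat) : RtoC (INR (S n)) = (RtoC (INR n) + 1)%C.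
Proof. now rewrite S_INR, RtoC_plus. Qed.

Lemma poch_add (z : C) (m n : nat) : poch z (m + n) = (poch z m * poch (z + RtoC (INR m)) n)%C.
Proof.
  unfold poch. rewrite Cprodn_add. f_equal. apply Cprodn_ext. intros i _.
  rewrite plus_INR, RtoC_plus. ring.
Qed.

Lemma Re_plus_INR (z : C) (n : nat) : Re (z + RtoC (INR n)) = (Re z + INR n)%R.
Proof. now rewrite re_plus, re_RtoC. Qed.

Lemma Gam_poch (z : C) (n : nat) : 0 < Re z -> Gam (z + RtoC (INR n)) = (poch z n * Gam z)%C.
Proof.
  intros Hz. induction n as [|n IH].
  - unfold poch; simpl. rewrite Cplus_0_r. ring.
  - replace (z + RtoC (INR (S n)))%C with (z + RtoC (INR n) + 1)%C by (rewrite RtoC_S; ring).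
    rewrite Gam_succ by (rewrite Re_plus_INR; pose proof (pos_INR n); lra).
    rewrite IH. unfold poch; simpl. ring.
Qed.

Lemma Cneq_Re (z w : C) : Re z <> Re w -> z <> w.
Proof. intros H E. apply H. now rewrite E. Qed.

Lemma poch_neq_0 (z : C) (n : nat) : 0 < Re z -> poch z n <> 0.
Proof.
  intros Hz. apply Cprodn_neq_0. intros i _. apply Cneq_Re.
  rewrite Re_plus_INR, re_RtoC. pose proof (pos_INR i). lra.
Qed.

Lemma fold_right_Cmult_init (l : list C) (c : C) :
  fold_right Cmult c l = (fold_right Cmult (RtoC 1) l * c)%C.
Proof. induction l as [|x l IH]; simpl; [ring|]. rewrite IH. ring. Qed.

Lemma fold_right_poch (z : C) (m : nat) :
  fold_right Cmult (RtoC 1) (map (fun i => z + RtoC (INR i))%C (List.seq 0 m)) = poch z m.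
Proof.
  induction m as [|m IH]; [reflexivity|].
  rewrite List.seq_S, map_app, fold_right_app. simpl.
  rewrite fold_right_Cmult_init, IH. unfold poch; simpl. ring.
Qed.

(** [Gamma] shifts by the least admissible integer, which varies with [z]. By the functional
    equation any larger shift gives the same value, so a single [m] can be used along a whole
    contour. *)
Lemma Gamma_shifted (z : C) (m : nat) :
  0 < Re z + INR m -> (forall i, (i < m)%nat -> (z + RtoC (INR i))%C <> 0) ->
  Gamma z = (Gam (z + RtoC (INR m)) / poch z m)%C.
Proof.
  intros Hm Hnz. unfold Gamma. set (k := Gamma_shift z). rewrite fold_right_poch.
  assert (Hk : 0 < Re z + INR k /\ (k <= m)%nat).
  (* [up r] is the integer [q] with [r < q <= r + 1], hence [k] is the least shift; [Z.to_nat] sends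
     negative values to [0]. *)
  { unfold k, Gamma_shift. destruct (archimed (- Re z)) as [A1 A2].
    destruct (Z_le_gt_dec 0 (up (- Re z))) as [Hup|Hup].
    - rewrite INR_IZR_INZ, Z2Nat.id by exact Hup. split; [lra|].
      assert (IZR (up (- Re z)) < IZR (Z.of_nat m) + 1) as Hlt.
      { rewrite <- INR_IZR_INZ. lra. }
      rewrite <- plus_IZR in Hlt. apply lt_IZR in Hlt. lia.
    - assert (E : Z.to_nat (up (- Re z)) = 0%nat) by lia. rewrite E. simpl.
      split; [|lia]. assert (IZR (up (- Re z)) < 0) by (apply IZR_lt; lia). lra. }
  destruct Hk as [Hk1 Hk2].
  rewrite Gamma_int_Gam by (rewrite Re_plus_INR; exact Hk1).
  replace m with (k + (m - k))%nat by lia.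
  rewrite plus_INR, RtoC_plus, Cplus_assoc,
    (Gam_poch (z + RtoC (INR k)) (m - k)) by (rewrite Re_plus_INR; exact Hk1).
  rewrite poch_add.
  assert (N1 : poch z k <> 0) by (apply Cprodn_neq_0; intros i Hi; apply Hnz; lia).
  assert (N2 : poch (z + RtoC (INR k)) (m - k) <> 0).
  { apply Cprodn_neq_0. intros i Hi. rewrite <- Cplus_assoc, <- RtoC_plus, <- plus_INR.
    apply Hnz. lia. }
  field. split; assumption.
Qed.

Lemma Gamma_Gam (z : C) : 0 < Re z -> Gamma z = Gam z.
Proof.
  intros Hz. rewrite (Gamma_shifted z 0); [|simpl; lra|intros; lia].
  unfold poch; simpl. rewrite Cplus_0_r. field.
Qed.

(** * Lower bounds and vertical decay of Gamma *)

(** The second derivative of the difference is [exp w + exp (- w) - 2 >= 0], and the difference and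
    its first derivative vanish at [0]; the mean value theorem is applied twice for [w >= 0], and
    evenness does the rest. *)
Lemma sqr_le_cosh (w : R) : w ^ 2 <= exp w - 2 + exp (- w).
Proof.
  assert (H : forall w, 0 <= w -> w ^ 2 <= exp w - 2 + exp (- w)).
  { clear w. intros w Hw.
    set (f := fun w => (exp w - 2 + exp (- w) - w ^ 2)%R).
    assert (Hs : forall x, 0 <= x -> 0 <= exp x - exp (- x) - 2 * x).
    { intros x Hx. set (g := fun x => (exp x - exp (- x) - 2 * x)%R).
      destruct (Req_dec x 0) as [->|Hx0].
      - rewrite Ropp_0, exp_0. lra.
      - destruct (MVT_gen g 0 x (fun t => exp t + exp (- t) - 2)%R) as [c [Hc E]].
        + intros t _. unfold g. auto_derive; [trivial|ring].
        + intros t _. apply continuity_pt_filterlim.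
          apply (ex_derive_continuous (V := R_NormedModule)). unfold g. auto_derive. trivial.
        + unfold g in E. rewrite Ropp_0, exp_0 in E.
          assert (2 <= exp c + exp (- c)).
          { pose proof (exp_pos c). rewrite exp_Ropp.
            apply Rmult_le_reg_r with (exp c); [lra|].
            rewrite Rmult_plus_distr_r, Rinv_l by lra. pose proof (pow2_ge_0 (exp c - 1)); nra. }
          nra. }
    destruct (MVT_gen f 0 w (fun t => exp t - exp (- t) - 2 * t)%R) as [c [Hc E]].
    - intros t _. unfold f. auto_derive; [trivial|ring].
    - intros t _. apply continuity_pt_filterlim.
      apply (ex_derive_continuous (V := R_NormedModule)). unfold f. auto_derive. trivial.
    - unfold f in E. rewrite Ropp_0, exp_0 in E. rewrite Rmin_left, Rmax_right in Hc by lra.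
      pose proof (Hs c ltac:(lra)). nra. }
  destruct (Rle_dec 0 w) as [Hw|Hw]; [now apply H|].
  specialize (H (- w)%R ltac:(lra)). rewrite Ropp_involutive in H. nra.
Qed.

(** [1 - cos t = 2 sin (t / 2) ^ 2], together with [|sin x| <= |x|]. *)
Lemma cos_ge_quadratic (t : R) : 1 - t ^ 2 / 2 <= cos t.
Proof.
  replace t with (2 * (t / 2))%R at 2 by field. rewrite cos_2a_sin.
  assert (sin (t / 2) * sin (t / 2) <= (t / 2) * (t / 2)); [|nra].
  assert (H : Rabs (sin (t / 2)) <= Rabs (t / 2)).
  { destruct (Rle_dec 0 (t / 2)) as [Ht|Ht].
    - rewrite (Rabs_pos_eq (t / 2)) by exact Ht. apply Rabs_le_between.
      destruct (Req_dec (t / 2) 0) as [->|Hn]; [rewrite sin_0; lra|].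
      pose proof (sin_lt_x (t / 2) ltac:(lra)). split; [|lra].
      destruct (Rle_dec (t / 2) PI) as [Hp|Hp].
      + pose proof (sin_ge_0 (t / 2) Ht Hp). lra.
      + pose proof (SIN_bound (t / 2)). pose proof PI_RGT_0. pose proof PI2_1. lra.
    - rewrite <- (Rabs_Ropp (sin _)), <- sin_neg, <- (Rabs_Ropp (t / 2)).
      rewrite (Rabs_pos_eq (- (t / 2))) by lra. apply Rabs_le_between.
      pose proof (sin_lt_x (- (t / 2)) ltac:(lra)). split; [|lra].
      destruct (Rle_dec (- (t / 2)) PI) as [Hp|Hp].
      + pose proof (sin_ge_0 (- (t / 2)) ltac:(lra) Hp). lra.
      + pose proof (SIN_bound (- (t / 2))). pose proof PI_RGT_0. pose proof PI2_1. lra. }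
  apply Rsqr_le_abs_1 in H. exact H.
Qed.

Lemma gamma_integrand_polar (X q v : R) :
  gamma_integrand 0 (X, q) v
  = (exp (- exp v) * exp (X * v) * cos (q * v), exp (- exp v) * exp (X * v) * sin (q * v))%R.
Proof.
  unfold gamma_integrand. replace ((X, q) * RtoC v)%C with (RtoC v * (X, q))%C by ring.
  rewrite Cexp_coord. rewrite (Rmult_comm v X), (Rmult_comm v q).
  unfold Cmult, RtoC; simpl. f_equal; ring.
Qed.

(** On [[0, 1]] the integrand is at least [exp (- exp 1)] for every [X > 0]. The uniformity in [X]
    allows arbitrary shifts to the right. *)
Lemma Gam_real_ge (X : R) : 0 < X -> exp (- exp 1) <= Re (Gam (X, 0)).
Proof.
  intros HX. destruct (gamma_dominated_at 0 (X, 0) HX) as [K HK].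
  apply (J_Re_ge _ K); [exact HK| |].
  - intros u. rewrite gamma_integrand_polar. simpl. rewrite Rmult_0_l, cos_0, Rmult_1_r.
    apply Rmult_le_pos; left; apply exp_pos.
  - intros u Hu. rewrite gamma_integrand_polar. simpl. rewrite Rmult_0_l, cos_0, Rmult_1_r.
    rewrite <- exp_plus. apply exp_le_exp.
    assert (exp u <= exp 1) by (apply exp_le_exp; lra). nra.
Qed.

(* Under the probability density [exp (X v - exp v) / Gamma X] the variable
   [exp v] has mean [X], and [E (exp v / X - 2 + X / exp v) = 1 / (X - 1)];
   since [cos t >= 1 - t ^ 2 / 2] and [w ^ 2 <= exp w - 2 + exp (- w)], this
   bounds the characteristic function of [v] away from [0]. *)
Lemma Gam_imag_shift_ge (X q : R) : 1 < X ->
  Re (Gam (X, 0)) * (1 - q ^ 2 / (2 * (X - 1))) <= Cmod (Gam (X, q)).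
Proof.
  intros HX. set (mu := ln X).
  assert (HXp : 0 < X) by lra. assert (HX1 : 0 < Re (X - 1, 0)%R) by (simpl; lra).
  assert (HX2 : 0 < Re (X + 1, 0)%R) by (simpl; lra).
  destruct (gamma_dominated_at 0 (X, q) HXp) as [Kq Hq].
  destruct (gamma_dominated_at 0 (X, 0) HXp) as [K0 H0].
  destruct (gamma_dominated_at 0 (X - 1, 0)%R HX1) as [K1 H1].
  destruct (gamma_dominated_at 0 (X + 1, 0)%R HX2) as [K2 H2].
  (* The phase [exp (- i q mu)] centres the variable: [exp (i q v)] becomes [exp (i q (v - mu))]. *)
  set (cq := (cos (q * mu), - sin (q * mu))%R : C).
  (* With [w = v - mu], the real part of [D v] is the density times [cos (q w) - 1 + (q ^ 2 / 2)
     (exp w - 2 + exp (- w))], which is nonnegative. Since [exp mu = X], the factors [exp w] and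
     [exp (- w)] amount to replacing [X] by [X + 1] and [X - 1]. *)
  set (D := fun v => (cq * gamma_integrand 0 (X, q) v
    + (RtoC (- 1 - q ^ 2) * gamma_integrand 0 (X, 0) v
    + (RtoC (q ^ 2 / (2 * X)) * gamma_integrand 0 (X + 1, 0)%R v
    + RtoC (q ^ 2 * X / 2) * gamma_integrand 0 (X - 1, 0)%R v)))%C).
  assert (HD : dominated D (Cmod cq * Kq + (Cmod (RtoC (- 1 - q ^ 2)) * K0
    + (Cmod (RtoC (q ^ 2 / (2 * X))) * K2 + Cmod (RtoC (q ^ 2 * X / 2)) * K1)))).
  { apply dominated_plus; [|apply dominated_plus; [|apply dominated_plus]];
      apply dominated_mult; assumption. }
  assert (HJ : J D = (cq * Gam (X, q) + (RtoC (- 1 - q ^ 2) * Gam (X, 0)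
    + (RtoC (q ^ 2 / (2 * X)) * Gam (X + 1, 0)%R + RtoC (q ^ 2 * X / 2) * Gam (X - 1, 0)%R)))%C).
  { unfold D.
    erewrite J_plus; [|apply dominated_mult, Hq|
      apply dominated_plus; [apply dominated_mult, H0|
        apply dominated_plus; apply dominated_mult; eassumption]].
    erewrite J_plus; [|apply dominated_mult, H0|
        apply dominated_plus; apply dominated_mult; eassumption].
    erewrite J_plus; [|apply dominated_mult, H2|apply dominated_mult, H1].
    erewrite !J_mult by eassumption. reflexivity. }
  assert (Hpos : forall v, 0 <= Re (D v)).
  { intros v. unfold D. rewrite !gamma_integrand_polar. rewrite !Rmult_0_l, cos_0, sin_0.
    assert (Hmu : exp mu = X) by (apply exp_ln; lra).
    assert (E1 : exp ((X + 1) * v) = (exp (X * v) * X * exp (v - mu))%R).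
    { replace ((X + 1) * v)%R with (X * v + mu + (v - mu))%R by ring.
      rewrite !exp_plus, Hmu. reflexivity. }
    assert (E2 : exp ((X - 1) * v) = (exp (X * v) / X * exp (- (v - mu)))%R).
    { replace ((X - 1) * v)%R with (X * v + - mu + - (v - mu))%R by ring.
      rewrite !exp_plus, exp_Ropp, Hmu. reflexivity. }
    rewrite E1, E2. unfold cq. unfold Re, Cplus, Cmult, RtoC; simpl.
    set (w := (v - mu)%R).
    assert (E3 : (cos (q * mu) * cos (q * v) + sin (q * mu) * sin (q * v))%R = cos (q * w)).
    { unfold w. replace (q * (v - mu))%R with (q * v - q * mu)%R by ring.
      rewrite cos_minus. ring. }
    pose proof (cos_ge_quadratic (q * w)) as B1. pose proof (sqr_le_cosh w) as B2.
    match goal with |- 0 <= ?t =>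
      replace t with (exp (- exp v) * exp (X * v) *
        ((cos (q * mu) * cos (q * v) + sin (q * mu) * sin (q * v)) - 1
          + q ^ 2 / 2 * (exp w - 2 + exp (- w))))%R by (field; lra) end.
    rewrite E3. apply Rmult_le_pos.
    - apply Rmult_le_pos; left; apply exp_pos.
    - pose proof (pow2_ge_0 q). nra. }
  pose proof (J_Re_ge D _ 0 HD Hpos (fun u _ => Hpos u)) as HR. rewrite HJ in HR.
  assert (G1 : Gam (X + 1, 0)%R = (RtoC X * Gam (X, 0))%C).
  { replace ((X + 1)%R, 0) with ((X, 0) + 1)%C by (unfold Cplus, RtoC; simpl; f_equal; ring).
    now rewrite Gam_succ. }
  assert (G2 : Gam (X - 1, 0)%R = (RtoC (/ (X - 1)) * Gam (X, 0))%C).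
  { replace (Gam (X, 0)) with (Gam (((X - 1)%R, 0) + 1))
      by (f_equal; unfold Cplus, RtoC; simpl; f_equal; ring).
    rewrite Gam_succ by exact HX1.
    change ((X - 1)%R, 0) with (RtoC (X - 1)).
    rewrite Cmult_assoc, <- RtoC_mult, Rinv_l by lra. now rewrite Cmult_1_l. }
  rewrite G1, G2 in HR.
  replace (cq * Gam (X, q) + (RtoC (- 1 - q ^ 2) * Gam (X, 0)
    + (RtoC (q ^ 2 / (2 * X)) * (X * Gam (X, 0))
    + RtoC (q ^ 2 * X / 2) * (RtoC (/ (X - 1)) * Gam (X, 0)))))%C
    with (cq * Gam (X, q) + RtoC (- (1 - q ^ 2 / (2 * (X - 1)))) * Gam (X, 0))%C in HR.
  - rewrite re_plus, re_scal_l in HR.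
    apply Rle_trans with (Re (cq * Gam (X, q))); [nra|].
    eapply Rle_trans; [apply Rle_abs|]. eapply Rle_trans; [apply re_le_Cmod|].
    rewrite Cmod_mult. replace (Cmod cq) with 1; [lra|].
    unfold cq, Cmod; simpl. pose proof (sin2_cos2 (q * mu)) as E. unfold Rsqr in E.
    rewrite <- sqrt_1 at 1. f_equal. nra.
  - f_equal. rewrite !Cmult_assoc, <- !RtoC_mult, <- !Cmult_plus_distr_r, <- !RtoC_plus.
    f_equal. f_equal. field. lra.
Qed.

Lemma Cmod_poch_le (z : C) (m : nat) (b : R) : 0 <= b -> Cmod z <= b ->
  Cmod (poch z m) <= (b + INR m) ^ m.
Proof.
  intros Hb Hz. assert (W : forall k, (k <= m)%nat -> Cmod (poch z k) <= (b + INR m) ^ k).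
  { induction k as [|k IH]; intros Hk.
    - unfold poch; simpl. rewrite Cmod_1. lra.
    - unfold poch in *; simpl. rewrite Cmod_mult, Rmult_comm.
      apply Rmult_le_compat; try apply Cmod_ge_0.
      + eapply Rle_trans; [apply Cmod_triangle|]. rewrite Cmod_R, Rabs_pos_eq by apply pos_INR.
        assert (INR k <= INR m) by (apply le_INR; lia). lra.
      + apply IH. lia. }
  apply W. lia.
Qed.

(** After a shift by [N > b ^ 2 + 3] the factor [1 - q ^ 2 / (2 (X - 1))] is at least [1 / 2] on the
    whole box. The functional equation leads back at the cost of a Pochhammer product of modulus at
    most [(b + N) ^ N]. *)
Lemma Gam_lower_bound (s1 B : R) : 0 < s1 -> exists k, 0 < k /\
  forall z, box s1 B z -> k <= Cmod (Gam z).
Proof.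
  intros Hs. set (b := (Rabs B + 1)%R).
  assert (Hb : 1 <= b) by (unfold b; pose proof (Rabs_pos B); lra).
  destruct (nfloor_ex (b ^ 2 + 3)) as [m [_ Hm]]; [nra|].
  set (N := S m). assert (HN : b ^ 2 + 3 < INR N) by (unfold N; rewrite S_INR; lra).
  set (Q := ((b + INR N) ^ N)%R).
  assert (HQ : 0 < Q) by (apply pow_lt; nra).
  pose proof (exp_pos (- exp 1)) as He.
  exists (exp (- exp 1) / 2 / Q)%R. split.
  { apply Rdiv_lt_0_compat; lra. }
  intros z [Hz1 Hz2]. assert (Hzb : Cmod z <= b) by (unfold b; pose proof (Rle_abs B); lra).
  assert (Hz : 0 < Re z) by lra.
  pose proof (Gam_poch z N Hz) as E.
  destruct z as [p q]. unfold Re in Hz1, Hz; simpl in Hz1, Hz.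
  replace ((p, q) + RtoC (INR N))%C with ((p + INR N)%R, q) in E
    by (unfold Cplus, RtoC; simpl; f_equal; ring).
  assert (Hq : q ^ 2 <= b ^ 2).
  { rewrite <- pow2_abs. apply pow_incr. split; [apply Rabs_pos|].
    eapply Rle_trans; [|exact Hzb]. exact (Im_le_Cmod (p, q)). }
  pose proof (Gam_imag_shift_ge (p + INR N) q ltac:(nra)) as L1.
  pose proof (Gam_real_ge (p + INR N) ltac:(nra)) as L2.
  assert (L3 : / 2 <= 1 - q ^ 2 / (2 * (p + INR N - 1))).
  { assert (q ^ 2 / (2 * (p + INR N - 1)) <= / 2); [|lra].
    apply Rmult_le_reg_r with (2 * (p + INR N - 1))%R; [nra|].
    unfold Rdiv. rewrite Rmult_assoc, Rinv_l by nra. nra. }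
  assert (L4 : exp (- exp 1) / 2 <= Cmod (poch (p, q) N) * Cmod (Gam (p, q))).
  { rewrite <- Cmod_mult, <- E. eapply Rle_trans; [|exact L1]. unfold Rdiv at 1.
    apply Rmult_le_compat; lra. }
  pose proof (Cmod_poch_le (p, q) N b ltac:(lra) Hzb) as L5. fold Q in L5.
  apply Rmult_le_reg_l with Q; [exact HQ|].
  replace (Q * (exp (- exp 1) / 2 / Q))%R with (exp (- exp 1) / 2)%R by (field; lra).
  eapply Rle_trans; [exact L4|]. apply Rmult_le_compat_r; [apply Cmod_ge_0|exact L5].
Qed.

Lemma Gam_neq_0 (z : C) : 0 < Re z -> Gam z <> 0.
Proof.
  intros Hz. destruct (Gam_lower_bound (Re z) (Cmod z) Hz) as [k [Hk H]].
  apply Cmod_gt_0. specialize (H z (conj (Rle_refl _) (Rle_refl _))). lra.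
Qed.

Lemma Cmod_sqr (p u : R) : (Cmod (p, u) ^ 2 = p ^ 2 + u ^ 2)%R.
Proof. now rewrite Cmod2_alt. Qed.

Lemma Cmod_ge_abs (p p' u : R) : 0 <= p <= p' -> Cmod (p, u) <= Cmod (p', u).
Proof.
  intros Hp.
  unfold Cmod; simpl. apply sqrt_le_1_alt. nra.
Qed.

(** Four applications of the functional equation divide the bounded [Gam (z + 4)] by four factors of
    modulus at least [|z|]. Order four, not two, is needed because differentiating a line integral
    in [v] costs a factor of order [1 + u ^ 2]. *)
Lemma Gam_decay (s1 s2 : R) : 0 < s1 -> exists K, 0 <= K /\
  forall p u, s1 <= p <= s2 -> Cmod (Gam (p, u)) <= K / (1 + u ^ 2) ^ 2.
Proof.
  intros Hs. destruct (Gam_bounded s1 (s2 + 4) Hs) as [K [K0 HK]].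
  set (d := Rmin 1 s1).
  assert (Hd : 0 < d) by (apply Rmin_pos; lra).
  assert (Hd1 : d <= 1) by apply Rmin_l. assert (Hd2 : d <= s1) by apply Rmin_r.
  assert (Hd4 : 0 < d ^ 4) by now apply pow_lt.
  exists (K / d ^ 4)%R. split; [apply Rmult_le_pos; [lra|left; now apply Rinv_0_lt_compat]|].
  intros p u Hp. pose proof (one_sqr_pos u) as Hu.
  pose proof (Gam_poch (p, u) 4 ltac:(simpl; lra)) as E.
  assert (H1 : (d ^ 2 * (1 + u ^ 2)) ^ 2 <= Cmod (poch (p, u) 4)).
  { assert (Hge : forall i, Cmod (p, u) <= Cmod ((p, u) + RtoC (INR i))).
    { intros i. replace ((p, u) + RtoC (INR i))%C with ((p + INR i)%R, u)
        by (unfold Cplus, RtoC; simpl; f_equal; ring).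
      apply Cmod_ge_abs. pose proof (pos_INR i). lra. }
    unfold poch; simpl Cprodn. rewrite !Cmod_mult, Cmod_1.
    pose proof (Hge 0%nat) as A0. pose proof (Hge 1%nat) as A1. pose proof (Hge 2%nat) as A2.
    pose proof (Hge 3%nat) as A3. pose proof (Cmod_ge_0 (p, u)) as AP.
    apply Rle_trans with ((Cmod (p, u) ^ 2) ^ 2)%R.
    - apply pow_incr. rewrite Cmod_sqr. assert (d * d <= 1) by nra. assert (d * d <= p * p) by nra.
      pose proof (pow2_ge_0 u). split; [nra|nra].
    - replace ((Cmod (p, u) ^ 2) ^ 2)%R
        with (1 * Cmod (p, u) * Cmod (p, u) * Cmod (p, u) * Cmod (p, u))%R by ring.
      repeat (apply Rmult_le_compat); try assumption; try lra; repeat apply Rmult_le_pos; lra. }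
  assert (H2 : Cmod (poch (p, u) 4) * Cmod (Gam (p, u)) <= K).
  { rewrite <- Cmod_mult, <- E. apply HK. rewrite Re_plus_INR. unfold Re; simpl. lra. }
  pose proof (Cmod_ge_0 (Gam (p, u))) as HG.
  apply Rmult_le_reg_r with ((d ^ 2 * (1 + u ^ 2)) ^ 2)%R.
  { apply pow_lt. apply Rmult_lt_0_compat; [now apply pow_lt|exact Hu]. }
  replace (K / d ^ 4 / (1 + u ^ 2) ^ 2 * (d ^ 2 * (1 + u ^ 2)) ^ 2)%R with K
    by (field; split; lra).
  eapply Rle_trans; [|exact H2]. rewrite Rmult_comm. apply Rmult_le_compat_r; assumption.
Qed.

(** * Products of Gamma factors *)

Definition hol (s0 : R) (f : C -> C) : Prop := exists f', holo s0 f f'.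

Lemma hol_mult (s0 : R) (f g : C -> C) : hol s0 f -> hol s0 g -> hol s0 (fun z => f z * g z)%C.
Proof. intros [f' Hf] [g' Hg]. eexists. apply holo_mult; eassumption. Qed.

Lemma hol_const (s0 : R) (c : C) : hol s0 (fun _ => c).
Proof. eexists. apply holo_const. Qed.

Lemma hol_Cprodn (s0 : R) (f : nat -> C -> C) (n : nat) :
  (forall i, (i < n)%nat -> hol s0 (f i)) -> hol s0 (fun z => Cprodn (fun i => f i z) n).
Proof.
  induction n as [|n IH]; intros H; simpl; [apply hol_const|].
  apply hol_mult; [apply IH; intros; apply H; lia|apply H; lia].
Qed.

Lemma hol_inv_pos (s0 : R) (f : C -> C) :
  (forall s1 B, s0 < s1 -> exists k, 0 < k /\ forall z, box s1 B z -> k <= Cmod (f z)) ->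
  hol s0 f -> hol s0 (fun z => / f z)%C.
Proof. intros H [f' Hf]. eexists. apply holo_inv; eassumption. Qed.

Lemma hol_linear_inv (s0 : R) (a : C) : - Re a <= s0 -> hol s0 (fun z => / (z + a))%C.
Proof.
  intros Ha. apply hol_inv_pos.
  - intros s1 B Hs. exists (s1 - s0)%R. split; [lra|]. intros z [Hz _].
    eapply Rle_trans; [|apply re_le_Cmod]. rewrite re_plus.
    eapply Rle_trans; [|apply Rle_abs]. lra.
  - eexists. apply holo_plus; [apply holo_id|apply holo_const].
Qed.

Lemma hol_Gam_shift (s0 a : R) : - a <= s0 -> hol s0 (fun z => Gam (z + RtoC a)).
Proof.
  intros Ha. eexists. apply (holo_weaken (0 - a)); [lra|]. apply holo_shift. apply holo_Gam.
Qed.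

(** The lower bound for [Gam] on boxes enters here. It keeps the denominators of the kernel from
    creating poles in [t]. *)
Lemma hol_Gam_shift_inv (s0 a : R) : - a <= s0 -> hol s0 (fun z => / Gam (z + RtoC a))%C.
Proof.
  intros Ha. apply hol_inv_pos; [|now apply hol_Gam_shift]. intros s1 B Hs.
  destruct (Gam_lower_bound (s1 + a) (B + Rabs a) ltac:(lra)) as [k [Hk H]].
  exists k. split; [exact Hk|]. intros z [Hz1 Hz2]. apply H. split.
  - rewrite re_plus, re_RtoC. lra.
  - eapply Rle_trans; [apply Cmod_triangle|]. rewrite Cmod_R. lra.
Qed.

Lemma hol_Cpowr (s0 x : R) : hol s0 (Cpowr x).
Proof. eexists. apply holo_exp. Qed.

Lemma hol_continuous (s0 : R) (f : C -> C) (z : C) :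
  hol s0 f -> s0 < Re z -> continuous (T := C_UniformSpace) (U := C_UniformSpace) f z.
Proof. intros [f' Hf]. now apply (holo_continuous s0 f f'). Qed.

Lemma Cprodn_inv (f : nat -> C) (n : nat) :
  (forall i, (i < n)%nat -> f i <> 0) -> Cprodn (fun i => / f i)%C n = (/ Cprodn f n)%C.
Proof.
  induction n as [|n IH]; intros H; simpl.
  - field.
  - rewrite IH by (intros; apply H; lia). field. split; [apply H; lia|].
    apply Cprodn_neq_0. intros; apply H; lia.
Qed.

Lemma Cprodn_mult (f g : nat -> C) (n : nat) :
  Cprodn (fun i => f i * g i)%C n = (Cprodn f n * Cprodn g n)%C.
Proof. induction n as [|n IH]; simpl; [ring|]. rewrite IH. ring. Qed.

Lemma Cprod_Cprodn (f : nat -> C) (a b : nat) :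
  Cprod f a b = Cprodn (fun i => f (a + i)%nat) (S b - a).
Proof.
  unfold Cprod. generalize (S b - a)%nat as n. intros n. induction n as [|n IH]; [reflexivity|].
  rewrite List.seq_S, map_app, fold_right_app. simpl.
  rewrite fold_right_Cmult_init, IH. ring.
Qed.

(** * Mellin inversion *)

Lemma is_J_intro (F : R -> C) (v : C) :
  (forall u, contC F u) ->
  (forall e, 0 < e -> exists A, forall a b, a <= - A -> A <= b -> Cmod (CRInt F a b - v) < e) ->
  is_J F v.
Proof.
  intros HF H P HP. destruct HP as [d Hd].
  destruct (H (d / 1)%R) as [A HA]; [rewrite Rdiv_1_r; apply cond_pos|].
  rewrite Rdiv_1_r in HA.
  apply (Filter_prod _ _ _ (fun a => a <= - A) (fun b => A <= b)).
  - exists (- A)%R. intros a Ha. lra.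
  - exists A. intros a Ha. lra.
  - intros a b Ha Hb. exists (CRInt F a b). split.
    + now apply CRInt_continuous.
    + apply Hd. apply C_ball_Cmod. now apply HA.
Qed.

(** Both symmetric truncations converge, so an error of order [1 / T] against a convergent [w T]
    pins down the difference of the integrals. *)
Lemma J_diff (F1 F2 : R -> C) (K1 K2 B A : R) (w : R -> C) (v : C) :
  dominated F1 K1 -> dominated F2 K2 ->
  filterlim w (Rbar_locally p_infty) (locally (T := C_UniformSpace) v) ->
  (forall T, A <= T -> Cmod (CRInt F2 (- T) T - CRInt F1 (- T) T - w T) <= B / T) ->
  (J F2 - J F1)%C = v.
Proof.
  intros H1 H2 Hw HB.
  assert (Z : forall e, 0 < e -> Cmod (J F2 - J F1 - v) <= 4 * e).
  { intros e He.
    pose proof (proj1 (filterlim_C _ _ _) Hw e He) as [A0 HA0].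
    destruct (J_lim F1 K1 H1 e He) as [A1 HA1].
    destruct (J_lim F2 K2 H2 e He) as [A2 HA2].
    set (T := (Rabs A + Rabs A0 + Rabs A1 + Rabs A2 + Rabs B / e + 1)%R).
    pose proof (Rle_abs A). pose proof (Rle_abs A0). pose proof (Rle_abs A1).
    pose proof (Rle_abs A2). pose proof (Rle_abs B). pose proof (Rabs_pos B).
    pose proof (Rabs_pos A). pose proof (Rabs_pos A0). pose proof (Rabs_pos A1).
    pose proof (Rabs_pos A2).
    assert (HBe : 0 <= Rabs B / e) by (apply Rmult_le_pos; [lra|left; now apply Rinv_0_lt_compat]).
    assert (HT : 0 < T) by (unfold T; lra).
    specialize (HA0 T ltac:(unfold T; lra)).
    specialize (HA1 (- T)%R T ltac:(unfold T; lra) ltac:(unfold T; lra)).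
    specialize (HA2 (- T)%R T ltac:(unfold T; lra) ltac:(unfold T; lra)).
    specialize (HB T ltac:(unfold T; lra)).
    assert (HBT : B / T <= e).
    { apply Rmult_le_reg_r with T; [exact HT|]. unfold Rdiv.
      rewrite Rmult_assoc, Rinv_l, Rmult_1_r by lra.
      assert (HT2 : Rabs B / e <= T) by (unfold T; lra).
      apply Rmult_le_compat_r with (r := e) in HT2; [|lra].
      replace (Rabs B / e * e)%R with (Rabs B) in HT2 by (field; lra). lra. }
    replace (J F2 - J F1 - v)%C with
      ((CRInt F2 (- T) T - CRInt F1 (- T) T - w T) - (CRInt F2 (- T) T - J F2)
       + (CRInt F1 (- T) T - J F1) + (w T - v))%C by ring.
    eapply Rle_trans; [apply Cmod_triangle|].
    eapply Rle_trans; [apply Rplus_le_compat_r, Cmod_triangle|].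
    eapply Rle_trans; [apply Rplus_le_compat_r, Rplus_le_compat_r, Cmod_sub_le|]. lra. }
  assert (Z0 : Cmod (J F2 - J F1 - v) = 0).
  { apply Rle_antisym; [|apply Cmod_ge_0]. apply Rle_plus_epsilon. intros e He.
    specialize (Z (e / 4)%R ltac:(lra)). lra. }
  apply Cmod_eq_0 in Z0. replace (J F2 - J F1)%C with (J F2 - J F1 - v + v)%C by ring.
  rewrite Z0. ring.
Qed.

(** The primitive is [- i log (b + i u)] in coordinates, with [atan (u / b)] for the argument, so
    that no branch is chosen and [b] may have either sign. The logarithmic part is even and cancels
    over a symmetric segment. *)
Lemma is_CRInt_inv_vline (b T : R) : b <> 0 ->
  is_CRInt (fun u => / (b, u))%C (- T) T (RtoC (2 * atan (T / b))).
Proof.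
  intros Hb.
  set (f := fun u => (atan (u / b), - (ln (b ^ 2 + u ^ 2) / 2))%R : C).
  assert (Hpos : forall u, 0 < b ^ 2 + u ^ 2).
  { intros u. pose proof (pow2_ge_0 u). pose proof (pow2_gt_0 b Hb). lra. }
  replace (RtoC (2 * atan (T / b))) with (f T - f (- T)%R)%C.
  - apply is_CRInt_derive; intros u _.
    + apply is_Cderive_components; split; unfold f; simpl; specialize (Hpos u).
      * auto_derive; [trivial|]. simpl in *. field. split; [|exact Hb].
        replace (b ^ 2 + u ^ 2)%R with (b * (b * 1) + u * (u * 1))%R by ring. nra.
      * auto_derive; [simpl in *; lra|]. simpl in *. field. nra.
    + apply continuous_Cinv; [|apply continuous_vline].
      intro E. apply (f_equal Re) in E. simpl in E. now apply Hb.
  - unfold f, Cminus, Cplus, Copp, RtoC; simpl. f_equal.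
    + replace (- T / b)%R with (- (T / b))%R by (field; exact Hb). rewrite atan_opp. ring.
    + replace (- T * (- T * 1))%R with (T * (T * 1))%R by ring. ring.
Qed.

Lemma vline_neq (s u k : R) : s <> k \/ u <> 0 -> (s, u) <> RtoC k.
Proof. intros H E. unfold RtoC in E. injection E. intros. destruct H; auto. Qed.

Lemma continuous_quotient_vline (f : C -> C) (c k u : R) :
  c <> k -> contC (fun u => f (c, u)) u -> contC (fun u => f (c, u) / ((c, u) - RtoC k))%C u.
Proof.
  intros Hck Hf. apply continuous_Cdiv; [|exact Hf|].
  - apply Csub_neq_0, vline_neq. now left.
  - apply continuous_Cminus; [apply continuous_vline|apply continuous_Cconst].
Qed.

(* The pole is removed by subtracting [H k / (z - k)], whose integral over a
   vertical segment is explicit. *)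
Lemma pole_shift (s0 : R) (H H' : C -> C) (k c c' T e : R) :
  holo s0 H H' -> s0 < k -> s0 < c -> c <= c' -> c <> k -> c' <> k -> 0 < T ->
  (forall s u, c <= s <= c' -> Rabs u = T -> Cmod (H (s, u)) <= e) ->
  Cmod ((CRInt (fun u => H (c', u) / ((c', u) - RtoC k))%C (- T) T
           - H (RtoC k) * RtoC (2 * atan (T / (c' - k))))
    - (CRInt (fun u => H (c, u) / ((c, u) - RtoC k))%C (- T) T
           - H (RtoC k) * RtoC (2 * atan (T / (c - k)))))
  <= 2 * (c' - c) * ((e + Cmod (H (RtoC k))) / T).
Proof.
  intros HH Hk Hc Hcc Hck Hck' HT He.
  destruct (difference_quotient_primitive s0 H H' (RtoC k) HH Hk) as [F HF].
  set (q := fun s => ((H s - H (RtoC k)) / (s - RtoC k))%C).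
  assert (S1 : forall s, s = c \/ s = c' ->
    (CRInt (fun u => H (s, u) / ((s, u) - RtoC k)) (- T) T
      - H (RtoC k) * RtoC (2 * atan (T / (s - k))))%C = CRInt (fun u => q (s, u)) (- T) T).
  { intros s Hs. assert (Hsk : s <> k) by (destruct Hs; congruence).
    assert (Hcont : forall u, contC (fun u => H (s, u)) u).
    { intros u. apply (continuous_path_comp H (fun u => (s, u))); [|apply continuous_vline].
      apply (holo_continuous s0 H H'); [exact HH|]. simpl. destruct Hs; lra. }
    symmetry. apply is_CRInt_eq.
    apply (is_CRInt_ext (fun u => H (s, u) / ((s, u) - RtoC k) - H (RtoC k) * / ((s - k)%R, u))%C).
    - intros u _. unfold q.
      replace ((s - k)%R, u) with ((s, u) - RtoC k)%C
        by (unfold Cminus, Cplus, Copp, RtoC; simpl; f_equal; ring).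
      field. apply Csub_neq_0, vline_neq. now left.
    - apply is_CRInt_minus.
      + apply CRInt_continuous. intros u. now apply continuous_quotient_vline.
      + apply is_CRInt_mult. apply is_CRInt_inv_vline. lra. }
  rewrite !S1 by auto. apply (rectangle_shift F); [lra|exact Hcc| |].
  - intros s u Hs Hu Hbd.
    assert (Hn : (s, u) <> RtoC k).
    { apply vline_neq. destruct Hbd as [-> | [-> | [-> | ->]]]; (left; assumption) || (right; lra). }
    split.
    + apply HF; [simpl; lra|exact Hn].
    + apply continuous_Cdiv.
      * now apply Csub_neq_0.
      * apply continuous_Cminus; [|apply continuous_Cconst].
        apply (holo_continuous s0 H H'); [exact HH|simpl; lra].
      * apply continuous_Cminus; [apply continuous_id|apply continuous_Cconst].
  - assert (Hb : forall s u, c <= s <= c' -> Rabs u = T ->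
      Cmod (q (s, u)) <= (e + Cmod (H (RtoC k))) / T).
    { intros s u Hs Hu. unfold q.
      assert (Hn : ((s, u) - RtoC k)%C <> 0).
      { apply Csub_neq_0, vline_neq. right. intros ->. rewrite Rabs_R0 in Hu. lra. }
      rewrite Cmod_div by exact Hn. apply Rmult_le_compat.
      - apply Cmod_ge_0.
      - left. apply Rinv_0_lt_compat. now apply Cmod_gt_0.
      - eapply Rle_trans; [apply Cmod_sub_le|]. apply Rplus_le_compat_r. now apply He.
      - apply Rinv_le_contravar; [lra|]. rewrite <- Hu.
        eapply Rle_trans; [|apply Im_le_Cmod]. right. f_equal.
        unfold Im, Cminus, Cplus, Copp, RtoC; simpl. ring. }
    intros s Hs. split; apply Hb; try assumption.
    + apply Rabs_pos_eq; lra.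
    + rewrite Rabs_Ropp. apply Rabs_pos_eq; lra.
Qed.

Lemma filterlim_atan (b : R) : 0 < b ->
  filterlim (fun T => RtoC (2 * atan (T / b))) (Rbar_locally p_infty)
    (locally (T := C_UniformSpace) (RtoC PI)).
Proof.
  intros Hb. apply filterlim_C; [typeclasses eauto|]. intros e He.
  destruct (atan_near_PI2 (e / 2) ltac:(lra)) as [A [HA0 HA]].
  exists (A * b)%R. intros T HT.
  rewrite <- RtoC_minus, Cmod_R. specialize (HA (T / b)%R).
  assert (A <= T / b).
  { apply Rmult_le_reg_r with b; [exact Hb|]. replace (T / b * b)%R with T by (field; lra). lra. }
  specialize (HA H). apply Rabs_def1; lra.
Qed.

(** Working form of [is_vint], with the factor [Ci] left out. Continuity makes all truncated
    integrals exist, and domination stands in for absolute convergence; both pass to linear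
    combinations. *)
Definition vline (M : nat) (f : C -> C) (c : R) (v : C) : Prop :=
  (forall u, contC (fun u => f (c, u)) u) /\
  filterlim (fun T => CRInt (fun u => f (c, u)) (- T) T) (Rbar_locally p_infty)
    (locally (T := C_UniformSpace) v) /\
  ((2 <= M)%nat -> exists K, dominated (fun u => f (c, u)) K).

(** Satisfied by the transforms of the weights when [M >= 2], where at least one Gamma factor
    remains in the numerator. *)
Definition fast_decay (G : C -> C) : Prop :=
  hol 0 G /\ forall s1 s2, 0 < s1 -> exists K, 0 <= K /\
    forall p u, s1 <= p <= s2 -> Cmod (G (p, u)) <= K / (1 + u ^ 2) ^ 2.

Lemma inv_sqr_le (K u : R) : 0 <= K -> K / (1 + u ^ 2) ^ 2 <= K / (1 + u ^ 2).
Proof.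
  intros HK. apply Rmult_le_compat_l; [exact HK|]. pose proof (one_sqr_pos u) as H.
  apply Rinv_le_contravar; [exact H|]. pose proof (pow2_ge_0 u). nra.
Qed.

Section FourierLaplace.
Context (g : R -> C) (b K : R) (Hg : forall u, contC g u)
  (HK : forall u, Cmod (g u) <= K / (1 + u ^ 2) ^ 2).

Let HK0 : 0 <= K.
Proof.
  pose proof (HK 0) as H. pose proof (Cmod_ge_0 (g 0)).
  replace (K / (1 + 0 ^ 2) ^ 2)%R with K in H by field. lra.
Qed.

Lemma Cmod_exp_vline (v u : R) : Cmod (Cexp (RtoC v * (b, (- u)%R))) = exp (v * b).
Proof. now rewrite Cmod_Cexp, Re_scal. Qed.

Lemma continuous_neg_vline (u : R) : contC (fun u => (b, (- u)%R)) u.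
Proof.
  apply (continuous_comp (U := R_UniformSpace) (W := C_UniformSpace) Ropp (fun v => (b, v))).
  - apply (continuous_opp (V := R_NormedModule)). apply continuous_id.
  - apply continuous_vline.
Qed.

Lemma continuous_exp_vline (v u : R) : contC (fun u => Cexp (RtoC v * (b, (- u)%R))) u.
Proof.
  apply continuous_Cexp. apply continuous_Cmult; [apply continuous_Cconst|].
  apply continuous_neg_vline.
Qed.

Lemma dominated_fourier (v : R) :
  dominated (fun u => g u * Cexp (RtoC v * (b, (- u)%R)))%C (K * exp (v * b)).
Proof.
  split.
  - intros u. apply continuous_Cmult; [apply Hg|apply continuous_exp_vline].
  - intros u. rewrite Cmod_mult, Cmod_exp_vline.
    replace (K * exp (v * b) / (1 + u ^ 2))%R with (K / (1 + u ^ 2) * exp (v * b))%R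
      by (field; pose proof (one_sqr_pos u); lra).
    apply Rmult_le_compat_r; [left; apply exp_pos|].
    eapply Rle_trans; [apply HK|apply inv_sqr_le, HK0].
Qed.

Lemma Cmod_vline_sqr_le (u : R) : Cmod (b, (- u)%R) ^ 2 <= (1 + b ^ 2) * (1 + u ^ 2).
Proof. rewrite Cmod_sqr. pose proof (pow2_ge_0 b). pose proof (pow2_ge_0 u). nra. Qed.

Lemma dominated_fourier_derivative (v : R) :
  dominated (fun u => g u * (b, (- u)%R) * Cexp (RtoC v * (b, (- u)%R)))%C
    (K * (1 + b ^ 2) * exp (v * b)).
Proof.
  split.
  - intros u. apply continuous_Cmult; [|apply continuous_exp_vline].
    apply continuous_Cmult; [apply Hg|apply continuous_neg_vline].
  - intros u. rewrite !Cmod_mult, Cmod_exp_vline.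
    pose proof (one_sqr_pos u) as Hu.
    replace (K * (1 + b ^ 2) * exp (v * b) / (1 + u ^ 2))%R
      with (K / (1 + u ^ 2) ^ 2 * ((1 + b ^ 2) * (1 + u ^ 2)) * exp (v * b))%R
      by (field; lra).
    apply Rmult_le_compat_r; [left; apply exp_pos|].
    apply Rmult_le_compat; try apply Cmod_ge_0; [apply HK|].
    pose proof (Cmod_vline_sqr_le u) as H. pose proof (Cmod_ge_0 (b, (- u)%R)) as H0.
    pose proof (pow2_ge_0 b). pose proof (pow2_ge_0 u).
    destruct (Rle_dec (Cmod (b, (- u)%R)) 1) as [L1|L1]; nra.
Qed.

(** The second-order Taylor remainder of the exponential grows like [1 + u ^ 2] along the line; the
    decay of [g] of order four absorbs it and leaves a dominated integrand. *)
Lemma is_Cderive_fourier (v : R) :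
  is_Cderive (fun v => J (fun u => g u * Cexp (RtoC v * (b, (- u)%R))))%C v
    (J (fun u => g u * (b, (- u)%R) * Cexp (RtoC v * (b, (- u)%R))))%C.
Proof.
  apply is_Cderive_eps. intros e He. pose proof PI_RGT_0 as Hpi.
  (* [PI] is the mass of [1 / (1 + u ^ 2)], [1 + b ^ 2] comes from
     [|b - i u| ^ 2 <= (1 + b ^ 2) (1 + u ^ 2)], and [exp |b|] bounds [exp (h b)] for [|h| < 1]. *)
  set (N := (PI * (K * (1 + b ^ 2) * (exp (v * b) * (2 + exp (Rabs b)))))%R).
  assert (HN : 0 <= N).
  { unfold N. pose proof HK0 as K0. pose proof (exp_pos (v * b)). pose proof (exp_pos (Rabs b)).
    pose proof (pow2_ge_0 b).
    apply Rmult_le_pos; [lra|]. apply Rmult_le_pos; [apply Rmult_le_pos; lra|].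
    apply Rmult_le_pos; lra. }
  exists (Rmin 1 (e / (N + 1))). split.
  { apply Rmin_pos; [lra|apply Rdiv_lt_0_compat; lra]. }
  intros h Hh.
  assert (Hh1 : Rabs h < 1) by (eapply Rlt_le_trans; [exact Hh|apply Rmin_l]).
  assert (Hh2 : Rabs h < e / (N + 1)) by (eapply Rlt_le_trans; [exact Hh|apply Rmin_r]).
  set (D := fun u => (g u * Cexp (RtoC (v + h) * (b, (- u)%R))
    + ((-1) * (g u * Cexp (RtoC v * (b, (- u)%R)))
    + (- RtoC h) * (g u * (b, (- u)%R) * Cexp (RtoC v * (b, (- u)%R)))))%C).
  pose proof (dominated_fourier (v + h)) as D1. pose proof (dominated_fourier v) as D2.
  pose proof (dominated_fourier_derivative v) as D3.
  match goal with |- Cmod ?t <= _ => replace t with (J D) end.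
  2: { unfold D. erewrite J_plus;
         [|exact D1|apply dominated_plus; [apply (dominated_mult (-1)), D2|apply dominated_mult, D3]].
       erewrite J_plus; [|apply (dominated_mult (-1)), D2|apply dominated_mult, D3].
       erewrite (J_mult (-1)) by exact D2. erewrite J_mult by exact D3. ring. }
  apply Rle_trans with (N * Rabs h * Rabs h)%R.
  - unfold N. rewrite !Rmult_assoc. apply J_norm. split.
    + apply (dominated_plus _ _ _ _ D1 (dominated_plus _ _ _ _ (dominated_mult (-1) _ _ D2)
        (dominated_mult (- RtoC h) _ _ D3))).
    + intros u. set (z := (b, (- u)%R) : C).
      assert (ED : D u = (g u * Cexp (RtoC v * z) * (Cexp (RtoC h * z) - 1 - RtoC h * z))%C).
      { unfold D. fold z. rewrite RtoC_plus, Cmult_plus_distr_r, Cexp_plus. ring. }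
      rewrite ED, !Cmod_mult. unfold z at 1. rewrite Cmod_exp_vline.
      pose proof (one_sqr_pos u) as Hu.
      replace (K * ((1 + b ^ 2) * (exp (v * b) * ((2 + exp (Rabs b)) * (Rabs h * Rabs h))))
        / (1 + u ^ 2))%R
        with (K / (1 + u ^ 2) ^ 2 * exp (v * b)
          * ((Rabs h * Rabs h) * ((1 + b ^ 2) * (1 + u ^ 2)) * (2 + exp (Rabs b))))%R
        by (field; lra).
      apply Rmult_le_compat; try apply Cmod_ge_0.
      * apply Rmult_le_pos; [apply Cmod_ge_0|left; apply exp_pos].
      * apply Rmult_le_compat_r; [left; apply exp_pos|apply HK].
      * eapply Rle_trans; [apply Cexp_taylor_le|].
        rewrite Cmod_mult, Cmod_R, Re_scal, Rpow_mult_distr.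
        assert (Ex : exp (h * Re z) <= exp (Rabs b)).
        { apply exp_le_exp. unfold z, Re; simpl. eapply Rle_trans; [apply Rle_abs|].
          rewrite Rabs_mult. pose proof (Rabs_pos b). pose proof (Rabs_pos h). nra. }
        pose proof (exp_pos (h * Re z)).
        apply Rmult_le_compat.
        -- apply Rmult_le_pos; apply pow2_ge_0.
        -- lra.
        -- replace (Rabs h ^ 2)%R with (Rabs h * Rabs h)%R by ring.
           apply Rmult_le_compat_l; [|apply Cmod_vline_sqr_le].
           apply Rmult_le_pos; apply Rabs_pos.
        -- lra.
  - apply Rmult_le_compat_r; [apply Rabs_pos|].
    apply Rmult_lt_compat_l with (r := (N + 1)%R) in Hh2; [|lra].
    replace ((N + 1) * (e / (N + 1)))%R with e in Hh2 by (field; lra).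
    pose proof (Rabs_pos h). nra.
Qed.

Lemma fourier_le (v : R) :
  Cmod (J (fun u => g u * Cexp (RtoC v * (b, (- u)%R))))%C <= PI * (K * exp (v * b)).
Proof. apply J_norm, dominated_fourier. Qed.

End FourierLaplace.

Section FastMellin.
Context (G : C -> C) (HG : fast_decay G).

Lemma continuous_G_vline (c u : R) : 0 < c -> contC (fun u => G (c, u)) u.
Proof.
  intros Hc. apply (continuous_path_comp G (fun u => (c, u))); [|apply continuous_vline].
  apply (hol_continuous 0); [apply HG|exact Hc].
Qed.

(** With [x = exp v] this is [x ^ p] times the inversion integral of [G (s) x ^ (- s)] over
    [Re s = c]. Up to [2 PI], it is the integrand of the Mellin transform at [p] in the variable
    [v]. *)
Definition mellin_line (c p v : R) : C :=
  J (fun u => G (c, u) * Cexp (RtoC v * ((p - c)%R, (- u)%R)))%C.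

Lemma sub_vline (p c u : R) : ((p - c)%R, (- u)%R) = (RtoC p - (c, u))%C.
Proof. unfold Cminus, Cplus, Copp, RtoC; simpl. f_equal; ring. Qed.

(** The integrand is [O (1 / T ^ 2)] on the horizontal sides of a rectangle of fixed width, so the
    two vertical integrals agree in the limit. *)
Lemma mellin_line_independent (c1 c2 p v : R) :
  0 < c1 -> c1 <= c2 -> mellin_line c1 p v = mellin_line c2 p v.
Proof.
  intros Hc1 Hc. destruct HG as [Ghol Gdec]. destruct (Gdec c1 c2 Hc1) as [K [K0 HK]].
  set (q := fun s => (G s * (Cexp (RtoC (v * p)) * Cexp (s * RtoC (- v))))%C).
  assert (Hq : hol 0 q).
  { apply hol_mult; [exact Ghol|]. apply hol_mult; [apply hol_const|].
    eexists. apply holo_exp. }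
  assert (Eq : forall c u, (G (c, u) * Cexp (RtoC v * ((p - c)%R, (- u)%R)))%C = q (c, u)).
  { intros c u. unfold q. f_equal. rewrite <- Cexp_plus. f_equal.
    rewrite sub_vline, RtoC_mult, RtoC_opp. ring. }
  set (N := exp (Rabs v * (Rabs p + c2))).
  assert (HN : 0 < N) by apply exp_pos.
  assert (Bq : forall s u, c1 <= s <= c2 -> Cmod (q (s, u)) <= K * N / (1 + u ^ 2)).
  { intros s u Hs. rewrite <- Eq, Cmod_mult, Cmod_exp_vline.
    replace (K * N / (1 + u ^ 2))%R with (K / (1 + u ^ 2) * N)%R
      by (field; pose proof (one_sqr_pos u); lra).
    apply Rmult_le_compat; [apply Cmod_ge_0|left; apply exp_pos| |].
    - eapply Rle_trans; [apply HK, Hs|]. now apply inv_sqr_le.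
    - apply exp_le_exp. eapply Rle_trans; [apply Rle_abs|]. rewrite Rabs_mult.
      apply Rmult_le_compat_l; [apply Rabs_pos|].
      unfold Rminus. eapply Rle_trans; [apply Rabs_triang|].
      rewrite Rabs_Ropp, (Rabs_pos_eq s) by lra. lra. }
  assert (Dq : forall c, c1 <= c <= c2 -> dominated (fun u => q (c, u)) (K * N)).
  { intros c Hc'. split; [|intros; now apply Bq]. intros u.
    apply (continuous_path_comp q (fun u => (c, u))); [|apply continuous_vline].
    apply (hol_continuous 0); [exact Hq|simpl; lra]. }
  destruct Hq as [q' Hq].
  (* The point excluded by the primitive is put to the right of the strip. *)
  destruct (holo_primitive 0 q q' (RtoC (c2 + 1)) Hq ltac:(simpl; lra)) as [F HF].
  assert (E : (J (fun u => q (c2, u)) - J (fun u => q (c1, u)))%C = 0).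
  { apply (J_diff _ _ (K * N) (K * N) (2 * (c2 - c1) * (K * N)) 1 (fun _ => RtoC 0)).
    - apply Dq; lra.
    - apply Dq; lra.
    - apply (filterlim_const (U := C_UniformSpace)).
    - intros T HT. unfold Cminus at 1. rewrite Copp_0, Cplus_0_r.
      eapply Rle_trans; [apply (rectangle_shift F q c1 c2 T (K * N / (1 + T ^ 2)))|].
      + lra.
      + exact Hc.
      + intros s u Hs Hu _. split.
        * apply HF; [simpl; lra|]. intro X. apply (f_equal Re) in X. simpl in X. lra.
        * apply (holo_continuous 0 q q'); [exact Hq|simpl; lra].
      + intros s Hs. split; [now apply Bq|].
        pose proof (Bq s (- T)%R Hs) as B. now replace ((- T) ^ 2)%R with (T ^ 2)%R in B by ring.
      + unfold Rdiv. rewrite <- Rmult_assoc. apply Rmult_le_compat_l.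
        * apply Rmult_le_pos; [lra|]. apply Rmult_le_pos; lra.
        * apply Rinv_le_contravar; [lra|]. nra. }
  unfold mellin_line.
  replace (fun u => (G (c1, u) * Cexp (RtoC v * ((p - c1)%R, (- u)%R)))%C) with (fun u => q (c1, u))
    by (apply functional_extensionality; intros; now rewrite Eq).
  replace (fun u => (G (c2, u) * Cexp (RtoC v * ((p - c2)%R, (- u)%R)))%C) with (fun u => q (c2, u))
    by (apply functional_extensionality; intros; now rewrite Eq).
  replace (J (fun u => q (c2, u))) with (J (fun u => q (c2, u)) - J (fun u => q (c1, u))
    + J (fun u => q (c1, u)))%C by ring.
  rewrite E. ring.
Qed.

Lemma dominated_quotient (c p : R) : 0 < c -> c <> p ->
  exists K, dominated (fun u => G (c, u) / ((c, u) - RtoC p))%C K.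
Proof.
  intros Hc Hcp. destruct HG as [_ Gdec]. destruct (Gdec c c Hc) as [K [K0 HK]].
  exists (K / Rabs (c - p))%R. split.
  - intros u. apply continuous_quotient_vline; [exact Hcp|now apply continuous_G_vline].
  - intros u.
    assert (Hn : ((c, u) - RtoC p)%C <> 0) by (apply Csub_neq_0, vline_neq; now left).
    assert (Hpc : 0 < Rabs (c - p)) by (apply Rabs_pos_lt; lra).
    rewrite Cmod_div by exact Hn.
    replace (K / Rabs (c - p) / (1 + u ^ 2))%R with (K / (1 + u ^ 2) * / Rabs (c - p))%R
      by (field; pose proof (one_sqr_pos u); split; lra).
    apply Rmult_le_compat; [apply Cmod_ge_0| | |].
    + left. apply Rinv_0_lt_compat. now apply Cmod_gt_0.
    + eapply Rle_trans; [apply HK; lra|]. now apply inv_sqr_le.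
    + apply Rinv_le_contravar; [exact Hpc|]. exact (re_le_Cmod ((c, u) - RtoC p)).
Qed.

(** The subtracted pole contributes [2 atan (T / (c' - p))] on the right line and its counterpart of
    opposite sign on the left one; each tends to [PI] in absolute value. *)
Lemma mellin_residue (c c' p : R) : 0 < c -> c < p < c' ->
  (J (fun u => G (c', u) / ((c', u) - RtoC p)) - J (fun u => G (c, u) / ((c, u) - RtoC p)))%C
  = (2 * PI * G p)%C.
Proof.
  intros Hc Hp.
  destruct (dominated_quotient c p Hc ltac:(lra)) as [K1 D1].
  destruct (dominated_quotient c' p ltac:(lra) ltac:(lra)) as [K2 D2].
  destruct HG as [[G' Ghol] Gdec]. destruct (Gdec c c' Hc) as [K [K0 HK]].
  set (g := Cmod (G (RtoC p))). assert (Hg : 0 <= g) by apply Cmod_ge_0.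
  apply (J_diff _ _ K1 K2 (2 * (c' - c) * (K + g)) 1
    (fun T => G (RtoC p) * (RtoC (2 * atan (T / (c' - p))) + RtoC (2 * atan (T / (p - c)))))%C
    _ D1 D2).
  - assert (X1 : 0 < c' - p) by lra. assert (X2 : 0 < p - c) by lra.
    pose proof (proj1 (filterlim_C _ _ _) (filterlim_atan (c' - p) X1)) as L1.
    pose proof (proj1 (filterlim_C _ _ _) (filterlim_atan (p - c) X2)) as L2.
    apply filterlim_C; [typeclasses eauto|]. intros e He.
    assert (He' : 0 < e / (2 * (g + 1))) by (apply Rdiv_lt_0_compat; lra).
    generalize (filter_and _ _ (L1 _ He') (L2 _ He')). apply filter_imp.
    intros T [T1 T2].
    replace (G p * (RtoC (2 * atan (T / (c' - p))) + RtoC (2 * atan (T / (p - c)))) - 2 * PI * G p)%C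
      with (G p * ((RtoC (2 * atan (T / (c' - p))) - PI) + (RtoC (2 * atan (T / (p - c))) - PI)))%C
      by ring.
    rewrite Cmod_mult. fold g. eapply Rle_lt_trans; [apply Rmult_le_compat_l;
      [exact Hg|apply Cmod_triangle]|].
    apply Rle_lt_trans with (g * (e / (2 * (g + 1)) + e / (2 * (g + 1))))%R.
    + apply Rmult_le_compat_l; lra.
    + apply Rmult_lt_reg_r with (g + 1)%R; [lra|].
      replace (g * (e / (2 * (g + 1)) + e / (2 * (g + 1))) * (g + 1))%R with (g * e)%R
        by (field; lra). lra.
  - intros T HT.
    assert (HKT : forall s u, c <= s <= c' -> Rabs u = T -> Cmod (G (s, u)) <= K).
    { intros s u Hs _. eapply Rle_trans; [apply HK, Hs|].
      rewrite <- (Rdiv_1_r K) at 2. apply Rmult_le_compat_l; [exact K0|].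
      apply Rinv_le_contravar; [lra|]. pose proof (pow2_ge_0 u). nra. }
    pose proof (pole_shift 0 G G' p c c' T K Ghol ltac:(lra) Hc ltac:(lra) ltac:(lra) ltac:(lra)
      ltac:(lra) HKT) as B.
    replace (T / (c - p))%R with (- (T / (p - c)))%R in B by (field; split; lra).
    rewrite atan_opp in B.
    replace (RtoC (2 * - atan (T / (p - c)))) with (- RtoC (2 * atan (T / (p - c))))%C in B
      by (rewrite <- RtoC_opp; f_equal; ring).
    fold g in B. unfold Rdiv in *. rewrite (Rmult_assoc (2 * (c' - c))).
    eapply Rle_trans; [|exact B]. right. f_equal. ring.
Qed.

(** Integrating [exp (v (p - s))] in [v] divides by [p - s]. The result is [O (exp (v (p - c)))]: it
    vanishes at minus infinity if [c < p] and at plus infinity if [c > p], which is why two lines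
    are needed. *)
Lemma mellin_line_antiderivative (c p v : R) : 0 < c -> c <> p ->
  is_Cderive (fun v => J (fun u => G (c, u) / ((p - c)%R, (- u)%R)
      * Cexp (RtoC v * ((p - c)%R, (- u)%R))))%C v (mellin_line c p v) /\
  exists N, forall v, Cmod (J (fun u => G (c, u) / ((p - c)%R, (- u)%R)
      * Cexp (RtoC v * ((p - c)%R, (- u)%R))))%C <= N * exp (v * (p - c)).
Proof.
  intros Hc Hcp. destruct HG as [Ghol Gdec]. destruct (Gdec c c Hc) as [K [K0 HK]].
  assert (Hn : forall u, ((p - c)%R, (- u)%R) <> RtoC 0).
  { intros u E. apply (f_equal Re) in E. simpl in E. lra. }
  assert (Hcont : forall u, contC (fun u => G (c, u) / ((p - c)%R, (- u)%R))%C u).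
  { intros u. apply continuous_Cdiv; [apply Hn|now apply continuous_G_vline|].
    apply continuous_neg_vline. }
  assert (Hbd : forall u, Cmod (G (c, u) / ((p - c)%R, (- u)%R)) <= K / Rabs (p - c) / (1 + u ^ 2) ^ 2).
  { intros u. rewrite Cmod_div by apply Hn.
    assert (Hpc : 0 < Rabs (p - c)) by (apply Rabs_pos_lt; lra).
    replace (K / Rabs (p - c) / (1 + u ^ 2) ^ 2)%R
      with (K / (1 + u ^ 2) ^ 2 * / Rabs (p - c))%R
      by (field; pose proof (one_sqr_pos u); split; lra).
    apply Rmult_le_compat; [apply Cmod_ge_0| |apply HK; lra|].
    - left. apply Rinv_0_lt_compat. now apply Cmod_gt_0.
    - apply Rinv_le_contravar; [exact Hpc|]. exact (re_le_Cmod ((p - c)%R, (- u)%R)). }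
  split.
  - pose proof (is_Cderive_fourier _ (p - c) _ Hcont Hbd v) as H.
    unfold mellin_line.
    replace (fun u => (G (c, u) * Cexp (RtoC v * ((p - c)%R, (- u)%R)))%C)
      with (fun u => (G (c, u) / ((p - c)%R, (- u)%R) * ((p - c)%R, (- u)%R)
        * Cexp (RtoC v * ((p - c)%R, (- u)%R)))%C); [exact H|].
    apply functional_extensionality. intros u. f_equal. field. apply Hn.
  - exists (PI * (K / Rabs (p - c)))%R. intros w. rewrite Rmult_assoc.
    apply (fourier_le _ (p - c) _ Hcont Hbd).
Qed.

Lemma continuous_mellin_line (c p v : R) : 0 < c -> contC (mellin_line c p) v.
Proof.
  intros Hc. destruct HG as [Ghol Gdec]. destruct (Gdec c c Hc) as [K [K0 HK]].
  eapply is_Cderive_continuous.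
  apply (is_Cderive_fourier (fun u => G (c, u)) (p - c) K).
  - intros u. now apply continuous_G_vline.
  - intros u. apply HK. lra.
Qed.

(** With antiderivatives [P1] from a line left of [p] and [P2] from one right of it, the integral
    splits at [0] into [P1 0 - P1 a] and [P2 b - P2 0]. The outer terms vanish in the limit, and
    [P1 0 - P2 0] is the residue at [p]. *)
Lemma is_J_mellin_line (c p : R) : 0 < c -> 0 < p -> is_J (mellin_line c p) (2 * PI * G (RtoC p)).
Proof.
  intros Hc Hp.
  set (c1 := (p / 2)%R). set (c2 := (p + 1)%R).
  assert (Hc1 : 0 < c1) by (unfold c1; lra). assert (Hc2 : 0 < c2) by (unfold c2; lra).
  assert (I : forall c', 0 < c' -> forall v, mellin_line c' p v = mellin_line c p v).
  { intros c' Hc' v. destruct (Rle_dec c c') as [H|H].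
    - symmetry. now apply mellin_line_independent.
    - apply mellin_line_independent; lra. }
  destruct (mellin_line_antiderivative c1 p 0 Hc1 ltac:(unfold c1; lra)) as [_ [N1 HN1]].
  destruct (mellin_line_antiderivative c2 p 0 Hc2 ltac:(unfold c2; lra)) as [_ [N2 HN2]].
  set (P1 := fun v => J (fun u => G (c1, u) / ((p - c1)%R, (- u)%R)
      * Cexp (RtoC v * ((p - c1)%R, (- u)%R)))%C) in *.
  set (P2 := fun v => J (fun u => G (c2, u) / ((p - c2)%R, (- u)%R)
      * Cexp (RtoC v * ((p - c2)%R, (- u)%R)))%C) in *.
  assert (FTC : forall c' P, 0 < c' -> (forall v, is_Cderive P v (mellin_line c' p v)) ->
    forall a b, CRInt (mellin_line c p) a b = (P b - P a)%C).
  { intros c' P Hc' HP a b. apply is_CRInt_eq. apply is_CRInt_derive; intros u _.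
    - rewrite <- (I c' Hc'). apply HP.
    - now apply continuous_mellin_line. }
  assert (F1 := FTC c1 P1 Hc1 (fun v => proj1 (mellin_line_antiderivative c1 p v Hc1 ltac:(unfold c1; lra)))).
  assert (F2 := FTC c2 P2 Hc2 (fun v => proj1 (mellin_line_antiderivative c2 p v Hc2 ltac:(unfold c2; lra)))).
  assert (Hres : (P1 0 - P2 0)%C = (2 * PI * G (RtoC p))%C).
  { rewrite <- (mellin_residue c1 c2 p Hc1) by (unfold c1, c2; lra).
    assert (X : forall s, 0 < s -> s <> p ->
      J (fun u => G (s, u) / ((p - s)%R, (- u)%R) * Cexp (RtoC 0 * ((p - s)%R, (- u)%R)))%C
      = (- J (fun u => G (s, u) / ((s, u) - RtoC p)))%C).
    { intros s Hs Hsp. destruct (dominated_quotient s p Hs Hsp) as [K D].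
      assert (Hn : forall u, ((s, u) - RtoC p)%C <> 0)
        by (intros u; apply Csub_neq_0, vline_neq; now left).
      replace (- J (fun u => G (s, u) / ((s, u) - RtoC p)))%C
        with ((-1) * J (fun u => G (s, u) / ((s, u) - RtoC p)))%C by ring.
      rewrite <- (J_mult (-1) _ _ D). f_equal. apply functional_extensionality. intros u.
      rewrite sub_vline, Cmult_0_l, Cexp_0. field. split; [apply Hn|].
      intro E. apply (Hn u). replace ((s, u) - p)%C with (- (p - (s, u)))%C by ring.
      rewrite E. ring. }
    unfold P1, P2. rewrite !X by (unfold c1, c2 in *; lra). ring. }
  apply is_J_intro; [intros; now apply continuous_mellin_line|].
  intros e He.
  set (N := (Rabs N1 + Rabs N2 + 1)%R).
  pose proof (Rabs_pos N1). pose proof (Rabs_pos N2). pose proof (Rle_abs N1). pose proof (Rle_abs N2).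
  set (m := Rmin (p - c1) (c2 - p)).
  assert (Hm : 0 < m) by (apply Rmin_pos; unfold c1, c2; lra).
  assert (m1 : m <= p - c1) by apply Rmin_l. assert (m2 : m <= c2 - p) by apply Rmin_r.
  (* Both outer terms decay at least like [N exp (- m A)]; this threshold makes each at most
     [e / 4]. *)
  exists (Rabs (ln (4 * N / e)) / m + 1)%R. intros a b Ha Hb.
  set (A := (Rabs (ln (4 * N / e)) / m)%R) in *.
  assert (HA : 0 <= A) by (apply Rmult_le_pos; [apply Rabs_pos|left; now apply Rinv_0_lt_compat]).
  assert (HEA : exp (- (m * A)) <= e / (4 * N)).
  { assert (0 < 4 * N / e) by (apply Rdiv_lt_0_compat; unfold N; lra).
    replace (e / (4 * N))%R with (exp (- ln (4 * N / e))).
    - apply exp_le_exp. unfold A.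
      replace (m * (Rabs (ln (4 * N / e)) / m))%R with (Rabs (ln (4 * N / e))) by (field; lra).
      pose proof (Rle_abs (ln (4 * N / e))). lra.
    - rewrite exp_Ropp, exp_ln by assumption. field. unfold N. lra. }
  rewrite (CRInt_Chasles _ a 0 b) by (intros; now apply continuous_mellin_line).
  rewrite F1, F2, <- Hres.
  replace (P1 0 - P1 a + (P2 b - P2 0) - (P1 0 - P2 0))%C with (P2 b - P1 a)%C by ring.
  assert (Hn : forall n w, n <= N -> w <= - (m * A) -> n * exp w <= e / 4).
  { intros n w Hn Hw. apply exp_le_exp in Hw. pose proof (exp_pos w).
    apply Rle_trans with (N * (e / (4 * N)))%R.
    - apply Rle_trans with (N * exp w)%R; [apply Rmult_le_compat_r; lra|].
      apply Rmult_le_compat_l; [unfold N; lra|lra].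
    - right. field. unfold N. lra. }
  eapply Rle_lt_trans; [apply Cmod_sub_le|].
  assert (T1 : Cmod (P1 a) <= N1 * exp (a * (p - c1))) by exact (HN1 a).
  assert (T2 : Cmod (P2 b) <= N2 * exp (b * (p - c2))) by exact (HN2 b).
  pose proof (Hn N1 (a * (p - c1))%R ltac:(unfold N; lra) ltac:(nra)).
  pose proof (Hn N2 (b * (p - c2))%R ltac:(unfold N; lra) ltac:(nra)).
  lra.
Qed.

(** [W] is defined by the line [Re s = 1]; the choice is arbitrary because the integral does not
    depend on the line. *)
Lemma fast_mellin : exists W : R -> C, forall M,
  (forall c y, 0 < c -> 0 < y -> vline M (fun s => G s * Cpowr y (- s))%C c (2 * PI * W y)%C) /\
  (forall j, is_CRInt_0oo (fun y => RtoC (y ^ j) * W y)%C (G (RtoC (INR j) + 1)%C)).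
Proof.
  assert (Hpi : RtoC (2 * PI) <> 0).
  { intro E. apply RtoC_inj in E. pose proof PI_RGT_0. lra. }
  exists (fun y => / RtoC (2 * PI) * mellin_line 1 0 (ln y))%C. intros M. split.
  - intros c y Hc Hy. destruct HG as [Ghol Gdec]. destruct (Gdec c c Hc) as [K [K0 HK]].
    assert (EF : (fun u => G (c, u) * Cpowr y (- (c, u)))%C
      = (fun u => G (c, u) * Cexp (RtoC (ln y) * ((0 - c)%R, (- u)%R)))%C).
    { apply functional_extensionality. intros u. unfold Cpowr. do 2 f_equal.
      rewrite sub_vline. ring. }
    assert (D : dominated (fun u => G (c, u) * Cpowr y (- (c, u)))%C (K * exp (ln y * (0 - c)))).
    { rewrite EF. apply dominated_fourier.
      - intros u. now apply continuous_G_vline.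
      - intros u. apply HK. lra. }
    split; [apply D|]. split; [|intros _; eexists; exact D].
    replace (2 * PI * (/ RtoC (2 * PI) * mellin_line 1 0 (ln y)))%C with (mellin_line 1 0 (ln y))
      by (rewrite <- RtoC_mult; field; exact Hpi).
    replace (mellin_line 1 0 (ln y)) with (J (fun u => G (c, u) * Cpowr y (- (c, u)))%C).
    + apply (J_lim_sym _ _ D).
    + rewrite EF. fold (mellin_line c 0 (ln y)). destruct (Rle_dec c 1) as [H|H].
      * apply mellin_line_independent; lra.
      * symmetry. apply mellin_line_independent; lra.
  - intros j. set (p := (INR j + 1)%R).
    assert (Hp : 0 < p) by (unfold p; pose proof (pos_INR j); lra).
    apply (is_CRInt_0oo_subst _ (fun v => / RtoC (2 * PI) * mellin_line 1 p v)%C).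
    + intros v. apply continuous_Cmult; [apply continuous_Cconst|].
      apply continuous_mellin_line. lra.
    + intros x Hx.
      (* One power of [x] beyond the moment [j] compensates the factor [/ x] of the substitution. *)
      assert (E : mellin_line 1 p (ln x) = (RtoC (x ^ S j) * mellin_line 1 0 (ln x))%C).
      { destruct HG as [Ghol Gdec]. destruct (Gdec 1 1 Rlt_0_1) as [K [K0 HK]].
        unfold mellin_line. erewrite <- J_mult.
        2: { apply dominated_fourier with (K := K).
             - intros u. apply continuous_G_vline. lra.
             - intros u. apply HK. lra. }
        f_equal. apply functional_extensionality. intros u.
        replace (RtoC (x ^ S j)) with (Cexp (RtoC (ln x) * RtoC p)).
        - rewrite !sub_vline.
          replace (RtoC (ln x) * (p - (1, u)))%C
            with (RtoC (ln x) * RtoC p + RtoC (ln x) * (RtoC 0 - (1, u)))%C by ring.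
          rewrite Cexp_plus. ring.
        - rewrite <- RtoC_mult, Cexp_RtoC. f_equal. unfold p. rewrite <- S_INR.
          rewrite Rmult_comm, <- exp_pow_INR, exp_ln by exact Hx. reflexivity. }
      rewrite E. simpl pow. rewrite (RtoC_mult x), (RtoC_inv x) by lra.
      assert (Hx0 : RtoC x <> 0) by (intro X; apply RtoC_inj in X; lra).
      field. split; assumption.
    + pose proof (is_J_mellin_line 1 p Rlt_0_1 Hp) as HJ.
      replace (G (RtoC (INR j) + 1)%C) with (/ RtoC (2 * PI) * (2 * PI * G (RtoC p)))%C.
      * revert HJ. generalize (2 * PI * G (RtoC p))%C. intros v HJ.
        exact (is_RInt_gen_Cmult _ _ (/ RtoC (2 * PI)) (mellin_line 1 p) v HJ).
      * replace (RtoC (INR j) + 1)%C with (RtoC p) by (unfold p; now rewrite RtoC_plus).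
        rewrite <- RtoC_mult. field. exact Hpi.
Qed.

End FastMellin.

(** * Lagrange interpolation and partial fractions *)

Fixpoint Csumn (f : nat -> C) (n : nat) : C :=
  match n with 0%nat => RtoC 0 | S n => (Csumn f n + f n)%C end.

Lemma Csumn_ext (f g : nat -> C) (n : nat) :
  (forall i, (i < n)%nat -> f i = g i) -> Csumn f n = Csumn g n.
Proof.
  induction n as [|n IH]; intros H; simpl; [reflexivity|].
  rewrite IH by (intros; apply H; lia). now rewrite H by lia.
Qed.

Lemma Csumn_mult (c : C) (f : nat -> C) (n : nat) :
  Csumn (fun i => c * f i)%C n = (c * Csumn f n)%C.
Proof. induction n as [|n IH]; simpl; [ring|]. rewrite IH. ring. Qed.

Lemma Csumn_plus (f g : nat -> C) (n : nat) :
  Csumn (fun i => f i + g i)%C n = (Csumn f n + Csumn g n)%C.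
Proof. induction n as [|n IH]; simpl; [ring|]. rewrite IH. ring. Qed.

Lemma Csumn_single (f : nat -> C) (n k : nat) :
  (k < n)%nat -> (forall i, (i < n)%nat -> i <> k -> f i = 0) -> Csumn f n = f k.
Proof.
  induction n as [|n IH]; intros Hk H; [lia|]. simpl.
  destruct (Nat.eq_dec k n) as [->|Hkn].
  - rewrite (Csumn_ext f (fun _ => 0 * 0)%C) by (intros; rewrite H by lia; ring).
    rewrite (Csumn_mult 0 (fun _ => RtoC 0)). ring.
  - rewrite IH, (H n) by (lia || (intros; apply H; lia)). ring.
Qed.

Lemma Csumn_exchange (f : nat -> nat -> C) (m n : nat) :
  Csumn (fun i => Csumn (fun j => f i j) n) m = Csumn (fun j => Csumn (fun i => f i j) m) n.
Proof.
  induction m as [|m IH]; simpl.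
  - induction n as [|n IHn]; simpl; [reflexivity|]. rewrite <- IHn. ring.
  - rewrite IH, Csumn_plus. reflexivity.
Qed.

Lemma sum_n_Csumn (f : nat -> C) (n : nat) :
  sum_n (G := C_AbelianMonoid) f n = Csumn f (S n).
Proof.
  induction n as [|n IH].
  - rewrite sum_O. simpl. ring.
  - rewrite sum_Sn, IH. reflexivity.
Qed.

(* Horner form; [d] bounds the degree. *)
Fixpoint is_poly (d : nat) (f : C -> C) : Prop :=
  match d with
  | 0%nat => exists c, forall z, f z = c
  | S d => exists c g, is_poly d g /\ forall z, f z = (c + z * g z)%C
  end.

Lemma is_poly_ext (d : nat) (f g : C -> C) : (forall z, f z = g z) -> is_poly d f -> is_poly d g.
Proof. intros H. now rewrite (functional_extensionality f g H). Qed.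

Lemma is_poly_const (d : nat) (c : C) : is_poly d (fun _ => c).
Proof.
  revert c. induction d as [|d IH]; intros c; simpl; [now exists c|].
  exists c, (fun _ => RtoC 0). split; [apply IH|]. intros; ring.
Qed.

Lemma is_poly_S (d : nat) (f : C -> C) : is_poly d f -> is_poly (S d) f.
Proof.
  revert f. induction d as [|d IH]; intros f.
  - intros [c Hc]. exists c, (fun _ => RtoC 0). split; [now exists 0|].
    intros z. rewrite Hc. ring.
  - intros [c [g [Hg Hf]]]. exists c, g. split; [now apply IH|exact Hf].
Qed.

Lemma is_poly_plus (d : nat) (f g : C -> C) :
  is_poly d f -> is_poly d g -> is_poly d (fun z => f z + g z)%C.
Proof.
  revert f g. induction d as [|d IH]; intros f g; simpl.
  - intros [c Hc] [e He]. exists (c + e)%C. intros. now rewrite Hc, He.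
  - intros [c [f1 [Hf1 Hf]]] [e [g1 [Hg1 Hg]]].
    exists (c + e)%C, (fun z => f1 z + g1 z)%C. split; [now apply IH|].
    intros z. rewrite Hf, Hg. ring.
Qed.

Lemma is_poly_scal (d : nat) (a : C) (f : C -> C) : is_poly d f -> is_poly d (fun z => a * f z)%C.
Proof.
  revert f. induction d as [|d IH]; intros f; simpl.
  - intros [c Hc]. exists (a * c)%C. intros. now rewrite Hc.
  - intros [c [f1 [Hf1 Hf]]]. exists (a * c)%C, (fun z => a * f1 z)%C. split; [now apply IH|].
    intros z. rewrite Hf. ring.
Qed.

Lemma is_poly_mul_linear (d : nat) (a : C) (f : C -> C) :
  is_poly d f -> is_poly (S d) (fun z => f z * (z + a))%C.
Proof.
  intros Hf. apply (is_poly_ext _ (fun z => a * f z + z * f z)%C); [intros; ring|].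
  apply is_poly_plus; [now apply is_poly_S, is_poly_scal|].
  exists 0, f. split; [exact Hf|]. intros; ring.
Qed.

Lemma is_poly_div (d : nat) (a : C) (f : C -> C) : is_poly (S d) f ->
  exists g, is_poly d g /\ forall z, f z = (f a + (z - a) * g z)%C.
Proof.
  revert f. induction d as [|d IH]; intros f [c [g [Hg Hf]]].
  - destruct Hg as [e He]. exists (fun _ => e). split; [now exists e|].
    intros z. rewrite !Hf, !He. ring.
  - destruct (IH g Hg) as [g2 [Hg2 Hg3]].
    exists (fun z => g a + (g2 z * (z + 0) ))%C. split.
    + apply is_poly_plus; [apply is_poly_const|now apply is_poly_mul_linear].
    + intros z. rewrite (Hf z), (Hf a), (Hg3 z). ring.
Qed.

Lemma is_poly_zero (d : nat) (f : C -> C) (a : nat -> C) : is_poly d f ->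
  (forall i j, (i <= d)%nat -> (j <= d)%nat -> i <> j -> a i <> a j) ->
  (forall i, (i <= d)%nat -> f (a i) = 0) -> forall z, f z = 0.
Proof.
  revert f. induction d as [|d IH]; intros f Hf Ha H0 z.
  - destruct Hf as [c Hc]. rewrite Hc, <- (Hc (a 0%nat)). now apply H0.
  - destruct (is_poly_div d (a (S d)) f Hf) as [g [Hg Hfg]].
    assert (Hg0 : forall z, g z = 0).
    { apply IH; [exact Hg|intros; apply Ha; lia|]. intros i Hi.
      assert (Hd : (a i - a (S d))%C <> 0) by (apply Csub_neq_0, Ha; lia).
      pose proof (Hfg (a i)) as E. rewrite (H0 i), (H0 (S d)) in E by lia.
      replace (g (a i)) with ((0 + (a i - a (S d)) * g (a i)) / (a i - a (S d)))%C
        by (field; exact Hd).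
      rewrite <- E. field. exact Hd. }
    rewrite Hfg, Hg0, H0 by lia. ring.
Qed.

Definition node_prod (a : nat -> C) (n k : nat) (z : C) : C :=
  Cprodn (fun i => if Nat.eqb i k then RtoC 1 else (z - a i)%C) n.

Lemma is_poly_Cprodn (a : nat -> C) (n : nat) : is_poly n (fun z => Cprodn (fun i => z + a i)%C n).
Proof.
  induction n as [|n IH]; [now exists 1|]. simpl Cprodn. now apply is_poly_mul_linear.
Qed.

Lemma is_poly_node_prod (a : nat -> C) (n k : nat) : (k < n)%nat -> is_poly (n - 1) (node_prod a n k).
Proof.
  unfold node_prod. induction n as [|n IH]; intros Hk; [lia|]. simpl Cprodn.
  rewrite Nat.sub_succ, Nat.sub_0_r.
  destruct (Nat.eqb_spec n k) as [->|Hnk].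
  - apply (is_poly_ext _ (fun z => Cprodn (fun i => z + - a i)%C k)).
    + intros z. rewrite Cmult_1_r. apply Cprodn_ext. intros i Hi.
      destruct (Nat.eqb_spec i k); [lia|reflexivity].
    + apply is_poly_Cprodn.
  - replace n with (S (n - 1)) at 1 by lia.
    apply (is_poly_mul_linear (n - 1) (- a n)%C). apply IH. lia.
Qed.

Lemma Cprodn_node_prod (a : nat -> C) (n k : nat) (z : C) : (k < n)%nat ->
  Cprodn (fun i => z - a i)%C n = ((z - a k) * node_prod a n k z)%C.
Proof.
  unfold node_prod. induction n as [|n IH]; intros Hk; [lia|]. simpl.
  destruct (Nat.eqb_spec n k) as [->|Hnk].
  - replace (Cprodn (fun i => if Nat.eqb i k then RtoC 1 else (z - a i)%C) k)
      with (Cprodn (fun i => z - a i)%C k); [ring|].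
    apply Cprodn_ext. intros i Hi. destruct (Nat.eqb_spec i k); [lia|reflexivity].
  - rewrite IH by lia. ring.
Qed.

Lemma Cprodn_zero (f : nat -> C) (n k : nat) : (k < n)%nat -> f k = 0 -> Cprodn f n = 0.
Proof.
  induction n as [|n IH]; intros Hk H; [lia|]. simpl.
  destruct (Nat.eq_dec k n) as [->|Hkn]; [rewrite H; ring|]. rewrite IH by (lia || exact H). ring.
Qed.

Section Nodes.
Context (a : nat -> C) (n : nat)
  (Ha : forall i j, (i < n)%nat -> (j < n)%nat -> i <> j -> a i <> a j).

Lemma node_prod_neq_0 (k : nat) : (k < n)%nat -> node_prod a n k (a k) <> 0.
Proof.
  intros Hk. apply Cprodn_neq_0. intros i Hi. destruct (Nat.eqb_spec i k) as [->|Hik].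
  - intro E; apply RtoC_inj in E; lra.
  - apply Csub_neq_0. apply Ha; auto.
Qed.

Lemma node_prod_other (k j : nat) : (j < n)%nat -> j <> k -> node_prod a n k (a j) = 0.
Proof.
  intros Hj Hjk. apply (Cprodn_zero _ n j Hj). destruct (Nat.eqb_spec j k); [contradiction|ring].
Qed.

Lemma is_poly_Csumn (d m : nat) (f : nat -> C -> C) :
  (forall i, (i < m)%nat -> is_poly d (f i)) -> is_poly d (fun z => Csumn (fun i => f i z) m).
Proof.
  induction m as [|m IH]; intros H; simpl; [apply is_poly_const|].
  apply is_poly_plus; [apply IH; intros; apply H; lia|apply H; lia].
Qed.

(** The difference of the two sides has degree at most [n - 1] and vanishes at the [n] nodes. *)
Lemma lagrange (p : C -> C) : (1 <= n)%nat -> is_poly (n - 1) p -> forall z,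
  p z = Csumn (fun k => p (a k) / node_prod a n k (a k) * node_prod a n k z)%C n.
Proof.
  intros Hn Hp z.
  assert (Z : forall z, (p z + (-1) * Csumn (fun k => p (a k) / node_prod a n k (a k)
    * node_prod a n k z) n)%C = 0).
  { apply (is_poly_zero (n - 1) _ a).
    - apply is_poly_plus; [exact Hp|]. apply is_poly_scal. apply is_poly_Csumn.
      intros i Hi. apply is_poly_scal. now apply is_poly_node_prod.
    - intros i j Hi Hj. apply Ha; lia.
    - intros i Hi. rewrite (Csumn_single _ n i); [|lia|].
      + field. apply node_prod_neq_0. lia.
      + intros j Hj Hji. rewrite (node_prod_other j i); [ring|lia|intro; subst; now apply Hji]. }
  specialize (Z z).
  set (S := Csumn _ n) in *. replace (p z) with (p z + (-1) * S + S)%C by ring.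
  rewrite Z. ring.
Qed.

(** Interpolation of the constant [1], divided by the product over all nodes. *)
Lemma partial_fractions (z : C) : (1 <= n)%nat -> (forall i, (i < n)%nat -> z <> a i) ->
  (/ Cprodn (fun i => z - a i) n)%C
  = Csumn (fun k => / node_prod a n k (a k) * / (z - a k))%C n.
Proof.
  intros Hn Hz.
  assert (Hp : Cprodn (fun i => z - a i)%C n <> 0).
  { apply Cprodn_neq_0. intros i Hi. now apply Csub_neq_0, Hz. }
  rewrite <- (Cmult_1_r (/ Cprodn _ n)).
  rewrite (lagrange (fun _ => RtoC 1) Hn (is_poly_const _ 1) z), <- Csumn_mult.
  apply Csumn_ext. intros k Hk.
  rewrite (Cprodn_node_prod a n k z Hk) in *.
  assert (H1 : node_prod a n k z <> 0) by (intro E; apply Hp; rewrite E; ring).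
  field. repeat split; [now apply Csub_neq_0, Hz|now apply node_prod_neq_0|exact H1].
Qed.

End Nodes.

(** * Perron's formula *)

Section Perron.
Context (l c k : R) (Hl : 0 < l) (Hck : c <> k).

Let H (z : C) : C := Cexp (z * RtoC (- l)).
Let E : R := (exp (- l * c) + exp (- l * k))%R.

Lemma Cmod_perron (p u : R) : Cmod (H (p, u)) = exp (- l * p).
Proof. unfold H. rewrite Cmod_Cexp, Re_mul_R. f_equal. simpl. ring. Qed.

Lemma continuous_perron (p u : R) : contC (fun u => H (p, u)) u.
Proof.
  apply continuous_Cexp. apply continuous_Cmult; [apply continuous_vline|apply continuous_Cconst].
Qed.

(** The numerator does not decay along vertical lines, so the right side of the rectangle must
    recede, but more slowly than [T]. At distance [sqrt T] the horizontal sides contribute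
    [O (sqrt T / T)], while on the far side [exp (- l sqrt T)] outweighs the length [2 T]. *)
Lemma perron_truncated (T : R) : 1 <= T ->
  Cmod (CRInt (fun u => H (c, u) / ((c, u) - RtoC k))%C (- T) T
    - H (RtoC k) * (RtoC (2 * atan (T / (c - k)))
        - RtoC (2 * atan (T / (Rmax c k + sqrt T - k)))))
  <= (2 * (Rmax c k - c + 1) * E + 8 * exp (- l * Rmax c k) / l ^ 2) / sqrt T.
Proof.
  intros HT. set (S := sqrt T).
  assert (HS : 1 <= S) by (unfold S; rewrite <- sqrt_1; apply sqrt_le_1_alt; exact HT).
  assert (HSS : T = (S * S)%R) by (unfold S; rewrite sqrt_sqrt; lra).
  set (m := Rmax c k). assert (Hmc : c <= m) by apply Rmax_l. assert (Hmk : k <= m) by apply Rmax_r.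
  set (c' := (m + S)%R).
  assert (HEk : H (RtoC k) = RtoC (exp (- l * k))).
  { unfold H. rewrite <- RtoC_mult, Cexp_RtoC. do 2 f_equal. ring. }
  assert (E0 : 0 < E) by (unfold E; pose proof (exp_pos (- l * c)); pose proof (exp_pos (- l * k)); lra).
  assert (Hck' : c' <> k) by (unfold c'; lra).
  assert (HB : forall s u, c <= s <= c' -> Rabs u = T -> Cmod (H (s, u)) <= exp (- l * c)).
  { intros s u Hs _. rewrite Cmod_perron. apply exp_le_exp. nra. }
  pose proof (Rmin_l c k). pose proof (Rmin_r c k).
  pose proof (pole_shift (Rmin c k - 1) H _ k c c' T _ (holo_exp _ (- l)) ltac:(lra) ltac:(lra)
    ltac:(unfold c'; lra) Hck Hck' ltac:(lra) HB) as Shift.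
  rewrite HEk, Cmod_R, (Rabs_pos_eq (exp (- l * k))), <- HEk in Shift by (left; apply exp_pos).
  fold E in Shift.
  assert (Far : Cmod (CRInt (fun u => H (c', u) / ((c', u) - RtoC k))%C (- T) T)
    <= (T - - T) * (exp (- l * m) * exp (- l * S) * / S)).
  { apply (is_CRInt_norm_le_const (fun u => H (c', u) / ((c', u) - RtoC k))%C _ (- T) T); [lra| |].
    - intros u _. assert (Hn : (c', u) <> RtoC k) by (apply vline_neq; now left).
      rewrite Cmod_div by now apply Csub_neq_0.
      apply Rmult_le_compat; [apply Cmod_ge_0| | |].
      + left. apply Rinv_0_lt_compat, Cmod_gt_0. now apply Csub_neq_0.
      + rewrite Cmod_perron, <- exp_plus. right. f_equal. unfold c'. ring.
      + apply Rinv_le_contravar; [lra|]. eapply Rle_trans; [|apply re_le_Cmod].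
        eapply Rle_trans; [|apply Rle_abs]. unfold Cminus. rewrite re_plus, re_opp.
        unfold c'; simpl. lra.
    - apply CRInt_continuous. intros u. apply continuous_quotient_vline;
        [exact Hck'|apply continuous_perron]. }
  fold m S. fold c'.
  set (Xc := CRInt (fun u => H (c, u) / ((c, u) - RtoC k))%C (- T) T) in *.
  set (Xc' := CRInt (fun u => H (c', u) / ((c', u) - RtoC k))%C (- T) T) in *.
  set (A1 := RtoC (2 * atan (T / (c - k)))) in *. set (A2 := RtoC (2 * atan (T / (c' - k)))) in *.
  replace (Xc - H (RtoC k) * (A1 - A2))%C
    with (Xc' - (Xc' - H (RtoC k) * A2 - (Xc - H (RtoC k) * A1)))%C by ring.
  eapply Rle_trans; [apply Cmod_sub_le|].
  assert (X1 : 2 * (c' - c) * (E / T) <= 2 * (m - c + 1) * E / S).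
  { rewrite HSS. replace (2 * (c' - c) * (E / (S * S)))%R with (2 * ((c' - c) / S) * E / S)%R
      by (field; lra).
    apply Rmult_le_compat_r; [left; apply Rinv_0_lt_compat; lra|].
    apply Rmult_le_compat_r; [lra|]. apply Rmult_le_compat_l; [lra|].
    apply Rmult_le_reg_r with S; [lra|]. replace ((c' - c) / S * S)%R with (c' - c)%R by (field; lra).
    unfold c'. nra. }
  assert (X2 : (T - - T) * (exp (- l * m) * exp (- l * S) * / S)
    <= 8 * exp (- l * m) / l ^ 2 / S).
  (* From [exp x >= (1 + x / 2) ^ 2 >= x ^ 2 / 4] at [x = l S]; the factor [S ^ 2] cancels the
     length [2 T]. *)
  { assert (Q : exp (- l * S) <= 4 / (l ^ 2 * (S * S))).
    { replace (- l * S)%R with (- (l * S))%R by ring. rewrite exp_Ropp.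
      assert (Hls : 0 < l * S) by nra.
      assert (Y : (l * S) ^ 2 / 4 <= exp (l * S)).
      { pose proof (exp_ineq1_le (l * S / 2)) as Z.
        replace (l * S)%R with (l * S / 2 + l * S / 2)%R at 2 by field. rewrite exp_plus. nra. }
      replace (4 / (l ^ 2 * (S * S)))%R with (/ ((l * S) ^ 2 / 4))%R by (field; lra).
      apply Rinv_le_contravar; [|exact Y]. pose proof (pow_lt (l * S) 2 Hls). lra. }
    rewrite HSS.
    replace (8 * exp (- l * m) / l ^ 2 / S)%R
      with ((S * S - - (S * S)) * (exp (- l * m) * (4 / (l ^ 2 * (S * S))) * / S))%R
      by (field; lra).
    apply Rmult_le_compat_l; [nra|].
    apply Rmult_le_compat_r; [left; apply Rinv_0_lt_compat; lra|].
    apply Rmult_le_compat_l; [left; apply exp_pos|exact Q]. }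
  unfold Rdiv in *. rewrite Rmult_plus_distr_r. lra.
Qed.

Lemma filterlim_inv_sqrt (B e : R) : 0 < e ->
  Rbar_locally p_infty (fun T => 1 <= T /\ B / sqrt T < e).
Proof.
  intros He. exists (Rmax 1 ((Rabs B / e) ^ 2)). intros T HT.
  pose proof (Rmax_l 1 ((Rabs B / e) ^ 2)). pose proof (Rmax_r 1 ((Rabs B / e) ^ 2)).
  split; [lra|].
  assert (Hq : 0 <= Rabs B / e)
    by (apply Rmult_le_pos; [apply Rabs_pos|left; now apply Rinv_0_lt_compat]).
  assert (Hs : Rabs B / e < sqrt T).
  { rewrite <- (sqrt_pow2 (Rabs B / e)) by exact Hq. apply sqrt_lt_1_alt. split; [|lra].
    apply pow2_ge_0. }
  assert (Hs0 : 0 < sqrt T) by lra.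
  apply Rmult_lt_reg_r with (sqrt T); [exact Hs0|].
  unfold Rdiv. rewrite Rmult_assoc, Rinv_l, Rmult_1_r by lra.
  apply Rmult_lt_compat_r with (r := e) in Hs; [|exact He].
  replace (Rabs B / e * e)%R with (Rabs B) in Hs by (field; lra).
  pose proof (Rle_abs B). lra.
Qed.

(** The second arctangent in the truncated formula tends to [PI / 2]. The first tends to [PI / 2] or
    [- PI / 2] according to the side of the pole on which the line runs, so the two cancel or add
    up. *)
Lemma perron :
  filterlim (fun T => CRInt (fun u => H (c, u) / ((c, u) - RtoC k))%C (- T) T)
    (Rbar_locally p_infty)
    (locally (T := C_UniformSpace) (if Rlt_dec k c then RtoC 0 else - (2 * PI * H (RtoC k)))%C).
Proof.
  apply filterlim_C; [typeclasses eauto|]. intros e He.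
  set (h := Cmod (H (RtoC k))). pose proof (Cmod_ge_0 (H (RtoC k)) : 0 <= h) as Hh.
  set (B := (2 * (Rmax c k - c + 1) * E + 8 * exp (- l * Rmax c k) / l ^ 2)%R).
  assert (He1 : 0 < e / (8 * (h + 1))) by (apply Rdiv_lt_0_compat; lra).
  destruct (atan_near_PI2 _ He1) as [A [HA0 HA]].
  set (m := (Rmax c k - k + 1)%R).
  assert (Hm : 1 <= m) by (unfold m; pose proof (Rmax_r c k); lra).
  assert (Ev1 : Rbar_locally p_infty (fun T => A <= T / Rabs (c - k))).
  { exists (A * Rabs (c - k))%R. intros T HT.
    assert (Hp : 0 < Rabs (c - k)) by (apply Rabs_pos_lt; lra).
    apply Rmult_le_reg_r with (Rabs (c - k)); [exact Hp|].
    replace (T / Rabs (c - k) * Rabs (c - k))%R with T by (field; lra). lra. }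
  assert (He2 : 0 < e / 2) by lra.
  generalize (filter_and _ _ Ev1 (filter_and _ _ (filterlim_inv_sqrt B (e / 2) He2)
    (filterlim_inv_sqrt (m * A) 1 Rlt_0_1))).
  apply filter_imp. intros T [E1 [[HT1 E2] [_ E3]]].
  pose proof (perron_truncated T HT1) as P. fold B in P.
  assert (HS : 1 <= sqrt T) by (rewrite <- sqrt_1; apply sqrt_le_1_alt; exact HT1).
  assert (HSS : T = (sqrt T * sqrt T)%R) by (rewrite sqrt_sqrt; lra).
  assert (E4 : A <= T / (Rmax c k + sqrt T - k)).
  { apply Rmult_lt_compat_r with (r := sqrt T) in E3; [|lra].
    replace (m * A / sqrt T * sqrt T)%R with (m * A)%R in E3 by (field; lra).
    assert (Hpos : 0 < Rmax c k + sqrt T - k) by (unfold m in *; lra).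
    apply Rmult_le_reg_r with (Rmax c k + sqrt T - k)%R; [exact Hpos|].
    replace (T / (Rmax c k + sqrt T - k) * (Rmax c k + sqrt T - k))%R with T by (field; lra).
    rewrite HSS at 2. apply Rle_trans with (A * (m * sqrt T))%R; [|nra].
    apply Rmult_le_compat_l; [lra|]. unfold m in *. nra. }
  pose proof (HA _ E1) as B1. pose proof (HA _ E4) as B2.
  set (A2 := atan (T / (Rmax c k + sqrt T - k))) in *.
  set (X := CRInt (fun u => H (c, u) / ((c, u) - RtoC k))%C (- T) T) in *.
  set (L := if Rlt_dec k c then RtoC 0 else (- (2 * PI * H (RtoC k)))%C).
  set (Y := (H (RtoC k) * (RtoC (2 * atan (T / (c - k))) - RtoC (2 * A2)))%C) in *.
  assert (HY : Cmod (Y - L) < e / 2).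
  { assert (Z : exists r, (Y - L)%C = (H (RtoC k) * RtoC r)%C /\ Rabs r <= 4 * (e / (8 * (h + 1)))).
    { unfold L. destruct (Rlt_dec k c) as [Hkc|Hkc].
      - exists (2 * atan (T / (c - k)) - 2 * A2)%R. split.
        + unfold Y. rewrite RtoC_minus. ring.
        + rewrite (Rabs_pos_eq (c - k)) in B1 by lra. apply Rabs_le. lra.
      - exists (2 * atan (T / (c - k)) - 2 * A2 + 2 * PI)%R. split.
        + unfold Y. rewrite RtoC_plus, RtoC_minus, (RtoC_mult 2 PI). ring.
        + rewrite (Rabs_left (c - k)) in B1 by lra.
          replace (T / (c - k))%R with (- (T / - (c - k)))%R by (field; lra).
          rewrite atan_opp. apply Rabs_le. lra. }
    destruct Z as [r [-> Hr]]. rewrite Cmod_mult, Cmod_R. fold h.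
    apply Rle_lt_trans with (h * (4 * (e / (8 * (h + 1)))))%R; [now apply Rmult_le_compat_l|].
    apply Rmult_lt_reg_r with (h + 1)%R; [lra|].
    replace (h * (4 * (e / (8 * (h + 1)))) * (h + 1))%R with (h * e / 2)%R by (field; lra). nra. }
  change (Cmod (X - L) < e).
  replace (X - L)%C with ((X - Y) + (Y - L))%C by ring.
  eapply Rle_lt_trans; [apply Cmod_triangle|]. lra.
Qed.

End Perron.

(** * Linear combinations of line integrals and of Mellin pairs *)

Lemma filterlim_C_plus (f g : R -> C) (v w : C) :
  filterlim f (Rbar_locally p_infty) (locally (T := C_UniformSpace) v) ->
  filterlim g (Rbar_locally p_infty) (locally (T := C_UniformSpace) w) ->
  filterlim (fun T => f T + g T)%C (Rbar_locally p_infty) (locally (T := C_UniformSpace) (v + w)%C).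
Proof.
  intros Hf Hg. apply filterlim_C; [typeclasses eauto|]. intros e He.
  assert (He2 : 0 < e / 2) by lra.
  generalize (filter_and _ _ (proj1 (filterlim_C _ _ _) Hf _ He2) (proj1 (filterlim_C _ _ _) Hg _ He2)).
  apply filter_imp. intros T [A1 A2].
  replace (f T + g T - (v + w))%C with ((f T - v) + (g T - w))%C by ring.
  eapply Rle_lt_trans; [apply Cmod_triangle|]. lra.
Qed.

Lemma filterlim_C_mult (c : C) (f : R -> C) (v : C) :
  filterlim f (Rbar_locally p_infty) (locally (T := C_UniformSpace) v) ->
  filterlim (fun T => c * f T)%C (Rbar_locally p_infty) (locally (T := C_UniformSpace) (c * v)%C).
Proof.
  intros Hf. apply filterlim_C; [typeclasses eauto|]. intros e He.
  assert (Hc : 0 < Cmod c + 1) by (pose proof (Cmod_ge_0 c); lra).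
  generalize (proj1 (filterlim_C _ _ _) Hf _ (Rdiv_lt_0_compat _ _ He Hc)).
  apply filter_imp. intros T A1.
  replace (c * f T - c * v)%C with (c * (f T - v))%C by ring.
  rewrite Cmod_mult. apply Rle_lt_trans with (Cmod c * (e / (Cmod c + 1)))%R.
  - apply Rmult_le_compat_l; [apply Cmod_ge_0|lra].
  - apply Rmult_lt_reg_r with (Cmod c + 1)%R; [exact Hc|].
    replace (Cmod c * (e / (Cmod c + 1)) * (Cmod c + 1))%R with (Cmod c * e)%R by (field; lra).
    nra.
Qed.

Lemma vline_plus (M : nat) (f g : C -> C) (c : R) (v w : C) :
  vline M f c v -> vline M g c w -> vline M (fun s => f s + g s)%C c (v + w)%C.
Proof.
  intros [F1 [F2 F3]] [G1 [G2 G3]]. split; [|split].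
  - intros u. now apply continuous_Cplus.
  - replace (fun T => CRInt (fun u => f (c, u) + g (c, u))%C (- T) T)
      with (fun T => CRInt (fun u => f (c, u)) (- T) T + CRInt (fun u => g (c, u)) (- T) T)%C.
    + now apply filterlim_C_plus.
    + apply functional_extensionality. intros T. symmetry. apply is_CRInt_eq.
      apply is_CRInt_plus; now apply CRInt_continuous.
  - intros HM. destruct (F3 HM) as [K HK]. destruct (G3 HM) as [L HL].
    exists (K + L)%R. exact (dominated_plus _ _ _ _ HK HL).
Qed.

Lemma vline_mult (M : nat) (a : C) (f : C -> C) (c : R) (v : C) :
  vline M f c v -> vline M (fun s => a * f s)%C c (a * v)%C.
Proof.
  intros [F1 [F2 F3]]. split; [|split].
  - intros u. apply continuous_Cmult; [apply continuous_Cconst|apply F1].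
  - replace (fun T => CRInt (fun u => a * f (c, u))%C (- T) T)
      with (fun T => a * CRInt (fun u => f (c, u)) (- T) T)%C.
    + now apply filterlim_C_mult.
    + apply functional_extensionality. intros T. symmetry. apply is_CRInt_eq.
      apply is_CRInt_mult; now apply CRInt_continuous.
  - intros HM. destruct (F3 HM) as [K HK].
    exists (Cmod a * K)%R. exact (dominated_mult _ _ _ HK).
Qed.

Lemma vline_ext (M : nat) (f g : C -> C) (c : R) (v : C) :
  (forall u, f (c, u) = g (c, u)) -> vline M f c v -> vline M g c v.
Proof.
  intros H [H1 H2]. split.
  - intros u. exact (continuous_ext _ _ _ H (H1 u)).
  - rewrite <- (functional_extensionality (fun u => f (c, u)) (fun u => g (c, u)) H). exact H2.
Qed.

Lemma vline_0 (M : nat) (c : R) : vline M (fun _ => RtoC 0) c 0.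
Proof.
  split; [|split].
  - intros u. apply continuous_Cconst.
  - replace (fun T => CRInt (fun _ => RtoC 0) (- T) T) with (fun _ : R => RtoC 0).
    + apply (filterlim_const (U := C_UniformSpace)).
    + apply functional_extensionality. intros T. symmetry. apply is_CRInt_eq.
      pose proof (is_CRInt_const 0 (- T) T) as H.
      now replace (RtoC (T - - T) * 0)%C with (RtoC 0) in H by ring.
  - intros _. exists 0. split.
    + intros u. apply continuous_Cconst.
    + intros u. rewrite Cmod_0. unfold Rdiv. rewrite Rmult_0_l. lra.
Qed.

Lemma vline_Csumn (M : nat) (f : nat -> C -> C) (c : R) (v : nat -> C) (n : nat) :
  (forall i, (i < n)%nat -> vline M (f i) c (v i)) ->
  vline M (fun s => Csumn (fun i => f i s) n) c (Csumn v n).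
Proof.
  induction n as [|n IH]; intros H; simpl; [apply vline_0|].
  apply vline_plus; [apply IH; intros; apply H; lia|apply H; lia].
Qed.

Lemma is_CRInt_0oo_plus (f g : R -> C) (v w : C) :
  is_CRInt_0oo f v -> is_CRInt_0oo g w -> is_CRInt_0oo (fun x => f x + g x)%C (v + w)%C.
Proof. exact (is_RInt_gen_plus (V := C_R_NormedModule) f g v w). Qed.

Lemma is_CRInt_0oo_mult (a : C) (f : R -> C) (v : C) :
  is_CRInt_0oo f v -> is_CRInt_0oo (fun x => a * f x)%C (a * v)%C.
Proof. exact (is_RInt_gen_Cmult _ _ a f v). Qed.

Lemma is_CRInt_0oo_ext (f g : R -> C) (v : C) :
  (forall x, 0 < x -> f x = g x) -> is_CRInt_0oo f v -> is_CRInt_0oo g v.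
Proof.
  intros H H0. refine (is_RInt_gen_ext (V := C_R_NormedModule) f g v _ H0).
  apply (Filter_prod _ _ _ (fun a => 0 < a) (fun b => 0 < b)).
  - exists (mkposreal 1 Rlt_0_1). intros y _ Hy. exact Hy.
  - exists 0. intros y Hy. exact Hy.
  - intros p q Hp Hq x [Hx _]. apply H. simpl in Hx.
    eapply Rlt_trans; [|exact Hx]. now apply Rmin_pos.
Qed.

Lemma is_CRInt_0oo_unique (f : R -> C) (v w : C) :
  is_CRInt_0oo f v -> is_CRInt_0oo f w -> v = w.
Proof. intros H1 H2. now rewrite <- (CRInt_0oo_eq f v H1), <- (CRInt_0oo_eq f w H2). Qed.

Lemma is_CRInt_0oo_0 : is_CRInt_0oo (fun _ => RtoC 0) 0.
Proof.
  intros P HP. unfold filtermapi.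
  apply filter_forall. intros [p q]. exists (RtoC 0). split.
  - pose proof (is_CRInt_const 0 p q) as H.
    now replace (RtoC (q - p) * 0)%C with (RtoC 0) in H by ring.
  - destruct HP as [d Hd]. apply Hd. apply (ball_center (M := C_UniformSpace)).
Qed.

Lemma is_CRInt_0oo_Csumn (f : nat -> R -> C) (v : nat -> C) (n : nat) :
  (forall i, (i < n)%nat -> is_CRInt_0oo (f i) (v i)) ->
  is_CRInt_0oo (fun x => Csumn (fun i => f i x) n) (Csumn v n).
Proof.
  induction n as [|n IH]; intros H; simpl; [apply is_CRInt_0oo_0|].
  apply is_CRInt_0oo_plus; [apply IH; intros; apply H; lia|apply H; lia].
Qed.

(** [W] is the inverse transform of [G] through every line of the right half-plane, and [G] gives
    the moments of [W]. Only the integer points [j + 1] are recorded, since biorthogonality tests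
    against monomials. *)
Definition mellin_pair (M : nat) (G : C -> C) (W : R -> C) : Prop :=
  (forall c y, 0 < c -> 0 < y -> vline M (fun s => G s * Cpowr y (- s))%C c (2 * PI * W y)%C) /\
  (forall j, is_CRInt_0oo (fun y => RtoC (y ^ j) * W y)%C (G (RtoC (INR j) + 1)%C)).

Lemma mellin_pair_Csumn (M : nat) (G : nat -> C -> C) (W : nat -> R -> C) (n : nat) :
  (forall i, (i < n)%nat -> mellin_pair M (G i) (W i)) ->
  mellin_pair M (fun s => Csumn (fun i => G i s) n) (fun y => Csumn (fun i => W i y) n).
Proof.
  intros H. split.
  - intros c y Hc Hy. rewrite <- Csumn_mult.
    apply (vline_ext _ (fun s => Csumn (fun i => G i s * Cpowr y (- s)) n)%C).
    + intros u. rewrite Cmult_comm, <- Csumn_mult. apply Csumn_ext. intros; ring.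
    + apply (vline_Csumn M (fun i s => G i s * Cpowr y (- s))%C). intros i Hi.
      now apply H.
  - intros j. apply (is_CRInt_0oo_ext (fun y => Csumn (fun i => RtoC (y ^ j) * W i y) n)%C).
    + intros x _. apply Csumn_mult.
    + apply (is_CRInt_0oo_Csumn (fun i y => RtoC (y ^ j) * W i y)%C). intros i Hi. now apply H.
Qed.

Lemma mellin_pair_scal (M : nat) (a : C) (G : C -> C) (W : R -> C) :
  mellin_pair M G W -> mellin_pair M (fun s => a * G s)%C (fun y => a * W y)%C.
Proof.
  intros [H1 H2]. split.
  - intros c y Hc Hy. replace (2 * PI * (a * W y))%C with (a * (2 * PI * W y))%C by ring.
    apply (vline_ext _ (fun s => a * (G s * Cpowr y (- s)))%C); [intros; ring|].
    apply vline_mult. now apply H1.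
  - intros j. apply (is_CRInt_0oo_ext (fun y => a * (RtoC (y ^ j) * W y))%C); [intros; ring|].
    now apply is_CRInt_0oo_mult.
Qed.

Lemma mellin_pair_ext (M : nat) (G G' : C -> C) (W : R -> C) :
  (forall s, 0 < Re s -> G s = G' s) -> mellin_pair M G W -> mellin_pair M G' W.
Proof.
  intros H [H1 H2]. split.
  - intros c y Hc Hy. apply (vline_ext _ (fun s => G s * Cpowr y (- s))%C).
    + intros u. now rewrite H.
    + now apply H1.
  - intros j. rewrite <- H; [apply H2|].
    rewrite re_plus, !re_RtoC. pose proof (pos_INR j). lra.
Qed.

(** * The case [M = 1]: truncated powers *)

Lemma CRInt_reflect (f : R -> C) (T : R) : (forall u, contC f u) ->
  CRInt (fun u => f (- u)%R) (- T) T = CRInt f (- T) T.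
Proof.
  intros Hf. apply is_CRInt_eq.
  pose proof (CRInt_continuous f (- T) T Hf) as H.
  apply (is_RInt_swap (V := C_R_NormedModule)) in H.
  replace (- T) with (- T + 0)%R in H at 1 by ring.
  pose proof (is_RInt_comp_opp (V := C_R_NormedModule) f (- T) T) as X.
  rewrite Ropp_involutive in X. rewrite Rplus_0_r in H. specialize (X _ H).
  apply (is_CRInt_mult (-1)) in X.
  replace (CRInt f (- T) T) with ((-1) * opp (CRInt f (- T) T))%C.
  - revert X. apply is_CRInt_ext. intros u _. change (-1 * - f (- u)%R = f (- u)%R)%C. ring.
  - change (-1 * - CRInt f (- T) T = CRInt f (- T) T)%C. ring.
Qed.

(** The inverse Mellin transform of [1 / (s + b)]. At the jump [y = 1] the symmetric limit selects
    the mean [1 / 2]. *)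
Definition truncated_power (b : nat) (y : R) : C :=
  if Rlt_dec y 1 then RtoC (y ^ b) else if Req_EM_T y 1 then RtoC (/ 2) else RtoC 0.

(** Perron's formula requires decay to the right. For [y > 1] it applies directly, with the pole
    [- b] to the left of the line, and gives [0]. For [y < 1] the factor [y ^ (- s)] decays to the
    left, so [s] is replaced by [- s]: the line becomes [Re s = - c], with the pole [b] on its
    right. For [y = 1] the integral is an explicit arctangent. *)
Lemma truncated_power_vline (b : nat) (c y : R) : 0 < c -> 0 < y ->
  vline 1 (fun s => / (s + RtoC (INR b)) * Cpowr y (- s))%C c (2 * PI * truncated_power b y)%C.
Proof.
  intros Hc Hy. pose proof (pos_INR b) as Hb.
  assert (Hn : forall u, ((c, u) + RtoC (INR b))%C <> 0).
  { intros u X. apply (f_equal Re) in X. simpl in X. lra. }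
  assert (Hcont : forall u, contC (fun u => / ((c, u) + RtoC (INR b)) * Cpowr y (- (c, u)))%C u).
  { intros u. apply continuous_Cmult.
    - apply continuous_Cinv; [apply Hn|]. apply continuous_Cplus;
        [apply continuous_vline|apply continuous_Cconst].
    - apply continuous_Cexp. apply continuous_Cmult; [|apply continuous_Cconst].
      apply continuous_Copp, continuous_vline. }
  split; [exact Hcont|]. split; [|intros; lia].
  unfold truncated_power. destruct (Rlt_dec y 1) as [Hy1|Hy1]; [|destruct (Req_EM_T y 1) as [->|Hy2]].
  - set (l := (- ln y)%R).
    assert (Hl : 0 < l).
    { unfold l. pose proof (ln_increasing y 1 Hy Hy1). rewrite ln_1 in H. lra. }
    pose proof (perron l (- c) (INR b) Hl ltac:(lra)) as P.
    destruct (Rlt_dec (INR b) (- c)) as [X|_]; [lra|].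
    apply (filterlim_C_mult (-1)) in P.
    replace (2 * PI * RtoC (y ^ b))%C
      with ((-1) * - (2 * PI * Cexp (RtoC (INR b) * RtoC (- l))))%C.
    + revert P. apply filterlim_ext. intros T.
      rewrite <- (CRInt_reflect (fun u => / ((c, u) + RtoC (INR b)) * Cpowr y (- (c, u)))%C)
        by exact Hcont.
      symmetry. apply is_CRInt_eq.
      apply (is_CRInt_ext (fun u => (-1) * (Cexp (((- c)%R, u) * RtoC (- l))
        / (((- c)%R, u) - RtoC (INR b))))%C).
      * intros u _. unfold Cpowr, l.
        replace (- (c, (- u)%R))%C with ((- c)%R, u)
          by (unfold Copp; simpl; f_equal; ring).
        rewrite Ropp_involutive.
        assert (Hx : ((c, (- u)%R) + RtoC (INR b))%C = (- (((- c)%R, u) - RtoC (INR b)))%C)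
          by (unfold Cminus, Cplus, Copp, RtoC; simpl; f_equal; ring).
        assert (Hz : (((- c)%R, u) - RtoC (INR b))%C <> 0).
        { intro X. apply (f_equal Re) in X. simpl in X. lra. }
        rewrite Hx. field. exact Hz.
      * apply is_CRInt_mult. apply CRInt_continuous. intros u. apply continuous_Cdiv.
        -- intro X. apply (f_equal Re) in X. simpl in X. lra.
        -- apply continuous_Cexp. apply continuous_Cmult; [apply continuous_vline|apply continuous_Cconst].
        -- apply continuous_Cminus; [apply continuous_vline|apply continuous_Cconst].
    + rewrite <- (RtoC_mult (INR b)), Cexp_RtoC. unfold l. rewrite Ropp_involutive.
      rewrite <- exp_pow_INR, exp_ln by exact Hy. ring.
  - pose proof (filterlim_atan (c + INR b) ltac:(lra)) as P.
    replace (2 * PI * RtoC (/ 2))%C with (RtoC PI).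
    + revert P. apply filterlim_ext. intros T. symmetry. apply is_CRInt_eq.
      apply (is_CRInt_ext (fun u => / ((c + INR b)%R, u))%C).
      * intros u _. unfold Cpowr. rewrite ln_1.
        replace (- (c, u) * RtoC 0)%C with (RtoC 0) by ring. rewrite Cexp_0, Cmult_1_r.
        f_equal. unfold Cplus, RtoC; simpl. f_equal; ring.
      * apply is_CRInt_inv_vline. lra.
    + rewrite <- !RtoC_mult. f_equal. field.
  - set (l := ln y).
    assert (Hl : 0 < l).
    { unfold l. pose proof (ln_increasing 1 y Rlt_0_1 ltac:(lra)). rewrite ln_1 in H. lra. }
    pose proof (perron l c (- INR b) Hl ltac:(lra)) as P.
    destruct (Rlt_dec (- INR b) c) as [_|X]; [|lra].
    replace (2 * PI * RtoC 0)%C with (RtoC 0) by ring.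
    revert P. apply filterlim_ext. intros T. f_equal. apply functional_extensionality.
    intros u. unfold Cpowr. fold l.
    replace ((c, u) - RtoC (- INR b))%C with ((c, u) + RtoC (INR b))%C by (rewrite RtoC_opp; ring).
    replace (- (c, u) * RtoC l)%C with ((c, u) * RtoC (- l))%C by (rewrite RtoC_opp; ring).
    unfold Cdiv. ring.
Qed.

Lemma truncated_power_moment (b j : nat) :
  is_CRInt_0oo (fun y => RtoC (y ^ j) * truncated_power b y)%C
    (/ (RtoC (INR j) + 1 + RtoC (INR b)))%C.
Proof.
  set (N := S (j + b)).
  assert (HN : 0 < INR N) by (apply lt_0_INR; unfold N; lia).
  assert (EN : (RtoC (INR j) + 1 + RtoC (INR b))%C = RtoC (INR N)).
  { unfold N. rewrite RtoC_S, plus_INR, RtoC_plus. ring. }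
  assert (HNC : RtoC (INR N) <> 0) by (intro X; apply RtoC_inj in X; lra).
  rewrite EN.
  assert (HD : forall m r y, r <> 0 -> is_derive (fun y => y ^ m / r)%R y (INR m * y ^ Nat.pred m / r)).
  { intros m r y Hr. auto_derive; [trivial|]. field. exact Hr. }
  assert (HI : forall p q, 0 < p < 1 -> 1 < q ->
    is_CRInt (fun y => RtoC (y ^ j) * truncated_power b y)%C p q
      (/ RtoC (INR N) - RtoC (p ^ N / INR N))%C).
  { intros p q Hp Hq.
    replace (/ RtoC (INR N) - RtoC (p ^ N / INR N))%C
      with ((RtoC (1 ^ N / INR N) - RtoC (p ^ N / INR N)) + RtoC (q - 1) * 0)%C
      by (rewrite pow1; unfold Rdiv at 1; rewrite Rmult_1_l, RtoC_inv by lra; ring).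
    apply (is_CRInt_Chasles _ p 1 q).
    - apply (is_CRInt_ext (fun y => RtoC (y ^ (j + b)))).
      + rewrite Rmin_left, Rmax_right by lra. intros y Hy. unfold truncated_power.
        destruct (Rlt_dec y 1); [|lra]. now rewrite pow_add, RtoC_mult.
      + apply (is_CRInt_derive (fun y => RtoC (y ^ N / INR N))); intros y _.
        * apply is_Cderive_components; simpl Re; simpl Im; split.
          -- replace (y ^ (j + b))%R with (INR N * y ^ Nat.pred N / INR N)%R
               by (change (Nat.pred N) with (j + b)%nat; field; lra).
             now apply HD, Rgt_not_eq.
          -- apply (is_derive_const (V := R_NormedModule)).
        * apply continuous_RtoC. apply (ex_derive_continuous (V := R_NormedModule)).
          auto_derive. trivial.
    - apply (is_CRInt_ext (fun _ => RtoC 0)); [|apply is_CRInt_const].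
      rewrite Rmin_left, Rmax_right by lra. intros y Hy. unfold truncated_power.
      destruct (Rlt_dec y 1); [lra|]. destruct (Req_EM_T y 1); [lra|]. ring. }
  intros P HP. destruct HP as [d Hd].
  assert (Hd2 : 0 < Rmin 1 d) by (apply Rmin_pos; [lra|apply cond_pos]).
  apply (Filter_prod _ _ _ (fun p => 0 < p < Rmin 1 d) (fun q => 1 < q)).
  - exists (mkposreal _ Hd2). intros p Hp Hp0. split; [exact Hp0|].
    change (Rabs (p - 0) < Rmin 1 d) in Hp. rewrite Rminus_0_r in Hp.
    pose proof (Rle_abs p). lra.
  - exists 1. intros q Hq. exact Hq.
  - intros p q Hp Hq. pose proof (Rmin_l 1 d). pose proof (Rmin_r 1 d).
    exists (/ RtoC (INR N) - RtoC (p ^ N / INR N))%C. split; [apply HI; [lra|exact Hq]|].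
    apply Hd. apply C_ball_Cmod.
    replace (/ RtoC (INR N) - RtoC (p ^ N / INR N) - / RtoC (INR N))%C
      with (- RtoC (p ^ N / INR N))%C by ring.
    rewrite Cmod_opp, Cmod_R.
    assert (H1 : 1 <= INR N) by (unfold N; rewrite S_INR; pose proof (pos_INR (j + b)); lra).
    assert (H2 : 0 <= p ^ N <= p).
    { unfold N. simpl. assert (0 <= p ^ (j + b) <= 1); [|nra]. split.
      - apply pow_le; lra.
      - rewrite <- (pow1 (j + b)). apply pow_incr. lra. }
    assert (H3 : p ^ N / INR N <= p ^ N).
    { rewrite <- (Rdiv_1_r (p ^ N)) at 2. apply Rmult_le_compat_l; [lra|].
      apply Rinv_le_contravar; lra. }
    rewrite Rabs_pos_eq; [lra|]. apply Rmult_le_pos; [lra|]. left. now apply Rinv_0_lt_compat.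
Qed.

Lemma mellin_pair_truncated_power (b : nat) :
  mellin_pair 1 (fun s => / (s + RtoC (INR b)))%C (truncated_power b).
Proof.
  split; [intros; now apply truncated_power_vline|intros; apply truncated_power_moment].
Qed.

(** The transform is rational with distinct simple poles at [- (a + i)], so partial fractions reduce
    it to truncated powers. *)
Lemma slow_mellin (a N : nat) : (1 <= N)%nat ->
  exists W, mellin_pair 1 (fun s => / poch (s + RtoC (INR a)) N)%C W.
Proof.
  intros HN. set (x := fun i => (- RtoC (INR (a + i)))%C).
  assert (Hx : forall i j, (i < N)%nat -> (j < N)%nat -> i <> j -> x i <> x j).
  { intros i j _ _ Hij E. apply Hij. unfold x in E.
    assert (E' : RtoC (INR (a + i)) = RtoC (INR (a + j))).
    { replace (RtoC (INR (a + i))) with (- - RtoC (INR (a + i)))%C by ring. rewrite E. ring. }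
    apply RtoC_inj, INR_eq in E'. lia. }
  exists (fun y => Csumn (fun k => / node_prod x N k (x k) * truncated_power (a + k) y)%C N).
  apply (mellin_pair_ext _ (fun s => Csumn (fun k => / node_prod x N k (x k)
    * / (s + RtoC (INR (a + k)))) N)%C).
  - intros s Hs. replace (poch (s + RtoC (INR a)) N) with (Cprodn (fun i => s - x i)%C N).
    + rewrite (partial_fractions x N Hx s HN).
      * apply Csumn_ext. intros k Hk. unfold x. do 2 f_equal. ring.
      * intros i Hi. apply Cneq_Re. unfold x. rewrite re_opp, re_RtoC.
        pose proof (pos_INR (a + i)). lra.
    + apply Cprodn_ext. intros i _. unfold x. rewrite plus_INR, RtoC_plus. ring.
  - apply (mellin_pair_Csumn 1 (fun k s => / node_prod x N k (x k) * / (s + RtoC (INR (a + k))))%C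
      (fun k y => / node_prod x N k (x k) * truncated_power (a + k) y)%C).
    intros k Hk. apply (mellin_pair_scal 1 (/ node_prod x N k (x k))%C
      (fun s => / (s + RtoC (INR (a + k))))%C).
    apply mellin_pair_truncated_power.
Qed.

(** * Evaluation of [vint] *)

Lemma vline_is_vint (M : nat) (f : C -> C) (c : R) (v : C) :
  vline M f c v -> is_vint M f c (Ci * v)%C.
Proof.
  intros [F1 [F2 F3]]. split.
  - intros P HP. pose proof (filterlim_C_mult Ci _ _ F2 P HP) as H.
    unfold filtermapi, filtermap in *. revert H. apply filter_imp. intros T HT.
    exists (Ci * CRInt (fun u => f (c, u)) (- T) T)%C. split; [|exact HT].
    now apply is_CRInt_mult, CRInt_continuous.
  - intros HM. destruct (F3 HM) as [K HK]. exact (dominated_ex_Cmod _ K HK).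
Qed.

(** [iota] selects this value because symmetric limits are unique. *)
Lemma vline_vint (M : nat) (f : C -> C) (c : R) (v : C) :
  vline M f c v -> vint M f c = (Ci * v)%C.
Proof.
  intros H. apply (iota_unique (V := C_R_CompleteNormedModule)); [|now apply vline_is_vint].
  intros w [Hw _]. destruct H as [F1 [F2 _]].
  apply (filterlim_C_unique (fun T => Ci * CRInt (fun u => f (c, u)) (- T) T)%C);
    [|now apply filterlim_C_mult].
  intros P HP. specialize (Hw P HP). unfold filtermapi, filtermap in *.
  revert Hw. apply filter_imp. intros T [z [Hz HPz]].
  replace (Ci * CRInt (fun u => f (c, u)) (- T) T)%C with z; [exact HPz|].
  apply (is_CRInt_unique _ _ _ _ _ Hz). now apply is_CRInt_mult, CRInt_continuous.
Qed.

(** * Finite linear algebra of biorthogonality *)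

Lemma finite_choice {A : Type} (a0 : A) (n : nat) (Q : nat -> A -> Prop) :
  (forall k, (k < n)%nat -> exists z, Q k z) -> exists f, forall k, (k < n)%nat -> Q k (f k).
Proof.
  induction n as [|n IH]; intros H.
  - exists (fun _ => a0). intros; lia.
  - destruct IH as [f Hf]; [intros; apply H; lia|]. destruct (H n (Nat.lt_succ_diag_r n)) as [z Hz].
    exists (fun k => if Nat.eqb k n then z else f k). intros k Hk.
    destruct (Nat.eqb_spec k n) as [->|Hkn]; [exact Hz|]. apply Hf. lia.
Qed.

Lemma Csumn_add (f : nat -> C) (m n : nat) :
  Csumn f (m + n) = (Csumn f m + Csumn (fun i => f (m + i)%nat) n)%C.
Proof.
  induction n as [|n IH]; simpl.
  - rewrite Nat.add_0_r. ring.
  - rewrite Nat.add_succ_r. simpl. rewrite IH. ring.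
Qed.

Lemma Csumn_0 (n : nat) : Csumn (fun _ => RtoC 0) n = 0.
Proof. induction n as [|n IH]; simpl; [reflexivity|]. rewrite IH. ring. Qed.

Lemma Csumn_zero (f : nat -> C) (n : nat) :
  (forall i, (i < n)%nat -> f i = 0) -> Csumn f n = 0.
Proof. intros H. rewrite (Csumn_ext f (fun _ => RtoC 0) n H). apply Csumn_0. Qed.

(* Coefficients [c i] with [i > k] are replaced by [0] so that all sums run over [i < n]. *)
Definition truncate (k : nat) (c : nat -> C) (i : nat) : C := if Nat.leb i k then c i else RtoC 0.

Lemma truncate_gt (k : nat) (c : nat -> C) (i : nat) : (k < i)%nat -> truncate k c i = 0.
Proof. intros H. unfold truncate. destruct (Nat.leb_spec i k); [lia|reflexivity]. Qed.

Lemma Csumn_truncate (k n : nat) (c f : nat -> C) : (k < n)%nat ->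
  Csumn (fun i => c i * f i)%C (S k) = Csumn (fun i => truncate k c i * f i)%C n.
Proof.
  intros Hk. replace n with (S k + (n - S k))%nat by lia. rewrite Csumn_add.
  rewrite (Csumn_zero (fun i => truncate k c (S k + i)%nat * f (S k + i)%nat)%C).
  - rewrite Cplus_0_r. apply Csumn_ext. intros i Hi. unfold truncate.
    destruct (Nat.leb_spec i k); [reflexivity|lia].
  - intros i _. rewrite truncate_gt by lia. ring.
Qed.

Section Biorthogonality.
Context (n : nat) (A B m : nat -> nat -> C) (X : nat -> C)
  (HA : forall k i, (k < i)%nat -> A k i = 0) (HA1 : forall k, (k < n)%nat -> A k k = 1)
  (HB : forall k i, (k < i)%nat -> B k i = 0)
  (HAm : forall k j, (k < n)%nat -> (j < k)%nat -> Csumn (fun i => A k i * m i j)%C n = 0)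
  (HBm : forall k j, (k < n)%nat -> (j <= k)%nat ->
    Csumn (fun i => B k i * m j i)%C n = RtoC (if Nat.eqb j k then 1 else 0)).

(** In the application [A] and [B] hold the coefficients of the [P_k] in monomials and of the [Q_k]
    in weights, [m j i] is the [j]-th moment of [w_i], and [X j = x ^ j]. Then [mu j k] is the
    [j]-th moment of [Q_k], and [p k] is [P_k (x)]. *)
Let mu (j k : nat) : C := Csumn (fun i => B k i * m j i)%C n.
Let p (k : nat) : C := Csumn (fun i => A k i * X i)%C n.

(** For [r <= k] the moment conditions on [Q_k] decide, as [P_r] has degree at most [k]; for [r > k]
    the orthogonality of [P_r] does, as [Q_k] is spanned by [w_0, ..., w_k]. *)
Lemma biorthogonal (r k : nat) : (r < n)%nat -> (k < n)%nat ->
  Csumn (fun j => A r j * mu j k)%C n = RtoC (if Nat.eqb r k then 1 else 0).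
Proof.
  intros Hr Hk. destruct (Nat.eqb_spec r k) as [->|Hrk].
  - rewrite (Csumn_single _ n k Hk).
    + rewrite HA1 by exact Hk. unfold mu. rewrite HBm, Nat.eqb_refl by lia. ring.
    + intros j Hj Hjk. destruct (le_lt_dec j k) as [L|L].
      * unfold mu. rewrite HBm by lia. destruct (Nat.eqb_spec j k); [contradiction|ring].
      * rewrite HA by exact L. ring.
  - destruct (le_lt_dec r k) as [L|L].
    + apply Csumn_zero. intros j Hj. destruct (le_lt_dec j r) as [L2|L2].
      * unfold mu. rewrite HBm by lia. destruct (Nat.eqb_spec j k); [lia|ring].
      * rewrite HA by exact L2. ring.
    + rewrite (Csumn_ext _ (fun j => Csumn (fun i => A r j * (B k i * m j i)) n)%C)
        by (intros; unfold mu; now rewrite Csumn_mult).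
      rewrite Csumn_exchange. apply Csumn_zero. intros i Hi.
      rewrite (Csumn_ext _ (fun j => B k i * (A r j * m j i))%C) by (intros; ring).
      rewrite Csumn_mult. destruct (le_lt_dec i k) as [L2|L2].
      * rewrite HAm by lia. ring.
      * rewrite HB by exact L2. ring.
Qed.

(** By biorthogonality, [A] maps both the left-hand vector and [X] to [p]. Since [A] is triangular
    with unit diagonal, strong induction on the index separates them. *)
Lemma reproducing (j : nat) : (j < n)%nat -> Csumn (fun k => p k * mu j k)%C n = X j.
Proof.
  set (S := fun j => Csumn (fun k => p k * mu j k)%C n).
  assert (HS : forall r, (r < n)%nat -> Csumn (fun j => A r j * S j)%C n = p r).
  { intros r Hr. unfold S.
    rewrite (Csumn_ext _ (fun j => Csumn (fun k => A r j * (p k * mu j k)) n)%C)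
      by (intros; now rewrite Csumn_mult).
    rewrite Csumn_exchange.
    rewrite (Csumn_ext _ (fun k => p k * RtoC (if Nat.eqb r k then 1 else 0))%C).
    - rewrite (Csumn_single _ n r Hr).
      + rewrite Nat.eqb_refl. ring.
      + intros i Hi Hir. destruct (Nat.eqb_spec r i); [congruence|ring].
    - intros k Hk. rewrite <- (biorthogonal r k Hr Hk), <- Csumn_mult.
      apply Csumn_ext. intros; ring. }
  change ((j < n)%nat -> S j = X j).
  induction j as [j IH] using (well_founded_induction lt_wf). intros Hj.
  pose proof (HS j Hj) as E. unfold p in E.
  assert (Z : Csumn (fun i => A j i * (S i + (-1) * X i))%C n = 0).
  { rewrite (Csumn_ext _ (fun i => A j i * S i + (-1) * (A j i * X i))%C) by (intros; ring).
    rewrite Csumn_plus, Csumn_mult, E. ring. }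
  rewrite (Csumn_single _ n j Hj) in Z.
  - rewrite HA1 in Z by exact Hj.
    replace (S j) with (1 * (S j + (-1) * X j) + X j)%C by ring. rewrite Z. ring.
  - intros i Hi Hij. destruct (le_lt_dec i j) as [L|L].
    + assert (Ei : S i = X i) by (apply IH; lia). rewrite Ei. ring.
    + rewrite HA by exact L. ring.
Qed.

End Biorthogonality.

(** * The weights *)

Definition gamma_prod (nu : nat -> nat) (b m : nat) (s : C) : C :=
  Cprodn (fun i => Gam (s + RtoC (INR (nu (b + i)%nat)))) m.

(** The quotient of the two Gamma factors that depend on [k] has arguments at an integer distance
    [l - 2 n - nu_1 + 1], so it is the reciprocal of a Pochhammer product. For [M = 1] nothing else
    is left. *)
Definition weight_mellin (M n l : nat) (nu : nat -> nat) (k : nat) (s : C) : C :=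
  (gamma_prod nu 2 (M - 1) s
    * / poch (s + RtoC (INR (nu 1%nat + k))) (S (l - 2 * n - nu 1%nat)))%C.

Lemma gamma_prod_neq_0 (nu : nat -> nat) (b m : nat) (s : C) : 0 < Re s -> gamma_prod nu b m s <> 0.
Proof.
  intros Hs. apply Cprodn_neq_0. intros i _. apply Gam_neq_0. rewrite Re_plus_INR.
  pose proof (pos_INR (nu (b + i)%nat)). lra.
Qed.

Lemma w_integrand_eq (M n l : nat) (nu : nat -> nat) (k : nat) (x : R) (s : C) :
  (2 * n + nu 1%nat <= l)%nat -> 0 < Re s ->
  w_integrand M n l nu k x s = (weight_mellin M n l nu k s * Cpowr x (- s))%C.
Proof.
  intros Hl Hs. unfold w_integrand, weight_mellin. f_equal. rewrite Cprod_Cprodn.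
  assert (Hpos : forall m, 0 < Re (s + RtoC (INR m))).
  { intros m. rewrite Re_plus_INR. pose proof (pos_INR m). lra. }
  replace (S M - 2)%nat with (M - 1)%nat by lia.
  replace (Cprodn (fun i => Gamma (s + RtoC (INR (nu (2 + i)%nat)))) (M - 1))
    with (gamma_prod nu 2 (M - 1) s)
    by (apply Cprodn_ext; intros; symmetry; apply Gamma_Gam, Hpos).
  set (N := S (l - 2 * n - nu 1%nat)). set (z := (s + RtoC (INR (nu 1%nat + k)))%C).
  replace (s + INR (nu 1%nat) + INR k)%C with z by (unfold z; rewrite plus_INR, RtoC_plus; ring).
  (* The inequality [l >= 2 n + nu_1] makes the truncated subtraction in [N] exact. *)
  assert (E : INR l = (2 * INR n + INR (nu 1%nat) + INR N - 1)%R).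
  { unfold N. rewrite S_INR, !minus_INR, mult_INR by lia. simpl. ring. }
  replace (s + INR l - 2 * INR n + 1 + INR k)%C with (z + RtoC (INR N))%C.
  - assert (Hz : 0 < Re z) by apply Hpos.
    rewrite !Gamma_Gam, Gam_poch;
      [|exact Hz|rewrite Re_plus_INR; pose proof (pos_INR N); lra|exact Hz].
    field. split; [now apply poch_neq_0|now apply Gam_neq_0].
  - unfold z. rewrite E, !RtoC_minus, !plus_INR, !RtoC_plus, RtoC_mult. ring.
Qed.

Lemma Cmod_poch_inv_le (s1 : R) (z : C) (N : nat) : 0 < s1 -> s1 <= Re z ->
  Cmod (/ poch z N) <= / s1 ^ N.
Proof.
  intros Hs Hz. rewrite Cmod_inv by (apply poch_neq_0; lra).
  apply Rinv_le_contravar; [now apply pow_lt|].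
  induction N as [|N IH]; [unfold poch; simpl; rewrite Cmod_1; lra|].
  unfold poch in *. simpl. rewrite Cmod_mult, Rmult_comm.
  apply Rmult_le_compat; [apply pow_le; lra|lra|exact IH|].
  eapply Rle_trans; [|apply re_le_Cmod]. rewrite Re_plus_INR.
  eapply Rle_trans; [|apply Rle_abs]. pose proof (pos_INR N). lra.
Qed.

(** The factor with [nu_2] alone supplies the decay; the remaining Gamma factors and the reciprocal
    Pochhammer product only need to be bounded on strips. *)
Lemma weight_mellin_fast_decay (M n l : nat) (nu : nat -> nat) (k : nat) :
  (2 <= M)%nat -> fast_decay (weight_mellin M n l nu k).
Proof.
  intros HM. unfold weight_mellin. set (N := S (l - 2 * n - nu 1%nat)). split.
  - apply hol_mult.
    + apply (hol_Cprodn 0 (fun i s => Gam (s + RtoC (INR (nu (2 + i)%nat))))).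
      intros i _. apply hol_Gam_shift. pose proof (pos_INR (nu (2 + i)%nat)). lra.
    + apply hol_inv_pos.
      * intros s1 B Hs. exists (s1 ^ N)%R. split; [now apply pow_lt|]. intros z [Hz _].
        assert (Hz' : s1 <= Re (z + RtoC (INR (nu 1%nat + k)))).
        { rewrite Re_plus_INR. pose proof (pos_INR (nu 1%nat + k)). lra. }
        pose proof (Cmod_poch_inv_le s1 _ N Hs Hz') as H.
        assert (H0 : poch (z + RtoC (INR (nu 1%nat + k))) N <> 0) by (apply poch_neq_0; lra).
        rewrite Cmod_inv in H by exact H0.
        apply Rinv_le_contravar in H; [|apply Rinv_0_lt_compat; now apply Cmod_gt_0].
        now rewrite !Rinv_inv in H.
      * apply (hol_Cprodn 0 (fun i s => s + RtoC (INR (nu 1%nat + k)) + RtoC (INR i))%C).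
        intros i _. eexists. apply holo_plus; [|apply holo_const].
        apply holo_plus; [apply holo_id|apply holo_const].
  - intros s1 s2 Hs.
    destruct (Gam_decay (s1 + INR (nu 2%nat)) (s2 + INR (nu 2%nat))) as [K0 [HK0 HD]].
    { pose proof (pos_INR (nu 2%nat)). lra. }
    assert (HB : forall m, exists K, 0 <= K /\ forall p u, s1 <= p <= s2 ->
      Cmod (gamma_prod nu 3 m (p, u)) <= K).
    { induction m as [|m [K [HK IH]]].
      - exists 1. split; [lra|]. intros. unfold gamma_prod; simpl. rewrite Cmod_1. lra.
      - destruct (Gam_bounded (s1 + INR (nu (3 + m)%nat)) (s2 + INR (nu (3 + m)%nat)))
          as [L [HL0 HL]].
        { pose proof (pos_INR (nu (3 + m)%nat)). lra. }
        exists (K * L)%R. split; [now apply Rmult_le_pos|]. intros p u Hp.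
        unfold gamma_prod in *; simpl Cprodn. rewrite Cmod_mult.
        apply Rmult_le_compat; try apply Cmod_ge_0; [now apply IH|].
        apply HL. rewrite Re_plus_INR. unfold Re; simpl. lra. }
    destruct (HB (M - 2)%nat) as [K1 [HK1 HB1]].
    assert (HsN : 0 < / s1 ^ N) by (apply Rinv_0_lt_compat; now apply pow_lt).
    exists (K0 * K1 * / s1 ^ N)%R. split; [repeat apply Rmult_le_pos; lra|]. intros p u Hp.
    replace (M - 1)%nat with (1 + (M - 2))%nat by lia.
    assert (E : gamma_prod nu 2 (1 + (M - 2)) (p, u)
      = (Gam ((p + INR (nu 2%nat))%R, u) * gamma_prod nu 3 (M - 2) (p, u))%C).
    { unfold gamma_prod. rewrite Cprodn_add. simpl Cprodn. rewrite Cmult_1_l. f_equal.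
      unfold Cplus, RtoC; simpl. do 2 f_equal. ring. }
    rewrite E, !Cmod_mult.
    replace (K0 * K1 * / s1 ^ N / (1 + u ^ 2) ^ 2)%R
      with (K0 / (1 + u ^ 2) ^ 2 * K1 * / s1 ^ N)%R
      by (unfold Rdiv; ring).
    apply Rmult_le_compat; try apply Cmod_ge_0.
    + apply Rmult_le_pos; apply Cmod_ge_0.
    + apply Rmult_le_compat; try apply Cmod_ge_0; [apply HD; lra|now apply HB1].
    + apply Cmod_poch_inv_le; [exact Hs|]. rewrite Re_plus_INR. unfold Re; simpl.
      pose proof (pos_INR (nu 1%nat + k)). lra.
Qed.

Lemma weight_mellin_pair (M n l : nat) (nu : nat -> nat) (k : nat) :
  (1 <= M)%nat -> exists W, mellin_pair M (weight_mellin M n l nu k) W.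
Proof.
  intros HM. destruct (Nat.eq_dec M 1) as [->|HM1].
  - destruct (slow_mellin (nu 1%nat + k) (S (l - 2 * n - nu 1%nat)) ltac:(lia)) as [W HW].
    exists W. revert HW. apply mellin_pair_ext. intros s _. unfold weight_mellin, gamma_prod.
    simpl Cprodn. ring.
  - destruct (fast_mellin _ (weight_mellin_fast_decay M n l nu k ltac:(lia))) as [W HW].
    exists W. apply HW.
Qed.

Lemma weight_eq (M n l : nat) (nu : nat -> nat) (c : R) (k : nat) (W : R -> C) (x : R) :
  (2 * n + nu 1%nat <= l)%nat -> 0 < c -> 0 < x ->
  mellin_pair M (weight_mellin M n l nu k) W -> w M n l nu c k x = W x.
Proof.
  intros Hl Hc Hx [HW _]. unfold w.
  rewrite (vline_vint M _ c (2 * PI * W x)%C).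
  - unfold twopii. field. split.
    + intro E. apply (f_equal Im) in E. simpl in E. lra.
    + pose proof PI_RGT_0. intro E. apply RtoC_inj in E. lra.
  - apply (vline_ext _ (fun s => weight_mellin M n l nu k s * Cpowr x (- s))%C).
    + intros u. symmetry. apply w_integrand_eq; [exact Hl|exact Hc].
    + now apply HW.
Qed.

(** * The reproducing kernel *)

(** The second clause says that the [j]-th moment of [K_n (x, .)] is [x ^ j]. It follows from the
    given relations alone, once uniqueness of improper integrals has turned them into identities
    between coefficients and moments. *)
Lemma kernel_reproducing (M n l : nat) (nu : nat -> nat) (c : R) (P Q : nat -> R -> C)
    (W : nat -> R -> C) (x : R) :
  (1 <= n)%nat -> (2 * n + nu 1%nat <= l)%nat -> 0 < c ->
  (forall k, (k < n)%nat -> mellin_pair M (weight_mellin M n l nu k) (W k)) ->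
  (forall k, (k < n)%nat -> is_Pk (w M n l nu c) k (P k)) ->
  (forall k, (k < n)%nat -> is_Qk (w M n l nu c) k (Q k)) ->
  exists beta : nat -> C,
    (forall y, 0 < y -> kernel n P Q x y = Csumn (fun i => beta i * W i y)%C n) /\
    (forall j, (j < n)%nat -> Csumn (fun i => beta i
       * weight_mellin M n l nu i (RtoC (INR j) + 1))%C n = RtoC (x ^ j)).
Proof.
  intros Hn Hl Hc HW HP HQ.
  assert (Ew : forall k y, (k < n)%nat -> 0 < y -> w M n l nu c k y = W k y).
  { intros k y Hk Hy. apply weight_eq; auto. }
  set (m := fun j i => weight_mellin M n l nu i (RtoC (INR j) + 1)%C).
  destruct (finite_choice (fun _ => RtoC 0) n (fun k (a : nat -> C) => a k = RtoC 1 /\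
    forall x, P k x = sum_n (fun i => a i * RtoC (x ^ i))%C k)) as [a Ha].
  { intros k Hk. apply (HP k Hk). }
  destruct (finite_choice (fun _ => RtoC 0) n (fun k (b : nat -> C) =>
    forall x, 0 < x -> Q k x = sum_n (fun i => b i * w M n l nu c i x)%C k)) as [b Hb].
  { intros k Hk. apply (HQ k Hk). }
  set (A := fun k => truncate k (a k)). set (B := fun k => truncate k (b k)).
  assert (EP : forall k y, (k < n)%nat -> P k y = Csumn (fun i => A k i * RtoC (y ^ i))%C n).
  { intros k y Hk. destruct (Ha k Hk) as [_ E]. rewrite E. unfold A.
    rewrite <- (Csumn_truncate k n (a k) (fun i => RtoC (y ^ i)) Hk).
    apply (sum_n_Csumn (fun i => a k i * RtoC (y ^ i))%C). }
  assert (EQ : forall k y, (k < n)%nat -> 0 < y -> Q k y = Csumn (fun i => B k i * W i y)%C n).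
  { intros k y Hk Hy. rewrite (Hb k Hk y Hy). unfold B.
    rewrite <- (Csumn_truncate k n (b k) (fun i => W i y) Hk).
    etransitivity; [apply (sum_n_Csumn (fun i => b k i * w M n l nu c i y)%C)|].
    apply Csumn_ext. intros i Hi. now rewrite Ew by (lia || exact Hy). }
  assert (HAm : forall k j, (k < n)%nat -> (j < k)%nat -> Csumn (fun i => A k i * m i j)%C n = 0).
  { intros k j Hk Hj. apply (is_CRInt_0oo_unique (fun y => P k y * w M n l nu c j y)%C);
      [|now apply (HP k Hk)].
    apply (is_CRInt_0oo_ext (fun y => Csumn (fun i => A k i * (RtoC (y ^ i) * W j y)) n)%C).
    - intros y Hy. rewrite EP, Ew, Cmult_comm, <- Csumn_mult by (assumption || lia).
      apply Csumn_ext. intros; ring.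
    - apply (is_CRInt_0oo_Csumn (fun i y => A k i * (RtoC (y ^ i) * W j y))%C).
      intros i _. apply is_CRInt_0oo_mult. apply (HW j). lia. }
  assert (HBm : forall k j, (k < n)%nat -> (j <= k)%nat ->
    Csumn (fun i => B k i * m j i)%C n = RtoC (if Nat.eqb j k then 1 else 0)).
  { intros k j Hk Hj. apply (is_CRInt_0oo_unique (fun y => RtoC (y ^ j) * Q k y)%C);
      [|now apply (HQ k Hk)].
    apply (is_CRInt_0oo_ext (fun y => Csumn (fun i => B k i * (RtoC (y ^ j) * W i y)) n)%C).
    - intros y Hy. rewrite EQ, <- Csumn_mult by assumption. apply Csumn_ext. intros; ring.
    - apply (is_CRInt_0oo_Csumn (fun i y => B k i * (RtoC (y ^ j) * W i y))%C).
      intros i Hi. apply is_CRInt_0oo_mult. now apply (HW i). }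
  set (X := fun j => RtoC (x ^ j)).
  (* The coefficient of [w_i] in the sum of the [P_k (x) Q_k]. *)
  exists (fun i => Csumn (fun k => Csumn (fun i => A k i * X i) n * B k i) n)%C. split.
  - intros y Hy. unfold kernel.
    etransitivity; [apply (sum_n_Csumn (fun k => P k x * Q k y)%C)|].
    replace (S (n - 1)) with n by lia.
    rewrite (Csumn_ext (fun k => P k x * Q k y)%C
      (fun k => Csumn (fun i => Csumn (fun i => A k i * X i) n * B k i * W i y) n)%C).
    + rewrite Csumn_exchange. apply Csumn_ext. intros i _.
      rewrite (Cmult_comm (Csumn _ n)), <- Csumn_mult. apply Csumn_ext. intros; ring.
    + intros k Hk. rewrite EP, EQ, <- Csumn_mult by assumption.
      apply Csumn_ext. intros; unfold X; ring.
  - intros j Hj. fold (X j).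
    rewrite <- (reproducing n A B m X) with (j := j); try assumption.
    + rewrite (Csumn_ext _ (fun i => Csumn (fun k =>
        Csumn (fun i => A k i * X i) n * (B k i * m j i)) n)%C).
      * rewrite Csumn_exchange. apply Csumn_ext. intros k _. now rewrite Csumn_mult.
      * intros i _. rewrite Cmult_comm, <- Csumn_mult. apply Csumn_ext. intros; unfold m; ring.
    + intros k i Hki. now apply truncate_gt.
    + intros k Hk. unfold A, truncate. rewrite Nat.leb_refl. now apply Ha.
    + intros k i Hki. now apply truncate_gt.
Qed.

(** * Residues of the kernel integrand *)

Lemma is_contour_Csumn (g : R -> C) (a b : R) (f : nat -> C -> C) (v : nat -> C) (n : nat) :
  (forall i, (i < n)%nat -> is_contour g a b (f i) (v i)) ->
  is_contour g a b (fun t => Csumn (fun i => f i t) n) (Csumn v n).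
Proof.
  unfold is_contour. induction n as [|n IH]; intros H; simpl.
  - pose proof (is_CRInt_const 0 a b) as X. replace (RtoC (b - a) * 0)%C with (RtoC 0) in X by ring.
    revert X. apply is_CRInt_ext. intros; ring.
  - apply (is_CRInt_ext (fun u => Csumn (fun i => f i (g u)) n * path_derive g u
      + f n (g u) * path_derive g u)%C); [intros; ring|].
    apply is_CRInt_plus; [apply IH; intros; apply H; lia|apply H; lia].
Qed.

Lemma is_contour_mult (g : R -> C) (a b : R) (c : C) (f : C -> C) (v : C) :
  is_contour g a b f v -> is_contour g a b (fun t => c * f t)%C (c * v)%C.
Proof.
  intros H. apply (is_CRInt_ext (fun u => c * (f (g u) * path_derive g u))%C); [intros; ring|].
  now apply is_CRInt_mult.
Qed.

(** Matches the [y ^ (- s - 1)] of the kernel with the [y ^ (- s)] of the weights. *)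
Lemma vline_shift (M : nat) (f : C -> C) (c : R) (v : C) :
  vline M f (c + 1) v -> vline M (fun s => f (s + 1)%C) c v.
Proof.
  assert (E : forall u, f ((c, u) + 1)%C = f ((c + 1)%R, u)).
  { intros u. f_equal. unfold Cplus, RtoC; simpl. f_equal. ring. }
  intros [H1 H2]. split.
  - intros u. apply (continuous_ext (fun u => f ((c + 1)%R, u))); [|apply H1].
    intros t. symmetry. apply E.
  - rewrite (functional_extensionality (fun u => f ((c, u) + 1)%C) (fun u => f ((c + 1)%R, u)) E).
    exact H2.
Qed.

Section KernelIntegrand.
Context (M n l : nat) (nu : nat -> nat) (x y : R)
  (HM : (1 <= M)%nat) (Hn : (1 <= n)%nat) (Hnu0 : nu 0%nat = 0%nat)
  (Hl : (2 * n + nu 1%nat <= l)%nat) (Hx : 0 < x).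

(** The poles [0, ..., n - 1] in reversed order, so that the [i]-th factor of the Pochhammer product
    of length [n] at [z + 1 - n] is [z - node i]. *)
Let node (i : nat) : C := RtoC (INR (n - 1 - i)).
Let L : nat := (l - n)%nat.

Lemma node_distinct (i j : nat) : (i < n)%nat -> (j < n)%nat -> i <> j -> node i <> node j.
Proof. intros Hi Hj Hij E. apply RtoC_inj, INR_eq in E. lia. Qed.

Lemma Gamma_node (z : C) : - 1 < Re z -> (forall i, (i < n)%nat -> z <> node i) ->
  Gamma (z + 1 - INR n) = (Gam (z + 1) / Cprodn (fun i => z - node i) n)%C.
Proof.
  intros Hz Hne.
  assert (E : forall i, (i < n)%nat -> (z + 1 - INR n + RtoC (INR i))%C = (z - node i)%C).
  { intros i Hi. unfold node. rewrite !minus_INR by lia. rewrite !RtoC_minus. simpl. ring. }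
  rewrite (Gamma_shifted _ n).
  - replace (z + 1 - INR n + INR n)%C with (z + 1)%C by ring. f_equal. f_equal.
    apply Cprodn_ext. exact E.
  - unfold Cminus. rewrite !re_plus, re_opp, !re_RtoC. lra.
  - intros i Hi. rewrite E by exact Hi. now apply Csub_neq_0, Hne.
Qed.

(* The integrand with the poles at [0, ..., n - 1] and the factors depending on
   [s] only taken out. *)
Definition regular_part (s t : C) : C :=
  (Cpowr x t * (Gam (t + RtoC (INR (S L)))
    * (Cprodn (fun i => / Gam (t + RtoC (1 + INR (nu (1 + i)%nat)))) M * ((-1) * / (t + - s)))))%C.

(** The pole [t = s] does not lie in the half-plane [Re t > - 1 / 2] that contains the contour.
    Writing [1 / (s - t)] as [(-1) * / (t + - s)] makes it an instance of [hol_linear_inv]. *)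
Lemma hol_regular_part (s : C) : Re s <= - / 2 -> hol (- / 2) (regular_part s).
Proof.
  intros Hs. unfold regular_part. apply hol_mult; [apply hol_Cpowr|].
  apply hol_mult.
  { apply hol_Gam_shift. rewrite S_INR. pose proof (pos_INR L). lra. }
  apply hol_mult.
  - apply (hol_Cprodn _ (fun i t => / Gam (t + RtoC (1 + INR (nu (1 + i)%nat))))%C).
    intros i _. apply hol_Gam_shift_inv. pose proof (pos_INR (nu (1 + i)%nat)). lra.
  - apply hol_mult; [apply hol_const|]. apply hol_linear_inv. rewrite re_opp. lra.
Qed.

Definition s_factor (s : C) : C :=
  (Cprodn (fun i => s - node i) n
    * (gamma_prod nu 1 M (s + 1) / Gam (s + 1 + RtoC (INR L))) * Cpowr y (- s - 1))%C.

(** As [nu_0 = 0], the factor [j = 0] is [Gamma (s + 1) / Gamma (t + 1)]. Against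
    [Gamma (t + 1 - n) / Gamma (s + 1 - n)] it leaves the product of the [s - node i] over that of
    the [t - node i], and the latter is expanded in partial fractions. *)
Lemma kernel_integrand_eq (s t : C) : Re s = - / 2 -> - / 2 < Re t ->
  (forall i, (i < n)%nat -> t <> node i) ->
  kernel_integrand M n l nu x y s t
  = (s_factor s * Csumn (fun k => / node_prod node n k (node k)
       * (regular_part s t / (t - node k))) n)%C.
Proof.
  intros Hs Ht Hne.
  assert (Hsn : forall i, (i < n)%nat -> s <> node i).
  { intros i _. apply Cneq_Re. unfold node. rewrite re_RtoC. pose proof (pos_INR (n - 1 - i)). lra. }
  assert (Hst : (s - t)%C <> 0) by (apply Csub_neq_0, Cneq_Re; lra).
  assert (Hpos : forall z a, - / 2 <= Re z -> 0 < a -> / 2 < a -> 0 < Re (z + RtoC a)).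
  { intros z a H1 H2 H3. rewrite re_plus, re_RtoC. lra. }
  assert (G1 : forall z m, - / 2 <= Re z ->
    Gamma (z + 1 + INR m) = Gam (z + RtoC (1 + INR m))).
  { intros z m Hz. rewrite RtoC_plus, Cplus_assoc. apply Gamma_Gam.
    rewrite <- Cplus_assoc, <- RtoC_plus. pose proof (pos_INR m). apply Hpos; lra. }
  assert (N1 : forall z m, - / 2 <= Re z -> Gam (z + RtoC (1 + INR m)) <> 0).
  { intros z m Hz. pose proof (pos_INR m). apply Gam_neq_0, Hpos; lra. }
  unfold kernel_integrand. rewrite Cprod_Cprodn.
  replace (S M - 0)%nat with (1 + M)%nat by lia. rewrite Cprodn_add.
  replace (Cprodn (fun i => Gamma (s + 1 + INR (nu (0 + (1 + i))%nat))
      / Gamma (t + 1 + INR (nu (0 + (1 + i))%nat)))%C M)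
    with (gamma_prod nu 1 M (s + 1)
      * Cprodn (fun i => / Gam (t + RtoC (1 + INR (nu (1 + i)%nat)))) M)%C.
  2: { unfold gamma_prod. rewrite <- Cprodn_mult. apply Cprodn_ext. intros i _.
       rewrite !G1 by lra.
       replace (s + 1 + RtoC (INR (nu (1 + i)%nat)))%C
         with (s + RtoC (1 + INR (nu (1 + i)%nat)))%C by (rewrite RtoC_plus; ring).
       reflexivity. }
  simpl (Cprodn _ 1). rewrite Hnu0. rewrite !G1 by lra. simpl (INR 0).
  rewrite Rplus_0_r.
  rewrite (Gamma_node s), (Gamma_node t) by (lra || assumption).
  assert (EL : forall z, - / 2 <= Re z ->
    Gamma (z + INR l - INR n + 1) = Gam (z + RtoC (INR (S L)))).
  { intros z Hz. replace (z + INR l - INR n + 1)%C with (z + RtoC (INR (S L)))%C.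
    - apply Gamma_Gam. rewrite S_INR. pose proof (pos_INR L). apply Hpos; lra.
    - unfold L. rewrite RtoC_S, minus_INR, RtoC_minus by lia. ring. }
  rewrite !EL by lra.
  assert (Pt : Cprodn (fun i => t - node i)%C n <> 0)
    by (apply Cprodn_neq_0; intros; now apply Csub_neq_0, Hne).
  assert (Ps : Cprodn (fun i => s - node i)%C n <> 0)
    by (apply Cprodn_neq_0; intros; now apply Csub_neq_0, Hsn).
  assert (E1 : Csumn (fun k => / node_prod node n k (node k)
       * (regular_part s t / (t - node k)))%C n
    = (regular_part s t * / Cprodn (fun i => t - node i) n)%C).
  { rewrite (partial_fractions node n node_distinct t Hn Hne), <- Csumn_mult.
    apply Csumn_ext. intros k _. unfold Cdiv. ring. }
  rewrite E1. unfold s_factor, regular_part.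
  replace (s + 1 + RtoC (INR L))%C with (s + RtoC (INR (S L)))%C by (rewrite RtoC_S; ring).
  replace ((-1) * / (t + - s))%C with (/ (s - t))%C.
  - pose proof (N1 s 0%nat ltac:(lra)) as Z1. pose proof (N1 t 0%nat ltac:(lra)) as Z2.
    simpl (INR 0) in Z1, Z2. rewrite Rplus_0_r in Z1, Z2.
    assert (Z3 : Gam (s + RtoC (INR (S L))) <> 0).
    { rewrite S_INR, Rplus_comm. apply N1. lra. }
    field. repeat split; assumption.
  - assert (Hts : (t + - s)%C <> 0).
    { intro E. apply Hst. replace (s - t)%C with (- (t + - s))%C by ring. rewrite E. ring. }
    replace (s - t)%C with (- (t + - s))%C by ring. field. exact Hts.
Qed.

(** The contour avoids the encircled nodes, so the decomposition holds at each of its points, and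
    every summand has a single simple pole. *)
Lemma contour_kernel_integrand (g : R -> C) (a b : R) (s : C) :
  closed_contour g a b -> (forall j, (j <= n)%nat -> encircles_once g a b (RtoC (INR j))) ->
  (forall u, a <= u <= b -> - / 2 < Re (g u)) -> Re s = - / 2 ->
  contour_int g a b (fun t => kernel_integrand M n l nu x y s t)
  = (s_factor s * Csumn (fun k => / node_prod node n k (node k)
       * (twopii * regular_part s (node k))) n)%C.
Proof.
  intros Hg Henc HRe Hs. apply is_CRInt_eq.
  assert (H : is_contour g a b (fun t => s_factor s * Csumn (fun k =>
      / node_prod node n k (node k) * (regular_part s t / (t - node k))) n)%C
    (s_factor s * Csumn (fun k => / node_prod node n k (node k)
       * (twopii * regular_part s (node k))) n)%C).
  { apply is_contour_mult.
    apply (is_contour_Csumn g a b (fun k t => / node_prod node n k (node k)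
      * (regular_part s t / (t - node k)))%C).
    intros k Hk. apply is_contour_mult.
    destruct (hol_regular_part s ltac:(lra)) as [R' HR].
    apply (residue_simple_pole g a b (- / 2) (regular_part s) R'); try assumption.
    - unfold node. rewrite re_RtoC. pose proof (pos_INR (n - 1 - k)). lra.
    - apply Henc. lia. }
  revert H. apply is_CRInt_ext. intros u Hu.
  rewrite Rmin_left, Rmax_right in Hu by (destruct Hg; lra).
  rewrite <- kernel_integrand_eq; [reflexivity|exact Hs|apply HRe; lra|].
  intros i Hi. destruct (Henc (n - 1 - i)%nat ltac:(lia)) as [Hoff _]. apply Hoff. lra.
Qed.

Let N1 : nat := S (l - 2 * n - nu 1%nat).

(** With [z = s + 1 + nu_1], these are the factors that complete the Pochhammer product of length
    [N1] at [z + i] to the one of length [N1 + n - 1] at [z]: [i] factors before it and [n - 1 - i]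
    after it. *)
Definition basis_poly (i : nat) (s : C) : C :=
  (poch (s + 1 + RtoC (INR (nu 1%nat))) i
    * poch (s + 1 + RtoC (INR (nu 1%nat)) + RtoC (INR (i + N1))) (n - 1 - i))%C.

Lemma is_poly_basis (i : nat) : (i < n)%nat -> is_poly (n - 1) (basis_poly i).
Proof.
  intros Hi.
  set (a := fun r => (1 + RtoC (INR (nu 1%nat))
    + RtoC (if Nat.ltb r i then INR r else INR (N1 + r)))%C).
  apply (is_poly_ext _ (fun s => Cprodn (fun r => s + a r) (i + (n - 1 - i)))%C).
  - intros s. rewrite Cprodn_add. unfold basis_poly, poch. f_equal; apply Cprodn_ext; intros r Hr;
      unfold a.
    + destruct (Nat.ltb_spec r i); [ring|lia].
    + destruct (Nat.ltb_spec (i + r) i); [lia|]. rewrite !plus_INR, !RtoC_plus. ring.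
  - replace (i + (n - 1 - i))%nat with (n - 1)%nat by lia. apply is_poly_Cprodn.
Qed.

(** The full product runs from [z] up to [z + N1 + n - 1 = s + 1 + l - n], the same end for all [i];
    hence the common quotient [Gam z / Gam (s + 1 + L)]. *)
Lemma weight_mellin_basis (i : nat) (s : C) : (i < n)%nat -> 0 < Re (s + 1) ->
  weight_mellin M n l nu i (s + 1)
  = (gamma_prod nu 1 M (s + 1) / Gam (s + 1 + RtoC (INR L)) * basis_poly i s)%C.
Proof.
  intros Hi Hs. unfold weight_mellin, basis_poly. fold N1.
  set (z := (s + 1 + RtoC (INR (nu 1%nat)))%C).
  assert (Hz : 0 < Re z) by (unfold z; rewrite Re_plus_INR; pose proof (pos_INR (nu 1%nat)); lra).
  replace (s + 1 + RtoC (INR L))%C with (z + RtoC (INR (i + N1 + (n - 1 - i))))%C.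
  2: { unfold z. rewrite <- Cplus_assoc, <- RtoC_plus, <- plus_INR. do 4 f_equal. unfold N1, L. lia. }
  rewrite Gam_poch by exact Hz. rewrite !poch_add.
  replace (s + 1 + RtoC (INR (nu 1%nat + i)))%C with (z + RtoC (INR i))%C
    by (unfold z; rewrite plus_INR, RtoC_plus; ring).
  replace (gamma_prod nu 1 M (s + 1)) with (Gam z * gamma_prod nu 2 (M - 1) (s + 1))%C.
  2: { unfold gamma_prod. replace M with (1 + (M - 1))%nat at 2 by lia. rewrite Cprodn_add.
       simpl (Cprodn _ 1). rewrite Cmult_1_l. reflexivity. }
  assert (Hzi : forall m, 0 < Re (z + RtoC (INR m))).
  { intros m. rewrite Re_plus_INR. pose proof (pos_INR m). lra. }
  field. repeat split; try (now apply Gam_neq_0); now apply poch_neq_0.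
Qed.

Lemma regular_part_node (s : C) (j : nat) : Re s = - / 2 ->
  regular_part s (RtoC (INR j))
  = (RtoC (x ^ j) * (Gam (RtoC (INR j) + 1 + RtoC (INR L))
     / gamma_prod nu 1 M (RtoC (INR j) + 1)) / (s - RtoC (INR j)))%C.
Proof.
  intros Hs. unfold regular_part. pose proof (pos_INR j) as Hj.
  assert (Hsj : (s - RtoC (INR j))%C <> 0) by (apply Csub_neq_0, Cneq_Re; rewrite re_RtoC; lra).
  replace (Cpowr x (RtoC (INR j))) with (RtoC (x ^ j)).
  2: { unfold Cpowr. rewrite <- RtoC_mult, Cexp_RtoC. f_equal.
       now rewrite <- exp_pow_INR, exp_ln. }
  replace (RtoC (INR j) + RtoC (INR (S L)))%C with (RtoC (INR j) + 1 + RtoC (INR L))%C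
    by (rewrite RtoC_S; ring).
  assert (Hp : 0 < Re (RtoC (INR j) + 1)) by (rewrite re_plus, !re_RtoC; lra).
  replace (Cprodn (fun i => / Gam (RtoC (INR j) + RtoC (1 + INR (nu (1 + i)%nat))))%C M)
    with (/ gamma_prod nu 1 M (RtoC (INR j) + 1))%C.
  - pose proof (gamma_prod_neq_0 nu 1 M _ Hp) as Hg.
    replace (RtoC (INR j) + - s)%C with (- (s - RtoC (INR j)))%C by ring.
    field. split; assumption.
  - unfold gamma_prod. rewrite <- Cprodn_inv.
    + apply Cprodn_ext. intros i _. do 2 f_equal. rewrite RtoC_plus. ring.
    + intros i _. apply Gam_neq_0. rewrite Re_plus_INR. pose proof (pos_INR (nu (1 + i)%nat)). lra.
Qed.

Lemma contour_value (beta : nat -> C) (s : C) : Re s = - / 2 ->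
  (forall j, (j < n)%nat -> Csumn (fun i => beta i
     * weight_mellin M n l nu i (RtoC (INR j) + 1))%C n = RtoC (x ^ j)) ->
  (s_factor s * Csumn (fun k => / node_prod node n k (node k)
     * (twopii * regular_part s (node k))) n)%C
  = (twopii * Csumn (fun i => beta i
       * (weight_mellin M n l nu i (s + 1) * Cpowr y (- (s + 1)))) n)%C.
Proof.
  intros Hs Hbeta.
  set (rho := fun s => (gamma_prod nu 1 M (s + 1) / Gam (s + 1 + RtoC (INR L)))%C).
  set (p := fun s => Csumn (fun i => beta i * basis_poly i s)%C n).
  assert (Hs1 : 0 < Re (s + 1)) by (rewrite re_plus, re_RtoC; lra).
  assert (Hpoly : is_poly (n - 1) p).
  { apply (is_poly_Csumn (n - 1) n (fun i s => beta i * basis_poly i s)%C).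
    intros i Hi. now apply is_poly_scal, is_poly_basis. }
  (* At a node [j] the regular part is [x ^ j / (rho j (s - j))], and the moment condition reads
     [x ^ j = rho j * p j]; the factor [rho j] cancels. *)
  assert (Hval : forall k, (k < n)%nat ->
    regular_part s (node k) = (p (node k) / (s - node k))%C).
  { intros k Hk. unfold node. set (j := (n - 1 - k)%nat). assert (Hj : (j < n)%nat) by (unfold j; lia).
    rewrite regular_part_node by exact Hs. rewrite <- (Hbeta j Hj).
    pose proof (pos_INR j) as Hj0.
    assert (Hp : 0 < Re (RtoC (INR j) + 1)) by (rewrite re_plus, !re_RtoC; lra).
    rewrite (Csumn_ext _ (fun i => rho (RtoC (INR j)) * (beta i * basis_poly i (RtoC (INR j))))%C).
    - rewrite Csumn_mult. fold (p (RtoC (INR j))). unfold rho.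
      assert (Z1 : gamma_prod nu 1 M (RtoC (INR j) + 1) <> 0) by now apply gamma_prod_neq_0.
      assert (Z2 : Gam (RtoC (INR j) + 1 + RtoC (INR L)) <> 0).
      { apply Gam_neq_0. rewrite Re_plus_INR. pose proof (pos_INR L). lra. }
      assert (Hsj : (s - RtoC (INR j))%C <> 0) by (apply Csub_neq_0, Cneq_Re; rewrite re_RtoC; lra).
      field. repeat split; assumption.
    - intros i Hi. rewrite weight_mellin_basis by assumption. unfold rho. ring. }
  rewrite (Csumn_ext (fun i => beta i * (weight_mellin M n l nu i (s + 1) * Cpowr y (- (s + 1))))%C
    (fun i => (rho s * Cpowr y (- (s + 1))) * (beta i * basis_poly i s))%C).
  2: { intros i Hi. rewrite weight_mellin_basis by assumption. unfold rho. ring. }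
  rewrite Csumn_mult. fold (p s). rewrite (lagrange node n node_distinct p Hn Hpoly s).
  rewrite <- !Csumn_mult. apply Csumn_ext. intros k Hk. rewrite Hval by exact Hk.
  unfold s_factor. rewrite (Cprodn_node_prod node n k s Hk). fold (rho s).
  replace (- s - 1)%C with (- (s + 1))%C by ring.
  assert (Hsk : (s - node k)%C <> 0).
  { apply Csub_neq_0, Cneq_Re. unfold node. rewrite re_RtoC. pose proof (pos_INR (n - 1 - k)). lra. }
  field. split; [now apply node_prod_neq_0, Hk; apply node_distinct|exact Hsk].
Qed.

End KernelIntegrand.

Theorem proposition4p4 (M n l : nat) (nu : nat -> nat) (c : R)
    (P Q : nat -> R -> C) (sigma : R -> C) (a b : R) (x y : R)
    (hM : (1 <= M)%nat) (hn : (1 <= n)%nat) (hl : (1 <= l)%nat)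
    (hnu0 : nu 0%nat = 0%nat)
    (hln : (2 * n + nu 1%nat <= l)%nat)
    (hc : 0 < c)
    (hP : forall k, (k < n)%nat -> is_Pk (w M n l nu c) k (P k))
    (hQ : forall k, (k < n)%nat -> is_Qk (w M n l nu c) k (Q k))
    (hsigma : closed_contour sigma a b)
    (hencircle : forall j, (j <= n)%nat ->
       encircles_once sigma a b (RtoC (INR j)))
    (hRe : forall u, a <= u <= b -> - / 2 < Re (sigma u))
    (hx : 0 < x) (hy : 0 < y) :
  exists I : C,
    is_vint M
      (fun s => contour_int sigma a b (fun t => kernel_integrand M n l nu x y s t))
      (- / 2) I
    /\ kernel n P Q x y = (/ (twopii * twopii) * I)%C.
Proof.
  assert (HW : exists W : nat -> R -> C,
    forall k, (k < n)%nat -> mellin_pair M (weight_mellin M n l nu k) (W k)).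
  { apply (finite_choice (fun _ => RtoC 0) n
      (fun k W => mellin_pair M (weight_mellin M n l nu k) W)).
    intros k _. now apply weight_mellin_pair. }
  destruct HW as [W HW].
  destruct (kernel_reproducing M n l nu c P Q W x hn hln hc HW hP hQ) as [beta [HK Hbeta]].
  assert (HV : vline M (fun s => contour_int sigma a b (fun t => kernel_integrand M n l nu x y s t))
    (- / 2) (twopii * Csumn (fun i => beta i * (2 * PI * W i y)) n)%C).
  { apply (vline_ext _ (fun s => twopii * Csumn (fun i => beta i
       * (weight_mellin M n l nu i (s + 1) * Cpowr y (- (s + 1)))) n)%C).
    - intros u. symmetry.
      rewrite (contour_kernel_integrand M n l nu x y) by (assumption || reflexivity).
      now apply contour_value.
    - apply vline_mult.
      apply (vline_Csumn M (fun i s => beta i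
        * (weight_mellin M n l nu i (s + 1) * Cpowr y (- (s + 1))))%C).
      intros i Hi. apply vline_mult.
      apply (vline_shift M (fun s => weight_mellin M n l nu i s * Cpowr y (- s))%C).
      apply HW; lra || assumption. }
  exists (Ci * (twopii * Csumn (fun i => beta i * (2 * PI * W i y)) n))%C. split.
  - now apply vline_is_vint.
  - rewrite HK by exact hy.
    rewrite (Csumn_ext (fun i => beta i * (2 * PI * W i y))%C
      (fun i => (2 * PI) * (beta i * W i y))%C) by (intros; ring).
    rewrite Csumn_mult. pose proof twopii_neq_0 as H0.
    (* One [twopii] stems from the residues, the other from [Ci] along the upward line and the
       [2 PI] of the inversion formula. *)
    assert (E : (Ci * (2 * PI))%C = twopii) by (unfold twopii; ring).
    set (S := Csumn _ n).
    replace (Ci * (twopii * (2 * PI * S)))%C with ((Ci * (2 * PI)) * twopii * S)%C by ring.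
    rewrite E. field. exact H0.
Qed.
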